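(* Let $\alpha>0$ and let $\Psi:H^1(\mathbb L^2(\Omega))\times H^1(\mathcal X_c)\to\mathbb R$ be weakly lower semicontinuous, continuous and bounded from below. Then the optimal control problem $$\min\ J(\sigma,\ell):=\Psi(\sigma,\ell)+\frac\alpha2\|\dot\ell\|^2_{L^2(\mathcal X_c)}\quad\text{s.t. } \ell\in H^1_0(\mathcal X_c),\ \sigma\in H^1(\mathbb L^2(\Omega)),\ \sigma\text{ is a reduced solution of the state equation w.r.t. }u_D=\mathcal G\ell+\mathfrak a$$ has at least one global solution.
   Context: Notation. $T>0$ is fixed; for a Banach space $X$, $L^2(X)=L^2(0,T;X)$, $H^1(X)=H^1(0,T;X)$; a dot denotes the time derivative; operators act pointwise in time. $\Omega\subset\mathbb R^d$, $d\ge2$, is a bounded domain with Lipschitz boundary $\Gamma$, the disjoint union of a relatively open part $\Gamma_N$ and a relatively closed part $\Gamma_D$ of positive surface measure; $\Omega\cup\Gamma_N$ is regular in the sense of Gröger (each $x\in\partial\Omega$ has a neighborhood $U$ and a bi-Lipschitz map $\Phi$ such that $\Phi(U\cap(\Omega\cup\Gamma_N))$ is one of $\{|y|<1,y_d<0\}$, $\{|y|<1,y_d\le0\}$, $\{|y|<1,y_d\le 0,\ (y_d<0\text{ or }y_1>0)\}$). $\mathbb R^{d\times d}_s$ is the space of symmetric matrices, $\mathbb L^2(\Omega)=L^2(\Omega;\mathbb R^{d\times d}_s)$, $\mathbf H^1(\Omega)=H^1(\Omega;\mathbb R^d)$; $\mathbf H^1_D(\Omega)$ is the closure in $\mathbf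 H^1(\Omega)$ of $\{\psi|_\Omega:\psi\in C_c^\infty(\mathbb R^d;\mathbb R^d),\ \mathrm{supp}\,\psi\cap\Gamma_D=\emptyset\}$. $\nabla^s=\frac12(\nabla+\nabla^\top)$. $\mathbb C$ is a symmetric coercive linear map on $\mathbb R^{d\times d}_s$, $\mathbb A=\mathbb C^{-1}$. Stresses. $\mathcal E(\Omega)=\{\tau\in\mathbb L^2(\Omega):(\tau,\nabla^s\varphi)_{\mathbb L^2(\Omega)}=0\ \forall\varphi\in\mathbf H^1_D(\Omega)\}$. For a fixed closed convex $K\subset\mathbb R^{d\times d}_s$, $\mathcal K(\Omega)=\{\tau\in\mathbb L^2(\Omega):\tau(x)\in K\text{ for a.a. }x\}$. The initial stress satisfies $\sigma_0\in\mathcal E(\Omega)\cap\mathcal K(\Omega)$ and $\sigma_0\in L^{\overline p}(\Omega;\mathbb R^{d\times d}_s)$ for some fixed $\overline p>2$. Reduced solution. $\sigma\in H^1(\mathbb L^2(\Omega))$ is a reduced solution of the state equation with respect to $u_D\in H^1(\mathbf H^1(\Omega))$ if $\sigma(0)=\sigma_0$ and, for a.a. $t\in(0,T)$, $\sigma(t)\in\mathcal E(\Omega)\cap\mathcal K(\Omega)$ and $(\mathbb A\dot\sigma(t)-\nabla^s\dot u_D(t),\tau-\sigma(t))_{\mathbb L^2(\Omega)}\ge0$ for all $\tau\in\mathcal E(\Omega)\cap\mathcal K(\Omega)$. Controls. $\mathcal X$ is a real Banach space, $\mathcal X_c$ a Hilbert space compactly embedded in $\mathcal X$, $H^1_0(\mathcal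 X_c)=\{\ell\in H^1(\mathcal X_c):\ell(0)=\ell(T)=0\}$, $\mathcal G:\mathcal X\to\mathbf H^1(\Omega)$ is linear and continuous, and $\mathfrak a\in H^1(\mathbf H^1(\Omega))$ is fixed. *)

(* Defs.v *)
From HB Require Import structures.
From mathcomp Require Import all_boot all_order all_algebra ring_quotient.
From mathcomp Require Import all_classical all_reals all_analysis.
From mathcomp Require Import measurable_realfun ring lra.

Set Implicit Arguments.
Unset Strict Implicit.
Unset Printing Implicit Defensive.
Import Order.TTheory GRing.Theory Num.Theory.
Import numFieldNormedType.Exports.

Local Open Scope classical_set_scope.
Local Open Scope ring_scope.

Section lebesgue_tuple.
Context {R : realType}.
Notation tuple n := (n.-tuple (measurableTypeR R)).

Definition tuple_cons n (p : measurableTypeR R * tuple n) : tuple n.+1 :=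
  [tuple of p.1 :: p.2].

Lemma measurable_tuple_cons n : measurable_fun setT (@tuple_cons n).
Proof. exact: measurable_cons. Qed.

Section step_fun.
Context n (m : {sigma_finite_measure set (tuple n) -> \bar R}).

Definition lebesgue_step : set (tuple n.+1) -> \bar R :=
  pushforward (lebesgue_measure \x m)%E (@tuple_cons n).

HB.instance Definition _ := Measure.copy lebesgue_step
  (measure_function_pushforward__canonical__measure_function_Measure
     (lebesgue_measure \x m)%E (@measurable_tuple_cons n)).

Lemma sigma_finite_lebesgue_step : sigma_finite setT lebesgue_step.
Proof.
have /sigma_finiteP[F [FT ndF mF]] :
  sigma_finite setT (@lebesgue_measure R) by exact: sigma_finiteT.
have /sigma_finiteP[G [GT ndG mG]] : sigma_finite setT m by exact: sigma_finiteT.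
pose H k : set (tuple n.+1) :=
  [set t : tuple n.+1 | F k (thead t)] `&` [set t : tuple n.+1 | G k [tuple of behead t]].
have HE k : @tuple_cons n @^-1` H k = F k `*` G k.
  have bE (x : R) (t : tuple n) : [tuple of behead (tuple_cons (x, t))] = t.
    exact: val_inj.
  by apply/seteqP; split=> -[x t] /=; rewrite /H /= theadE bE.
exists H.
  apply/seteqP; split=> // t _.
  have [i _ Fi] : (\bigcup_k F k) (thead t) by rewrite -FT.
  have [j _ Gj] : (\bigcup_k G k) [tuple of behead t] by rewrite -GT.
  exists (maxn i j) => //; split => /=.
    by move/subsetPset: (ndF _ _ (leq_maxl i j)); exact.
  by move/subsetPset: (ndG _ _ (leq_maxr i j)); exact.
move=> k; have [mFk Fk] := mF k; have [mGk Gk] := mG k; split.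
  apply: measurableI; rewrite -[X in measurable X]setTI.
    apply: (@measurable_tnth _ (measurableTypeR R) n.+1 ord0) => //.
  apply: (@measurable_behead _ (measurableTypeR R) n) => //.
rewrite /lebesgue_step /pushforward HE product_measure1E//.
by rewrite lte_mul_pinfty// ge0_fin_numE.
Qed.

HB.instance Definition _ :=
  @Measure_isSigmaFinite.Build _ _ _ lebesgue_step sigma_finite_lebesgue_step.

End step_fun.

(* The n-fold product of the one-dimensional Lebesgue measure. *)
Fixpoint lebesgue_tuple n : {sigma_finite_measure set (tuple n) -> \bar R} :=
  if n is k.+1 return {sigma_finite_measure set (tuple n) -> \bar R}
  then lebesgue_step (lebesgue_tuple k)
  else dirac ([tuple] : tuple 0).

End lebesgue_tuple.

Section lebesgue_rV.
Context {R : realType} {d : nat}.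

Definition borel_rV := g_sigma_algebraType (@open 'rV[R]_d).

Definition row_of_tuple (t : d.-tuple (measurableTypeR R)) : borel_rV :=
  \row_i (tnth t i : R).

Lemma open_rV_boxes (A : set 'rV[R]_d) : open A -> A =
  \bigcup_(ab : {ffun 'I_d -> rat * rat}) 
    (if `[< [set v : 'rV[R]_d | forall i, v 0 i \in `]ratr (ab i).1, ratr (ab i).2[ ] `<=` A >]
    then [set v : 'rV[R]_d | forall i, v 0 i \in `]ratr (ab i).1, ratr (ab i).2[ ]
    else set0).
Proof.
move=> oA; apply/seteqP; split=> [v Av|v [ab _]]; last first.
  by case: ifPn => [/asboolP|//]; exact.
have /nbhs_ballP[e /= e0 eA] : nbhs v A by exact: open_nbhs_nbhs.
have lo i : {q : rat | ratr q \in `](v 0 i - e), (v 0 i)[ }.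
  apply/cid; apply: rat_in_itvoo.
  by rewrite ltrBlDr ltrDl.
have hi i : {q : rat | ratr q \in `](v 0 i), (v 0 i + e)[ }.
  apply/cid; apply: rat_in_itvoo.
  by rewrite ltrDl.
exists [ffun i => (sval (lo i), sval (hi i))] => //.
rewrite ifT /=.
  move=> i; rewrite ffunE/= in_itv/=.
  by have := svalP (lo i); have := svalP (hi i); rewrite !in_itv/= => /andP[-> _] /andP[_ ->].
apply/asboolP => w /= wab; apply: eA; split=> [|i j] /=; first exact: e0.
rewrite ord1; have := wab j; rewrite ffunE/= in_itv/= => /andP[w1 w2].
have := svalP (lo j); have := svalP (hi j); rewrite !in_itv/=.
move=> /andP[h1 h2] /andP[l1 l2].
rewrite /ball/= ltr_norml; apply/andP; split.
  by rewrite ltrBrDr addrC ltrBlDr (lt_trans w2).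
by rewrite ltrBlDr -ltrBlDl (lt_trans l1).
Qed.

Lemma measurable_row_of_tuple : measurable_fun setT row_of_tuple.
Proof.
apply: (@measurability _ _ (d.-tuple (measurableTypeR R)) borel_rV setT
  row_of_tuple (@open 'rV[R]_d) erefl) => //= _ [B oB <-]; rewrite setTI (open_rV_boxes oB).
rewrite preimage_bigcup; apply: countable_bigcupT_measurable => // ab.
case: ifPn => _; last by rewrite preimage_set0.
rewrite (_ : _ @^-1` _ = \bigcap_(i in [set: 'I_d]) [set t : d.-tuple (measurableTypeR R) |
    (tnth t i : R) \in `]ratr (ab i).1, ratr (ab i).2[ ]); last first.
  apply/seteqP; split=> t /= h i; first by move=> _; have := h i; rewrite mxE.
  by rewrite mxE; exact: h.
apply: fin_bigcap_measurable => // i _.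
rewrite -[X in measurable X]setTI.
exact: (@measurable_tnth _ (measurableTypeR R) d i measurableT _
  (measurable_itv _)).
Qed.

Definition lebesgue_rV : set borel_rV -> \bar R :=
  pushforward (lebesgue_tuple d) row_of_tuple.

HB.instance Definition _ := Measure.copy lebesgue_rV
  (measure_function_pushforward__canonical__measure_function_Measure
     (lebesgue_tuple d) measurable_row_of_tuple).

Lemma measurable_open_rV (A : set 'rV[R]_d) : open A ->
  (measurable : set (set borel_rV)) A.
Proof. exact: sub_sigma_algebra. Qed.

End lebesgue_rV.
Arguments borel_rV : clear implicits.

Section step_functions.
Context {dT} {T : measurableType dT} {R : realType}.
Variables (mu : {measure set T -> \bar R}) (V : normedModType R).
Implicit Types (l : seq (set T * V)) (f g : T -> V).

Definition step_fun l (x : T) : V := \sum_(p <- l) \1_(p.1) x *: p.2.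

Definition step_measurable l := {in l, forall p, measurable p.1}.

Definition step_integrable l :=
  {in l, forall p, measurable p.1 /\ (mu p.1 < +oo)%E}.

Definition step_integral l : V := \sum_(p <- l) fine (mu p.1) *: p.2.

(* The limit is required everywhere; an a.e. strongly measurable function agrees
   a.e. with such an f, so nothing is lost in the quotient L2 below. *)
Definition strongly_measurable f := exists s : nat -> seq (set T * V),
  (forall n, step_measurable (s n)) /\
  forall x, step_fun (s n) x @[n --> \oo] --> f x.

(* I is the Bochner integral of f: f is the a.e. limit of integrable step
   functions that form a Cauchy sequence in L^1 and whose integrals converge
   to I. *)
Definition bochner_integral f (I : V) := exists s : nat -> seq (set T * V),
  [/\ forall n, step_integrable (s n),
      {ae mu, forall x, step_fun (s n) x @[n --> \oo] --> f x},
      forall e : R, 0 < e -> exists N, forall m n, (N <= m)%N -> (N <= n)%N ->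
        (\int[mu]_x (`|step_fun (s m) x - step_fun (s n) x|)%:E < e%:E)%E &
      step_integral (s n) @[n --> \oo] --> I].

Definition scale_step (a : R) l := [seq (p.1, a *: p.2) | p <- l].

Lemma step_cat l1 l2 x : step_fun (l1 ++ l2) x = step_fun l1 x + step_fun l2 x.
Proof. by rewrite /step_fun big_cat. Qed.

Lemma step_scale a l x : step_fun (scale_step a l) x = a *: step_fun l x.
Proof.
rewrite /step_fun big_map scaler_sumr; apply: eq_bigr => p _ /=.
by rewrite !scalerA mulrC.
Qed.

Lemma step_integral_cat l1 l2 :
  step_integral (l1 ++ l2) = step_integral l1 + step_integral l2.
Proof. by rewrite /step_integral big_cat. Qed.

Lemma step_integral_scale a l :
  step_integral (scale_step a l) = a *: step_integral l.
Proof.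
rewrite /step_integral big_map scaler_sumr; apply: eq_bigr => p _ /=.
by rewrite !scalerA mulrC.
Qed.

Lemma step_measurable_cat l1 l2 :
  step_measurable l1 -> step_measurable l2 -> step_measurable (l1 ++ l2).
Proof. by move=> m1 m2 p; rewrite mem_cat => /orP[/m1|/m2]. Qed.

Lemma step_measurable_scale a l :
  step_measurable l -> step_measurable (scale_step a l).
Proof. by move=> m p /mapP[q /m mq ->]. Qed.

Lemma step_integrable_cat l1 l2 :
  step_integrable l1 -> step_integrable l2 -> step_integrable (l1 ++ l2).
Proof. by move=> m1 m2 p; rewrite mem_cat => /orP[/m1|/m2]. Qed.

Lemma step_integrable_scale a l :
  step_integrable l -> step_integrable (scale_step a l).
Proof. by move=> m p /mapP[q /m mq ->]. Qed.

Lemma step_integrableW l : step_integrable l -> step_measurable l.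
Proof. by move=> m p /m[]. Qed.

Lemma measurable_step_comp l (h : V -> R) : step_measurable l ->
  measurable_fun setT (h \o step_fun l).
Proof.
elim: l h => [|[A v] l IH] h ml.
  rewrite (_ : _ \o _ = cst (h 0)); first exact: measurable_cst.
  by apply/funext => x; rewrite /= /step_fun big_nil.
have mA : measurable A by apply: (ml (A, v)); rewrite inE eqxx.
have {}ml : step_measurable l by move=> p pl; apply: ml; rewrite inE pl orbT.
rewrite (_ : _ \o _ = fun x =>
    if x \in A then ((fun w => h (v + w)) \o step_fun l) x else (h \o step_fun l) x).
  apply: measurable_fun_ifT; [|exact: IH|exact: IH].
  apply: (measurable_fun_bool true); rewrite setTI.
  rewrite (_ : _ @^-1` _ = A)//; apply/seteqP.
  by split => x /=; [exact: set_mem|exact: mem_set].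
apply/funext => x /=; rewrite /step_fun big_cons /= indicE.
by case: ifP => _ /=; rewrite ?scale1r ?scale0r ?add0r.
Qed.

Lemma strongly_measurable_norm f : strongly_measurable f ->
  measurable_fun setT (fun x => `|f x|).
Proof.
move=> [s [ms sf]].
apply: (measurable_fun_cvg (h := fun n x => `|step_fun (s n) x|)) => [n|x _].
  exact: (measurable_step_comp (fun v => `|v|)).
by apply: cvg_norm; exact: sf.
Qed.

Lemma strongly_measurable0 : strongly_measurable (cst 0).
Proof.
exists (fun=> [::]); split=> // x.
under eq_fun do rewrite /step_fun big_nil; exact: cvg_cst.
Qed.

Lemma strongly_measurableD f g : strongly_measurable f ->
  strongly_measurable g -> strongly_measurable (f \+ g).
Proof.
move=> [s [ms sf]] [t [mt tg]]; exists (fun n => s n ++ t n); split.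
  by move=> n; exact: step_measurable_cat.
by move=> x; under eq_fun do rewrite step_cat; exact: cvgD.
Qed.

Lemma strongly_measurableZ a f : strongly_measurable f ->
  strongly_measurable (a \*: f).
Proof.
move=> [s [ms sf]]; exists (fun n => scale_step a (s n)); split.
  by move=> n; exact: step_measurable_scale.
by move=> x; under eq_fun do rewrite step_scale; exact: cvgZr.
Qed.

Lemma bochner_integral_ae f g I : {ae mu, forall x, f x = g x} ->
  bochner_integral f I -> bochner_integral g I.
Proof.
move=> fg [s [ms sf sc sI]]; exists s; split=> //.
by apply: filterS2 fg sf => x ->.
Qed.

Lemma bochner_integral0 : bochner_integral (cst 0) 0.
Proof.
have s0 x : step_fun [::] x = 0 by rewrite /step_fun big_nil.
exists (fun=> [::]); split=> //.
- by apply: aeW => x; under eq_fun do rewrite s0; exact: cvg_cst.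
- move=> e e0; exists 0%N => m n _ _.
  by under eq_integral do rewrite s0 subrr normr0; rewrite integral0 lte_fin.
- by rewrite /step_integral; under eq_fun do rewrite big_nil; exact: cvg_cst.
Qed.

Let measurable_dist l1 l2 : step_measurable l1 -> step_measurable l2 ->
  measurable_fun setT (fun x => (`|step_fun l1 x - step_fun l2 x|)%:E).
Proof.
move=> m1 m2; apply/measurable_EFinP.
have := measurable_step_comp (fun v => `|v|)
  (step_measurable_cat m1 (step_measurable_scale (a := -1) m2)).
congr (measurable_fun _ _); apply/funext => x /=.
by rewrite step_cat step_scale scaleN1r.
Qed.

Lemma bochner_integralD f g I J : bochner_integral f I ->
  bochner_integral g J -> bochner_integral (f \+ g) (I + J).
Proof.
move=> [s [ms sf sc sI]] [t [mt tg tc tJ]].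
exists (fun n => s n ++ t n); split.
- by move=> n; exact: step_integrable_cat.
- apply: filterS2 sf tg => x sfx tgx.
  by under eq_fun do rewrite step_cat; exact: cvgD.
- move=> e e0; have e2 : 0 < e / 2 by rewrite divr_gt0.
  have [N1 h1] := sc _ e2; have [N2 h2] := tc _ e2.
  exists (maxn N1 N2) => m n; rewrite !geq_max => /andP[a1 a2] /andP[b1 b2].
  rewrite [X in (_ < X%:E)%E]splitr EFinD.
  apply: le_lt_trans (lteD (h1 m n a1 b1) (h2 m n a2 b2)).
  rewrite -ge0_integralD//; [|exact/measurable_dist/step_integrableW/ms/step_integrableW/ms|
    exact/measurable_dist/step_integrableW/mt/step_integrableW/mt].
  apply: ge0_le_integral => //.
  + apply: measurable_dist; exact/step_measurable_cat/step_integrableW/mt/step_integrableW/ms.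
  + by apply: emeasurable_funD; apply: measurable_dist; apply: step_integrableW.
  + move=> x _; rewrite -EFinD lee_fin !step_cat opprD addrACA.
    exact: ler_normD.
- under eq_fun do rewrite step_integral_cat; exact: cvgD.
Qed.

Lemma bochner_integralZ a f I : bochner_integral f I ->
  bochner_integral (a \*: f) (a *: I).
Proof.
move=> [s [ms sf sc sI]]; exists (fun n => scale_step a (s n)); split.
- by move=> n; exact: step_integrable_scale.
- apply: filterS sf => x sfx.
  by under eq_fun do rewrite step_scale; exact: cvgZr.
- move=> e e0; have a1 : 0 < `|a| + 1 by rewrite ltr_wpDl.
  have [N h] := sc (e / (`|a| + 1)) (divr_gt0 e0 a1).
  exists N => m n Nm Nn.
  under eq_integral do
    rewrite !step_scale -scalerBr normrZ EFinM.
  rewrite ge0_integralZl//; last exact/measurable_dist/step_integrableW/ms/step_integrableW/ms.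
  have := h m n Nm Nn.
  set X := integral _ _ _ => Xe.
  have X0 : (0 <= X)%E by exact: integral_ge0.
  apply: (@le_lt_trans _ _ ((`|a| + 1)%:E * X)%E).
    by rewrite lee_wpmul2r// lee_fin lerDl.
  by rewrite muleC -lte_pdivlMr.
- under eq_fun do rewrite step_integral_scale; exact: cvgZr.
Qed.

End step_functions.

Section L2_functions.
Context {dT} {T : measurableType dT} {R : realType}.
Variables (mu : {measure set T -> \bar R}) (V : normedModType R).

Definition normE (f : T -> V) : T -> \bar R := EFin \o (fun x => `|f x|).

Definition is_L2 (f : T -> V) := strongly_measurable f /\
  ('N[mu]_2%:E[normE f] < +oo)%E.

Lemma normE_le (f g h : T -> V) : strongly_measurable f ->
  strongly_measurable g -> strongly_measurable h ->
  (forall x, `|h x| <= `|f x| + `|g x|) ->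
  ('N[mu]_2%:E[normE h] <= 'N[mu]_2%:E[normE f] + 'N[mu]_2%:E[normE g])%E.
Proof.
move=> /strongly_measurable_norm mf /strongly_measurable_norm mg.
move=> /strongly_measurable_norm mh hfg.
apply: (le_trans _ (@eminkowski _ _ _ mu _ _ 2%:E mf mg _)); last first.
  by rewrite lee_fin ler1n.
rewrite unlock /Lnorm gt0_ler_poweR ?in_itv/= ?invr_ge0//.
- by rewrite integral_ge0// ?leey.
- by rewrite integral_ge0// ?leey.
apply: ge0_le_integral => //.
- apply/measurable_EFinP; apply: (@measurableT_comp _ _ _ _ _ _ (@powR R ^~ 2)) => //.
  exact: measurableT_comp.
- apply/measurable_EFinP; apply: (@measurableT_comp _ _ _ _ _ _ (@powR R ^~ 2)) => //.
  by apply: measurableT_comp => //; exact: measurable_funD.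
- move=> x _; rewrite /= lee_fin ge0_ler_powR ?nnegrE//.
  by rewrite !ger0_norm ?addr_ge0.
Qed.

Lemma normE0 : ('N[mu]_2%:E[normE (cst 0%R)] = 0)%E.
Proof.
rewrite (_ : normE _ = cst 0%E); last by apply/funext => x; rewrite /normE/= normr0.
by rewrite Lnorm0// eqe pnatr_eq0.
Qed.

Lemma normEE (f : T -> V) : ('N[mu]_2%:E[normE f] =
  (\int[mu]_x (`|f x| `^ 2)%:E) `^ 2^-1)%E.
Proof.
rewrite Lnorm.unlock; congr poweR; apply: eq_integral => x _ /=.
by rewrite normr_id.
Qed.

Lemma normEZ a (f : T -> V) : strongly_measurable f ->
  ('N[mu]_2%:E[normE (a \*: f)] = `|a|%:E * 'N[mu]_2%:E[normE f])%E.
Proof.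
move=> /strongly_measurable_norm mf; rewrite !normEE.
under eq_integral => x _ do rewrite /= normrZ powRM// EFinM.
have m2 : measurable_fun setT (fun x => (`|f x| `^ 2)%:E).
  apply/measurable_EFinP.
  exact: (@measurableT_comp _ _ _ _ _ _ (@powR R ^~ 2)).
have f0 x : setT x -> (0 <= (`|f x| `^ 2)%:E)%E.
  by move=> _; rewrite lee_fin powR_ge0.
have a0 : (0 <= (`|a| `^ 2)%:E)%E by rewrite lee_fin powR_ge0.
rewrite (ge0_integralZl mu measurableT m2 f0)//.
have := @integral_ge0 _ _ _ mu setT _ f0.
move: (integral mu setT _) => I I0.
rewrite (poweRM _ a0 I0); congr (_ * _)%E.
by rewrite poweR_EFin -powRrM mulfV ?pnatr_eq0// powRr1.
Qed.

Lemma normE_ae (f g : T -> V) : strongly_measurable f ->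
  strongly_measurable g -> {ae mu, forall x, f x = g x} ->
  ('N[mu]_2%:E[normE f] = 'N[mu]_2%:E[normE g])%E.
Proof.
move=> /strongly_measurable_norm mf /strongly_measurable_norm mg fg.
have m (k : T -> R) : measurable_fun setT k ->
    measurable_fun setT (fun x => (k x `^ 2)%:E).
  move=> mk; apply/measurable_EFinP.
  exact: (@measurableT_comp _ _ _ _ _ _ (@powR R ^~ 2)).
rewrite !normEE; congr poweR.
have p0 (k : T -> R) x : setT x -> (0 <= (k x `^ 2)%:E)%E.
  by move=> _; rewrite lee_fin powR_ge0.
apply: (ge0_ae_eq_integral measurableT (m _ mf) (m _ mg) (p0 _) (p0 _)).
by apply: filterS fg => x fgx _; rewrite fgx.
Qed.

Definition L2_pred : {pred T -> V} := mem [set f | is_L2 f].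

Lemma L2_submod_closed : submod_closed L2_pred.
Proof.
split.
  rewrite inE; split; first exact: strongly_measurable0.
  by rewrite [X in (X < _)%E]normE0 ltry.
move=> a f g; rewrite !inE => -[mf f2] [mg g2].
have maf := strongly_measurableZ a mf.
have mh : strongly_measurable (a *: f + g) by exact: strongly_measurableD.
split=> //.
apply: (le_lt_trans (normE_le maf mg mh _)).
  by move=> x; exact: ler_normD.
rewrite lte_add_pinfty// normEZ// lte_mul_pinfty// lee_fin//.
Qed.

HB.instance Definition _ := GRing.isSubmodClosed.Build _ _ L2_pred
  L2_submod_closed.

Record L2fun := MkL2fun { L2fun_val :> T -> V; _ : L2fun_val \in L2_pred }.

HB.instance Definition _ := [isSub for L2fun_val].
HB.instance Definition _ := [Choice of L2fun by <:].
HB.instance Definition _ := [SubChoice_isSubLmodule of L2fun by <:].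

Definition L2_null : {pred L2fun} :=
  mem [set f : L2fun | {ae mu, forall x, f x = 0}].

Lemma L2_null_zmod_closed : zmod_closed L2_null.
Proof.
split; first by rewrite inE; apply: aeW => x.
move=> f g; rewrite !inE => f0 g0; apply: filterS2 f0 g0 => x fx gx.
by have -> : (f - g) x = f x - g x by []; rewrite fx gx subr0.
Qed.

HB.instance Definition _ := GRing.isZmodClosed.Build _ L2_null
  L2_null_zmod_closed.

(* Lebesgue-Bochner space L^2(mu; V): square integrable functions modulo a.e.
   equality. Its elements are applied to points through a chosen representative. *)
Definition L2 := Quotient.quot L2_null.

HB.instance Definition _ := GRing.Zmodule.on L2.
HB.instance Definition _ := EqQuotient.on L2.

Local Open Scope quotient_scope.

Definition L2_repr (u : L2) : T -> V := repr u.

Lemma L2_reprP (u : L2) : is_L2 (L2_repr u).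
Proof. by have := valP (repr u); rewrite /= inE. Qed.

Lemma L2_eqP (f g : L2fun) : reflect {ae mu, forall x, f x = g x}
  (\pi_L2 f == \pi_L2 g).
Proof.
rewrite -Quotient.idealrBE; apply: (iffP idP); rewrite inE.
  apply: filterS => x; have -> : (f - g) x = f x - g x by [].
  exact: subr0_eq.
apply: filterS => x; have -> : (f - g) x = f x - g x by [].
by move=> ->; rewrite subrr.
Qed.

Lemma L2_repr_pi (f : L2fun) : {ae mu, forall x, L2_repr (\pi_L2 f) x = f x}.
Proof. by apply/L2_eqP; rewrite reprK. Qed.

Lemma L2_reprD (u v : L2) :
  {ae mu, forall x, L2_repr (u + v) x = L2_repr u x + L2_repr v x}.
Proof.
have -> : u + v = \pi_L2 (repr u + repr v) by rewrite Quotient.pi_add !reprK.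
exact: L2_repr_pi.
Qed.

Definition L2_scale (a : R) (u : L2) : L2 := \pi_L2 (a *: repr u).

Lemma L2_reprZ_subproof a u :
  {ae mu, forall x, L2_repr (L2_scale a u) x = a *: L2_repr u x}.
Proof. exact: L2_repr_pi. Qed.

Lemma L2_ext (u v : L2) : {ae mu, forall x, L2_repr u x = L2_repr v x} -> u = v.
Proof. by move=> uv; rewrite -[u]reprK -[v]reprK; apply/eqP/L2_eqP. Qed.

Lemma L2_scaleA a b u : L2_scale a (L2_scale b u) = L2_scale (a * b) u.
Proof.
apply: L2_ext; have h := L2_reprZ_subproof.
apply: filterS3 (h a (L2_scale b u)) (h b u) (h (a * b) u) => x -> -> ->.
by rewrite scalerA.
Qed.

Lemma L2_scale1 : left_id 1 L2_scale.
Proof.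
move=> u; apply: L2_ext; apply: filterS (L2_reprZ_subproof 1 u) => x ->.
by rewrite scale1r.
Qed.

Lemma L2_scaleDr : right_distributive L2_scale +%R.
Proof.
move=> a u v; apply: L2_ext; have h := L2_reprZ_subproof.
have e : {ae mu, forall x, L2_repr (L2_scale a u + L2_scale a v) x =
    a *: (L2_repr u x + L2_repr v x)}.
  apply: filterS3 (L2_reprD (L2_scale a u) (L2_scale a v)) (h a u) (h a v).
  by move=> x -> -> ->; rewrite scalerDr.
by apply: filterS3 (h a (u + v)) (L2_reprD u v) e => x -> -> ->.
Qed.

Lemma L2_scaleDl u : {morph L2_scale^~ u : a b / a + b}.
Proof.
move=> a b; apply: L2_ext; have h := L2_reprZ_subproof.
have e : {ae mu, forall x, L2_repr (L2_scale a u + L2_scale b u) x =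
    a *: L2_repr u x + b *: L2_repr u x}.
  apply: filterS3 (L2_reprD (L2_scale a u) (L2_scale b u)) (h a u) (h b u).
  by move=> x -> -> ->.
by apply: filterS2 (h (a + b) u) e => x -> ->; rewrite scalerDl.
Qed.

HB.instance Definition _ := GRing.Zmodule_isLmodule.Build R L2
  L2_scaleA L2_scale1 L2_scaleDr L2_scaleDl.

Lemma L2_reprZ a (u : L2) :
  {ae mu, forall x, L2_repr (a *: u) x = a *: L2_repr u x}.
Proof. exact: L2_reprZ_subproof. Qed.

Lemma L2_repr0 : {ae mu, forall x, L2_repr 0 x = 0}.
Proof. by apply: filterS (L2_reprZ 0 0) => x; rewrite !scale0r. Qed.

Definition L2_norm (u : L2) : R := fine ('N[mu]_2%:E[normE (L2_repr u)])%E.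

Lemma L2_normE u : ((L2_norm u)%:E = 'N[mu]_2%:E[normE (L2_repr u)])%E.
Proof.
rewrite /L2_norm fineK// ge0_fin_numE ?Lnorm_ge0//.
by have [] := L2_reprP u.
Qed.

Lemma L2_normD u v : L2_norm (u + v) <= L2_norm u + L2_norm v.
Proof.
have [[[mu_ _] [mv_ _]] [mw_ _]] := (L2_reprP u, L2_reprP v, L2_reprP (u + v)).
rewrite -lee_fin EFinD !L2_normE.
have muv := strongly_measurableD mu_ mv_.
rewrite (normE_ae mw_ muv (L2_reprD u v)).
by apply: normE_le => // x; exact: ler_normD.
Qed.

Lemma L2_normZ a u : L2_norm (a *: u) = `|a| * L2_norm u.
Proof.
have [[mu_ _] [mw_ _]] := (L2_reprP u, L2_reprP (a *: u)).
apply: EFin_inj; rewrite EFinM !L2_normE -normEZ//.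
by apply: normE_ae => //; [exact: strongly_measurableZ|exact: L2_reprZ].
Qed.

Lemma L2_norm0_eq0 u : L2_norm u = 0 -> u = 0.
Proof.
move=> u0; have [mu_ _] := L2_reprP u.
have /Lnorm_eq0_eq0 : ('N[mu]_2%:E[normE (L2_repr u)] = 0)%E.
  by rewrite -L2_normE u0.
have mn : measurable_fun setT (normE (L2_repr u)).
  by apply/measurable_EFinP; exact: strongly_measurable_norm.
move=> /(_ mn (lte0n 2)) h; rewrite -(scale0r u); apply: L2_ext.
apply: filterS2 h (L2_reprZ 0 u) => x /(_ I) [ux] ->.
by rewrite scale0r; apply/normr0_eq0.
Qed.

HB.instance Definition _ := Lmodule_isNormed.Build R L2
  L2_normD L2_normZ L2_norm0_eq0.

End L2_functions.

Coercion L2_repr : L2 >-> Funclass.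

Section frobenius.
Context {R : realType} {m n : nat}.
Implicit Types A B C : 'M[R]_(m, n).

Definition frob A B : R := \sum_i \sum_j A i j * B i j.

Definition enorm A : R := Num.sqrt (frob A A).

Lemma frobC A B : frob A B = frob B A.
Proof. by do 2!apply: eq_bigr => ? _; rewrite mulrC. Qed.

Lemma frobDl A B C : frob (A + B) C = frob A C + frob B C.
Proof.
rewrite /frob -big_split/=; apply: eq_bigr => i _.
by rewrite -big_split/=; apply: eq_bigr => j _; rewrite mxE mulrDl.
Qed.

Lemma frobZl a A B : frob (a *: A) B = a * frob A B.
Proof.
rewrite /frob mulr_sumr; apply: eq_bigr => i _.
by rewrite mulr_sumr; apply: eq_bigr => j _; rewrite mxE mulrA.
Qed.

Lemma frob_ge0 A : 0 <= frob A A.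
Proof. by do 2!apply: sumr_ge0 => ? _; rewrite -expr2 sqr_ge0. Qed.

Lemma frob_eq0 A : frob A A = 0 -> A = 0.
Proof.
move=> /eqP; rewrite psumr_eq0; last first.
  by move=> i _; apply: sumr_ge0 => j _; rewrite -expr2 sqr_ge0.
move=> /allP A0; apply/matrixP => i j; rewrite mxE.
have := A0 i (mem_index_enum _); rewrite psumr_eq0; last first.
  by move=> k _; rewrite -expr2 sqr_ge0.
by move=> /allP/(_ j (mem_index_enum _)); rewrite /= mulf_eq0 orbb => /eqP.
Qed.

Lemma frob_CS A B : frob A B <= enorm A * enorm B.
Proof.
rewrite -sqrtrM ?frob_ge0//.
have [B0|Bn0] := eqVneq (frob B B) 0.
  rewrite (frob_eq0 B0) -(scale0r 0) frobC frobZl mul0r.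
  by rewrite sqrtr_ge0.
have B0 : 0 < frob B B by rewrite lt0r Bn0 frob_ge0.
have := frob_ge0 (frob B B *: A + (- frob A B) *: B).
rewrite frobDl !frobZl ![frob _ (_ + _)]frobC !frobDl !frobZl (frobC B A).
move=> h; apply: (le_trans (ler_norm _)); rewrite -sqrtr_sqr ler_wsqrtr//.
by rewrite -(ler_pM2l B0); nra.
Qed.

Lemma enormD A B : enorm (A + B) <= enorm A + enorm B.
Proof.
have a0 := sqrtr_ge0 (frob A A); have b0 := sqrtr_ge0 (frob B B).
have sA := sqr_sqrtr (frob_ge0 A); have sB := sqr_sqrtr (frob_ge0 B).
have cs := frob_CS A B.
rewrite -[leRHS]ger0_norm ?addr_ge0// -sqrtr_sqr ler_wsqrtr//.
rewrite frobDl ![frob _ (_ + _)]frobC !frobDl (frobC B A).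
move: cs sA sB; rewrite /enorm; nra.
Qed.

Lemma enormZ a A : enorm (a *: A) = `|a| * enorm A.
Proof.
rewrite /enorm frobZl frobC frobZl mulrA -expr2 sqrtrM ?sqr_ge0//.
by rewrite sqrtr_sqr.
Qed.

Lemma enorm_eq0 A : enorm A = 0 -> A = 0.
Proof.
move=> /eqP; rewrite sqrtr_eq0 => A0; apply: frob_eq0; apply/eqP.
by rewrite eq_le A0 frob_ge0.
Qed.

End frobenius.

(* Matrices with the Frobenius norm, as opposed to the maximum norm that the
   library puts on matrices. *)
Definition eucl (R : realType) (m n : nat) := 'M[R]_(m, n).

HB.instance Definition _ (R : realType) m n := GRing.Lmodule.on (eucl R m n).
HB.instance Definition _ (R : realType) m n :=
  Lmodule_isNormed.Build R (eucl R m n) enormD enormZ enorm_eq0.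

Section symmetric_matrices.
Context {R : realType} {d : nat}.

Definition sym_pred : {pred 'M[R]_d} := [pred A | A^T == A].

Lemma sym_submod_closed : submod_closed sym_pred.
Proof.
split; first by rewrite inE trmx0.
by move=> a A B; rewrite !inE => /eqP hA /eqP hB; rewrite linearP/= hA hB.
Qed.

HB.instance Definition _ := GRing.isSubmodClosed.Build _ _ sym_pred
  sym_submod_closed.

Record sym := Sym { sym_val :> 'M[R]_d; sym_valP : sym_val \in sym_pred }.

HB.instance Definition _ := [isSub for sym_val].
HB.instance Definition _ := [Choice of sym by <:].
HB.instance Definition _ := [SubChoice_isSubLmodule of sym by <:].

Lemma sym_normD (A B : sym) : enorm (A + B : sym) <= enorm A + enorm B.
Proof. exact: enormD. Qed.

Lemma sym_normZ a (A : sym) : enorm (a *: A : sym) = `|a| * enorm A.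
Proof. exact: enormZ. Qed.

Lemma sym_norm_eq0 (A : sym) : enorm A = 0 -> A = 0.
Proof. by move=> /enorm_eq0 A0; apply: val_inj. Qed.

HB.instance Definition _ :=
  Lmodule_isNormed.Build R sym sym_normD sym_normZ sym_norm_eq0.

Lemma sym_part_subproof (A : 'M[R]_d) : 2^-1 *: (A + A^T) \in sym_pred.
Proof. by rewrite inE linearZ/= linearD/= trmxK addrC. Qed.

Definition sym_part (A : 'M[R]_d) : sym := Sym (sym_part_subproof A).

End symmetric_matrices.
Arguments sym : clear implicits.

Section graph_space.
Context {R : realType} {V W : normedModType R}.
Variable S : submodClosed (V * W)%type.

(* A subspace of V * W with the norm (|v|^2 + |w|^2)^(1/2); used for the pairs
   made of a function and its weak derivative, which is unique. *)
Record graph_space := GraphSpace {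
  graph_val :> V * W; graph_valP : graph_val \in S }.

HB.instance Definition _ := [isSub for graph_val].
HB.instance Definition _ := [Choice of graph_space by <:].
HB.instance Definition _ := [SubChoice_isSubLmodule of graph_space by <:].

Definition graph_norm (u : graph_space) : R :=
  Num.sqrt (`|u.1| ^+ 2 + `|u.2| ^+ 2).

Lemma graph_normD u v : graph_norm (u + v) <= graph_norm u + graph_norm v.
Proof.
have := enormD (\row_(i < 2) nth 0 [:: `|u.1|; `|u.2|] i : 'rV[R]_2)
               (\row_(i < 2) nth 0 [:: `|v.1|; `|v.2|] i).
rewrite /enorm /frob !big_ord1 !big_ord_recl !big_ord0 !mxE /= !addr0 -!expr2.
apply: le_trans; rewrite ler_wsqrtr//.
by rewrite lerD// ler_sqr ?nnegrE ?addr_ge0// ler_normD.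
Qed.

Lemma graph_normZ a u : graph_norm (a *: u) = `|a| * graph_norm u.
Proof.
rewrite /graph_norm /= !normrZ !exprMn -mulrDr sqrtrM ?sqr_ge0//.
by rewrite sqrtr_sqr normr_id.
Qed.

Lemma graph_norm_eq0 u : graph_norm u = 0 -> u = 0.
Proof.
move=> /eqP; rewrite sqrtr_eq0 => h.
have s1 := sqr_ge0 `|u.1|; have s2 := sqr_ge0 `|u.2|.
have u1 : u.1 = 0.
  by apply/normr0_eq0/eqP; rewrite -sqrf_eq0 eq_le s1 (le_trans _ h)// lerDl.
have u2 : u.2 = 0.
  by apply/normr0_eq0/eqP; rewrite -sqrf_eq0 eq_le s2 (le_trans _ h)// lerDr.
by apply: val_inj => /=; rewrite [graph_val u]surjective_pairing u1 u2.
Qed.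

HB.instance Definition _ := Lmodule_isNormed.Build R graph_space
  graph_normD graph_normZ graph_norm_eq0.

End graph_space.

Definition support_of (X : topologicalType) (V : zmodType) (f : X -> V) : set X :=
  closure [set x | f x != 0].

Section bochner_sobolev_time.
Context {R : realType}.
Variable T : R.

Definition time_measure : {measure set (measurableTypeR R) -> \bar R} :=
  mrestr lebesgue_measure (measurable_itv `]0, T[).

Definition time_test (phi : R -> R) :=
  [/\ forall n t, derivable (derive1n n phi) t 1,
      compact (support_of phi) & support_of phi `<=` `]0, T[ ].

Variable V : normedModType R.

Definition weak_dt (u v : L2 time_measure V) := forall phi, time_test phi ->
  exists I : V, bochner_integral time_measure (fun t => derive1 phi t *: u t) I /\
                bochner_integral time_measure (fun t => phi t *: v t) (- I).

Definition weak_dt_pred : {pred (L2 time_measure V * L2 time_measure V)%type} :=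
  mem [set p | weak_dt p.1 p.2].

Lemma weak_dt_submod_closed : submod_closed weak_dt_pred.
Proof.
split.
  rewrite inE => phi _; exists 0; rewrite oppr0.
  have h (psi : R -> R) : bochner_integral time_measure
      (fun t => psi t *: (0 : L2 time_measure V) t) 0.
    apply: bochner_integral_ae (bochner_integral0 time_measure V).
    by apply: filterS (L2_repr0 time_measure V) => t ->; rewrite scaler0.
  by split; exact: h.
move=> a p q; rewrite !inE => hp hq phi tphi.
have [I [I1 I2]] := hp phi tphi; have [J [J1 J2]] := hq phi tphi.
have h (psi : R -> R) (u v : L2 time_measure V) K L :
    bochner_integral time_measure (fun t => psi t *: u t) K ->
    bochner_integral time_measure (fun t => psi t *: v t) L ->
    bochner_integral time_measure (fun t => psi t *: L2_repr (a *: u + v) t) (a *: K + L).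
  move=> hK hL.
  apply: bochner_integral_ae (bochner_integralD (bochner_integralZ a hK) hL).
  apply: filterS2 (L2_reprD (a *: u) v) (L2_reprZ a u) => t -> ->.
  by rewrite /= scalerDr !scalerA mulrC.
exists (a *: I + J); split; first exact: h.
by rewrite opprD -scalerN; exact: h.
Qed.

HB.instance Definition _ := GRing.isSubmodClosed.Build _ _ weak_dt_pred
  weak_dt_submod_closed.

(* H^1(0, T; V): an element is the pair of a function and its time derivative. *)
Definition H1_time := graph_space weak_dt_pred.

HB.instance Definition _ := NormedModule.on H1_time.

Definition H1_time_fun (u : H1_time) : L2 time_measure V := u.1.

Definition H1_time_dot (u : H1_time) : L2 time_measure V := u.2.

(* The continuous representative of u takes the value x at t. *)
Definition H1_time_at (u : H1_time) (t : R) (x : V) := exists g : R -> V,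
  [/\ {within `[0, T], continuous g},
      {ae time_measure, forall s, H1_time_fun u s = g s} & g t = x].

End bochner_sobolev_time.

Section space.
Context {R : realType} {d : nat}.
Implicit Types (Omega : set 'rV[R]_d).

Definition basis_vec (j : 'I_d) : 'rV[R]_d := delta_mx 0 j.

Fixpoint partials (s : seq 'I_d) (f : 'rV[R]_d -> R) : 'rV[R]_d -> R :=
  if s is j :: s' then fun x => 'D_(basis_vec j) (partials s' f) x else f.

Definition smooth (f : 'rV[R]_d -> R) := forall s, continuous (partials s f) /\
  forall j x, derivable (partials s f) x (basis_vec j).

Definition space_test Omega (phi : 'rV[R]_d -> R) :=
  [/\ smooth phi, compact (support_of phi) & support_of phi `<=` Omega].

Section domain.
Context {Omega : set 'rV[R]_d}.
Variable oO : open Omega.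

Definition domain_measure : {measure set (borel_rV R d) -> \bar R} :=
  mrestr lebesgue_rV (measurable_open_rV oO).

Notation L2s := (L2 domain_measure (sym R d)).
Notation Lvec := (L2 domain_measure (eucl R 1 d)).
Notation Lmat := (L2 domain_measure (eucl R d d)).

Definition colT (j : 'I_d) (A : eucl R d d) : eucl R 1 d := (col j A)^T.

(* G i j is the weak derivative of the i-th component in direction j. *)
Definition weak_grad (u : Lvec) (G : Lmat) :=
  forall phi, space_test Omega phi -> forall j, exists I : eucl R 1 d,
    bochner_integral domain_measure (fun x => 'D_(basis_vec j) phi x *: u x) I /\
    bochner_integral domain_measure (fun x => phi x *: colT j (G x)) (- I).

Definition weak_grad_pred : {pred (Lvec * Lmat)%type} :=
  mem [set p | weak_grad p.1 p.2].

Lemma weak_grad_submod_closed : submod_closed weak_grad_pred.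
Proof.
have colTD j (A B : eucl R d d) a : colT j (a *: A + B) = a *: colT j A + colT j B.
  by rewrite /colT !linearP.
split.
  rewrite inE => phi _ j; exists 0; rewrite oppr0; split.
    apply: bochner_integral_ae (bochner_integral0 domain_measure _).
    by apply: filterS (L2_repr0 domain_measure (eucl R 1 d)) => t ->; rewrite scaler0.
  apply: bochner_integral_ae (bochner_integral0 domain_measure _).
  have c0 : colT j 0 = 0 by apply/matrixP => k l; rewrite !mxE.
  by apply: filterS (L2_repr0 domain_measure (eucl R d d)) => t ->; rewrite c0 scaler0.
move=> a p q; rewrite !inE => hp hq phi tphi j.
have [I [I1 I2]] := hp phi tphi j; have [J [J1 J2]] := hq phi tphi j.
exists (a *: I + J); rewrite opprD -scalerN; split.
  apply: bochner_integral_ae (bochner_integralD (bochner_integralZ a I1) J1).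
  apply: filterS2 (L2_reprD (a *: p.1) q.1) (L2_reprZ a p.1) => t -> ->.
  by rewrite /= scalerDr !scalerA mulrC.
apply: bochner_integral_ae (bochner_integralD (bochner_integralZ a I2) J2).
apply: filterS2 (L2_reprD (a *: p.2) q.2) (L2_reprZ a p.2) => t -> ->.
by rewrite /= colTD scalerDr !scalerA mulrC.
Qed.

HB.instance Definition _ := GRing.isSubmodClosed.Build _ _ weak_grad_pred
  weak_grad_submod_closed.

Definition H1_domain := graph_space weak_grad_pred.

HB.instance Definition _ := NormedModule.on H1_domain.

Definition H1_domain_fun (u : H1_domain) : Lvec := u.1.

Definition H1_domain_grad (u : H1_domain) : Lmat := u.2.

Definition sym_grad (u : H1_domain) (x : 'rV[R]_d) : sym R d := sym_part (H1_domain_grad u x).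

(* Closure in H^1; the weak gradient of v is determined by its values. *)
Definition H1_D (GammaD : set 'rV[R]_d) : set H1_domain :=
  closure [set v : H1_domain | exists psi : 'rV[R]_d -> 'rV[R]_d,
    [/\ forall i, smooth (fun x => psi x 0 i),
        compact (support_of psi),
        support_of psi `&` GammaD = set0 &
        {ae domain_measure, forall x, H1_domain_fun v x = psi x}]].

Definition in_equilibrium (GammaD : set 'rV[R]_d) : set L2s :=
  [set tau : L2s | forall phi, H1_D GammaD phi ->
    \int[domain_measure]_x frob (tau x) (sym_grad phi x) = 0].

Definition plastically_admissible (K : set (sym R d)) : set L2s :=
  [set tau : L2s | {ae domain_measure, forall x, K (tau x)}].

Definition reduced_solution (T : R) (A : sym R d -> sym R d)
    (GammaD : set 'rV[R]_d) (K : set (sym R d)) (sigma0 : L2s)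
    (sigma : H1_time T L2s) (uD : H1_time T H1_domain) :=
  let EK := in_equilibrium GammaD `&` plastically_admissible K in
  H1_time_at sigma 0 sigma0 /\
  {ae time_measure T, forall t,
    let sigma_t : L2s := H1_time_fun sigma t in
    let dsigma_t : L2s := H1_time_dot sigma t in
    let duD_t : H1_domain := H1_time_dot uD t in
    EK sigma_t /\
    forall tau : L2s, EK tau ->
      0 <= \int[domain_measure]_x
             frob (A (dsigma_t x) - sym_grad duD_t x) (tau x - sigma_t x)}.

End domain.
End space.

Section geometry.
Context {R : realType} {d : nat}.
Notation point := 'rV[R]_d.
Implicit Types (Omega A : set point).

Definition boundary Omega : set point := closure Omega `\` Omega°.

(* Near each boundary point Omega is, in a suitable orthonormal frame with last
   vector e, the strict subgraph of a Lipschitz function of the component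
   orthogonal to e. *)
Definition lipschitz_boundary Omega := forall x, boundary Omega x ->
  exists (e : point) (g : point -> R),
    [/\ enorm e = 1, [lipschitz g y | y in setT] &
        \forall y \near x, Omega y <-> frob y e < g (y - frob y e *: e)].

Definition ediam A : \bar R :=
  ereal_sup [set r | r = 0%E \/
                     exists x y, [/\ A x, A y & r = (enorm (x - y))%:E]].

Definition hausdorff_content (s : nat) (delta : R) A : \bar R :=
  ereal_inf [set r | exists U : nat -> set point,
    [/\ A `<=` \bigcup_i U i, forall i, (ediam (U i) <= delta%:E)%E &
        r = (\sum_(0 <= i <oo) (ediam (U i)) ^+ s)%E]].

(* Without the usual normalizing constant: on the boundary of a Lipschitz domain
   the (d-1)-dimensional one is a positive multiple of the surface measure. *)
Definition hausdorff_measure (s : nat) A : \bar R :=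
  ereal_sup [set hausdorff_content s delta A | delta in [set r : R | 0 < r]].

(* Zero-based coordinates: the first one is 0 and the last one is d.-1. *)
Definition point_coord (y : point) (k : nat) : R := oapp (y 0) 0 (insub k).

Definition groger_open : set point :=
  [set y | enorm y < 1 /\ point_coord y d.-1 < 0].

Definition groger_closed : set point :=
  [set y | enorm y < 1 /\ point_coord y d.-1 <= 0].

Definition groger_mixed : set point :=
  [set y | [/\ enorm y < 1, point_coord y d.-1 <= 0 &
               point_coord y d.-1 < 0 \/ 0 < point_coord y 0]].

Definition bilipschitz_on (U : set point) (Phi : point -> point) :=
  exists2 L : R, 0 < L & forall y z, U y -> U z ->
    enorm (Phi y - Phi z) <= L * enorm (y - z) /\
    enorm (y - z) <= L * enorm (Phi y - Phi z).

Definition groger_regular Omega (GammaN : set point) :=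
  forall x, boundary Omega x -> exists (U : set point) (Phi : point -> point),
    [/\ nbhs x U, bilipschitz_on U Phi &
        let M := Phi @` (U `&` (Omega `|` GammaN)) in
        [\/ M = groger_open, M = groger_closed | M = groger_mixed]].

End geometry.

Section functional_analysis.
Context {R : realType}.

Definition is_hilbert (V : completeNormedModType R) :=
  exists ip : V -> V -> R,
    [/\ forall u v, ip u v = ip v u,
        forall a u v w, ip (a *: u + v) w = a * ip u w + ip v w &
        forall u, ip u u = `|u| ^+ 2].

Definition compact_embedding (V W : normedModType R) (iota : V -> W) :=
  [/\ injective iota, continuous iota &
      compact (closure (iota @` [set v | `|v| <= 1]))].

Definition weak_cvg (V : normedModType R) (u : nat -> V) (l : V) :=
  forall f : {linear V -> R^o}, continuous f -> f (u n) @[n --> \oo] --> f l.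

(* Sequential weak lower semicontinuity, which is implied by lower
   semicontinuity for the weak topology. *)
Definition weakly_lsc (V : normedModType R) (F : V -> R) :=
  forall u l, weak_cvg u l ->
    ((F l)%:E <= limn_einf (fun n => (F (u n))%:E))%E.

Definition sym_coercive d (C : sym R d -> sym R d) :=
  (forall A B : sym R d, frob (C A) B = frob A (C B)) /\
  exists2 c : R, 0 < c & forall A, c * `|A| ^+ 2 <= frob (C A) A.

End functional_analysis.

Section control_problem.
Context {R : realType} {d : nat} {Omega : set 'rV[R]_d}.
Variables (T : R) (oO : open Omega) (X Xc : normedModType R).
Notation stress := (L2 (domain_measure oO) (sym R d)).

Definition H10_time (l : H1_time T Xc) := H1_time_at l 0 0 /\ H1_time_at l T 0.

(* u_D = G l + a, with G and the embedding iota acting pointwise in time. *)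
Definition dirichlet_data (G : X -> H1_domain oO) (iota : Xc -> X)
    (a : H1_time T (H1_domain oO)) (l : H1_time T Xc) (uD : H1_time T (H1_domain oO)) :=
  {ae time_measure T, forall t,
    H1_time_fun uD t = G (iota (H1_time_fun l t)) + H1_time_fun a t}.

Definition admissible G iota a A GammaD K (sigma0 : stress)
    (sigma : H1_time T stress) (l : H1_time T Xc) :=
  H10_time l /\ exists uD, dirichlet_data G iota a l uD /\
                        reduced_solution A GammaD K sigma0 sigma uD.

Definition cost (alpha : R) (Psi : (H1_time T stress * H1_time T Xc)%type -> R)
    (sigma : H1_time T stress) (l : H1_time T Xc) : R :=
  Psi (sigma, l) + alpha / 2 * `|H1_time_dot l| ^+ 2.

End control_problem.

(* Main.v *)
(** Direct method. Along a minimizing sequence the controls l_n are bounded in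
H^1, because the cost controls the time derivative and l_n(0) = 0, and the
stresses are bounded because the coercivity of A bounds the time derivative of
the solution by that of the strain U_n = (symmetric gradient of G l_n + a).
Extract weakly convergent subsequences. Traces at a fixed time are weakly
convergent, so the compact embedding makes U_n(t) converge strongly for every t,
hence U_n converges strongly in L^2 by domination. This suffices to pass to the
limit in the variational inequality integrated in time: the product of the
derivative of U_n with sigma_n is integrated by parts, where U_n(0) and U_n(T)
are fixed since l_n vanishes there, and the quadratic term is half the increment
of the energy ip (A sigma) sigma, which is lower semicontinuous. The same
passage to the limit, applied to the implicit Euler scheme, produces reduced
solutions, so that the feasible set is not empty, and together with uniqueness
it yields the a priori bound. *)

Require Import Defs.
From HB Require Import structures.
From mathcomp Require Import all_boot all_order all_algebra.
From mathcomp Require Import all_classical all_reals all_analysis.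
From mathcomp Require Import measurable_realfun ring lra.

Set Implicit Arguments.
Unset Strict Implicit.
Unset Printing Implicit Defensive.
Import Order.TTheory GRing.Theory Num.Theory.
Import numFieldNormedType.Exports.

Local Open Scope classical_set_scope.
Local Open Scope ring_scope.

(** * Hilbert spaces *)

(** Everything is reduced to Hilbert space arguments. One tool, minimization of a coercive quadratic
    functional over a closed convex set, supplies the Riesz theorem, projections and the implicit
    Euler step. The spaces in time are given by weak derivatives tested with Bochner integrals,
    whereas the argument lives on traces and on integration by parts up to intermediate times. The
    bridge is the du Bois-Reymond lemma, by which every element of H^1 is a constant plus a
    primitive, the primitive being itself defined by duality. The state equation becomes an
    evolution inequality in the Hilbert space of stresses, driven by the strain alone, so weak
    limits are taken only among stresses, strains and controls. The obstacle in every limit is that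
    the rates of stress and strain converge only weakly. The bound of the stress rate by the strain
    rate, with constant [c^-1], is read off from the discrete scheme, where the previous state is a
    test element; this spares the differentiability of solutions at almost every time. *)

Section bilinear_forms.
Context {R : realType} {V : normedModType R}.
Implicit Types (b : V -> V -> R) (f : V -> R).

Definition linear_form f := forall a u v, f (a *: u + v) = a * f u + f v.

Definition sym_bilinear b := (forall u v, b u v = b v u) /\
  forall w, linear_form (b^~ w).

Section linear_form_theory.
Variables (f : V -> R) (lf : linear_form f).

Lemma linear_formD u v : f (u + v) = f u + f v.
Proof. by rewrite -[u in LHS]scale1r lf mul1r. Qed.

Lemma linear_form0 : f 0 = 0.
Proof. by apply: (addrI (f 0)); rewrite -linear_formD !addr0. Qed.

Lemma linear_formZ a u : f (a *: u) = a * f u.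
Proof. by rewrite -[a *: u]addr0 lf linear_form0 addr0. Qed.

Lemma linear_formN u : f (- u) = - f u.
Proof. by rewrite -scaleN1r linear_formZ mulN1r. Qed.

Lemma linear_form_sum (I : Type) (r : seq I) (F : I -> V) :
  f (\sum_(i <- r) F i) = \sum_(i <- r) f (F i).
Proof.
elim: r => [|i r IH]; first by rewrite !big_nil linear_form0.
by rewrite !big_cons linear_formD IH.
Qed.

End linear_form_theory.

Section sym_bilinear_theory.
Variables (b : V -> V -> R) (hb : sym_bilinear b).

Lemma sbC u v : b u v = b v u. Proof. by case: hb. Qed.

Lemma sb_linear w : linear_form (b^~ w). Proof. by case: hb. Qed.

Lemma sb_linearr w : linear_form (b w).
Proof. by move=> a u v; rewrite !(sbC w) sb_linear. Qed.

Lemma sbDl u v w : b (u + v) w = b u w + b v w.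
Proof. exact: (linear_formD (sb_linear w)). Qed.
Lemma sbDr u v w : b w (u + v) = b w u + b w v.
Proof. exact: (linear_formD (sb_linearr w)). Qed.
Lemma sbZl a u w : b (a *: u) w = a * b u w.
Proof. exact: (linear_formZ (sb_linear w)). Qed.
Lemma sbZr a u w : b w (a *: u) = a * b w u.
Proof. exact: (linear_formZ (sb_linearr w)). Qed.
Lemma sbNl u w : b (- u) w = - b u w.
Proof. exact: (linear_formN (sb_linear w)). Qed.
Lemma sbNr u w : b w (- u) = - b w u.
Proof. exact: (linear_formN (sb_linearr w)). Qed.
Lemma sb0l w : b 0 w = 0. Proof. exact: (linear_form0 (sb_linear w)). Qed.
Lemma sb0r w : b w 0 = 0. Proof. exact: (linear_form0 (sb_linearr w)). Qed.

Definition sbE := (sbDl, sbDr, sbZl, sbZr, sbNl, sbNr, sb0l, sb0r).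

Hypothesis b_ge0 : forall u, 0 <= b u u.

Lemma sb_CS u v : b u v ^+ 2 <= b u u * b v v.
Proof.
have key (x y : V) (t : R) : 0 <= b x x + 2 * t * b x y + t ^+ 2 * b y y.
  by have := b_ge0 (x + t *: y); rewrite !sbE (sbC y x); nra.
have [v0|v0] := eqVneq (b v v) 0.
  suff -> : b u v = 0 by rewrite v0 expr0n/= mulr0.
  apply/eqP/negPn/negP => uv.
  (* The form is only semidefinite: for [b v v = 0] the polynomial is affine in [t], and this [t]
     gives it the value -1. *)
  have := key u v (- (b u u + 1) / (2 * b u v)).
  rewrite v0 mulr0 addr0.
  have -> : 2 * (- (b u u + 1) / (2 * b u v)) * b u v = - (b u u + 1) by field.
  lra.
have vp : 0 < b v v by rewrite lt0r v0 b_ge0.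
have := key u v (- b u v / b v v).
have -> : b u u + 2 * (- b u v / b v v) * b u v + (- b u v / b v v) ^+ 2 * b v v
  = (b u u * b v v - b u v ^+ 2) / b v v by field.
by rewrite pmulr_lge0 ?invr_gt0// subr_ge0.
Qed.

End sym_bilinear_theory.
End bilinear_forms.

Section sequences.
Context {R : realType}.

Lemma cvg_seqP (V : normedModType R) (u : nat -> V) (l : V) :
  u n @[n --> \oo] --> l <->
  forall e : R, 0 < e -> exists N, forall n, (N <= n)%N -> `|u n - l| < e.
Proof.
split=> [/cvgrPdist_lt ul e e0|h].
  have [N _ hN] := ul e e0; exists N => n Nn; rewrite distrC; exact: hN.
apply/cvgrPdist_lt => e e0; have [N hN] := h e e0; exists N => // n /= Nn.
by rewrite distrC; exact: hN.
Qed.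

Lemma cvg_filter_unique (V : normedModType R) (T : Type) (F : set_system T)
    {FF : ProperFilter F} (u : T -> V) (l l' : V) :
  u n @[n --> F] --> l -> u n @[n --> F] --> l' -> l = l'.
Proof. by move=> h h'; apply: (cvg_unique _ h h'); exact: norm_hausdorff. Qed.

Lemma cvg_seq_norm_le (V : normedModType R) (u : nat -> V) (l : V) (d : nat -> R) :
  (forall n, `|u n - l| <= d n) -> d n @[n --> \oo] --> 0 ->
  u n @[n --> \oo] --> l.
Proof.
move=> ud /cvg_seqP d0; apply/cvg_seqP => e e0; have [N hN] := d0 e e0.
exists N => n /hN; rewrite subr0; apply: le_lt_trans.
by rewrite (le_trans (ud n))// ler_norm.
Qed.

Lemma cvg_dist0 (V : normedModType R) (u : nat -> V) (l : V) :
  u n @[n --> \oo] --> l -> `|u n - l| @[n --> \oo] --> 0.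
Proof.
move=> /cvg_seqP ul; apply/cvg_seqP => e /ul[N hN]; exists N => n /hN.
by rewrite subr0 normr_id.
Qed.

Lemma cvg_seq_lim_le (u v : nat -> R) (a b : R) : u n @[n --> \oo] --> a ->
  v n @[n --> \oo] --> b -> (forall n, u n <= v n) -> a <= b.
Proof. by move=> ua vb uv; apply: (ler_cvg_to ua vb); exists 0%N => //. Qed.

(** Subsequences are encoded throughout by index maps with [n <= k n], not necessarily increasing:
    they tend to infinity, which is all that limits use, and they come directly out of [choice]. *)
Lemma cvg_seq_subseq (V : normedModType R) (u : nat -> V) (l : V) (k : nat -> nat) :
  (forall n, (n <= k n)%N) -> u n @[n --> \oo] --> l ->
  u (k n) @[n --> \oo] --> l.
Proof.
move=> kn /cvg_seqP ul; apply/cvg_seqP => e /ul[N hN]; exists N => n Nn.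
by apply: hN; rewrite (leq_trans Nn).
Qed.

Lemma cvg_seqM (u v : nat -> R) (a b : R) : u n @[n --> \oo] --> a ->
  v n @[n --> \oo] --> b -> (u n * v n) @[n --> \oo] --> a * b.
Proof. exact: cvgM. Qed.

Lemma cvg_seqMl (u : nat -> R) (a c : R) : u n @[n --> \oo] --> a ->
  (c * u n) @[n --> \oo] --> c * a.
Proof. by move=> ua; apply: cvg_seqM => //; exact: cvg_cst. Qed.

Lemma cvg_seqD (V : normedModType R) (u v : nat -> V) (a b : V) :
  u n @[n --> \oo] --> a -> v n @[n --> \oo] --> b ->
  (u n + v n) @[n --> \oo] --> a + b.
Proof. exact: cvgD. Qed.

Lemma cvg_seqB (V : normedModType R) (u v : nat -> V) (a b : V) :
  u n @[n --> \oo] --> a -> v n @[n --> \oo] --> b ->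
  (u n - v n) @[n --> \oo] --> a - b.
Proof. exact: cvgB. Qed.

Lemma cvg_inv_succ : (n.+1%:R^-1 : R) @[n --> \oo] --> 0.
Proof. exact: cvg_harmonic. Qed.

(** Completeness as a predicate on sequences, since the quotient and graph spaces below carry only a
    normed structure. *)
Definition cauchy_complete (V : normedModType R) := forall u : nat -> V,
  (forall e : R, 0 < e -> exists N, forall m n, (N <= m)%N -> (N <= n)%N ->
    `|u m - u n| < e) -> exists l : V, u n @[n --> \oo] --> l.

Lemma completeNormedMod_cauchy_complete (V : completeNormedModType R) :
  cauchy_complete V.
Proof.
move=> u uc; have : cvg (u n @[n --> \oo]); last by move=> cu; exists (lim (u n @[n --> \oo])).
apply/cauchy_cvgP/cauchyP => e e0.
have [N hN] := uc _ e0; exists (u N).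
by exists N => // n /= Nn; rewrite -ball_normE/=; apply: hN.
Qed.

Definition seq_closed (V : normedModType R) (C : set V) := forall (u : nat -> V) l,
  (forall n, C (u n)) -> u n @[n --> \oo] --> l -> C l.

Definition seg_convex (V : normedModType R) (C : set V) := forall x y (t : R),
  C x -> C y -> 0 <= t <= 1 -> C (x + t *: (y - x)).

End sequences.

(** * Quadratic minimization over closed convex sets *)

Section quadratic_minimization.
Context {R : realType} {V : normedModType R} (cV : cauchy_complete V).
Variables (b : V -> V -> R) (hb : sym_bilinear b) (c M : R).
Hypotheses (c0 : 0 < c) (b_coercive : forall x, c * `|x| ^+ 2 <= b x x).
Hypothesis b_bounded : forall x y, `|b x y| <= M * `|x| * `|y|.
Variables (f : V -> R) (lf : linear_form f) (L : R).
Hypothesis f_bounded : forall x, `|f x| <= L * `|x|.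

(** A minimizing sequence of [J x = b x x / 2 - f x] is Cauchy by the midpoint identity, and the
    inequality is the sign of the derivative of [J] at the minimizer in the direction of [t]. With
    [C] the whole space it gives the Riesz theorem, with [b] the inner product it gives projections,
    with [b] the form of [A] the Euler step. *)
Lemma quadratic_argmin (C : set V) : C !=set0 -> seq_closed C -> seg_convex C ->
  exists2 s, C s & forall t, C t -> f (t - s) <= b s (t - s).
Proof.
move=> [x0 Cx0] clC cvC.
pose J x := b x x / 2 - f x.
have JD s d : J (s + d) = J s + (b s d - f d) + b d d / 2.
  by rewrite /J !(sbE hb) (linear_formD lf) (sbC hb d s); field.
(* From completing the square in [c * |x|^2 / 2 - L * |x|], up to a factor 2. *)
pose lb := - (L ^+ 2 / c).
have Jlb x : lb <= J x.
  have h1 := b_coercive x; have /ler_normlP[_ h2] := f_bounded x.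
  have h3 : 0 <= (c * `|x| - L) ^+ 2 / c by rewrite divr_ge0 ?sqr_ge0// ltW.
  have e3 : (c * `|x| - L) ^+ 2 / c = c * `|x| ^+ 2 - 2 * L * `|x| + L ^+ 2 / c.
    by field; rewrite gt_eqF.
  rewrite /J /lb; move: h1 h2 h3; rewrite e3.
  have : 0 <= L ^+ 2 / c by rewrite divr_ge0 ?sqr_ge0// ltW.
  lra.
have hinf : has_inf (J @` C).
  split; first by exists (J x0), x0.
  by exists lb => _ [x _ <-].
pose m := inf (J @` C).
have mJ x : C x -> m <= J x by move=> Cx; apply: ge_inf; [case: hinf|exists x].
have hx n : exists x, C x /\ J x < m + n.+1%:R^-1.
  have [_ [x Cx <-] Jx] := inf_adherent (ltac:(rewrite invr_gt0//) : (0 < n.+1%:R^-1 :> R)) hinf.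
  by exists x.
have [x hxx] := choice hx.
have Cx n : C (x n) by case: (hxx n).
have Jx n : J (x n) < m + n.+1%:R^-1 by case: (hxx n).
(* From [J ((x + y) / 2) = (J x + J y) / 2 - b (x - y) (x - y) / 8], which is at least [m]. *)
have dist i j : c * `|x i - x j| ^+ 2 <= 4 * (i.+1%:R^-1 + j.+1%:R^-1).
  have Cm : C (x j + 2^-1 *: (x i - x j)).
    by apply: cvC => //; apply/andP; split; lra.
  have := mJ _ Cm; rewrite JD.
  have e1 : J (x i) = J (x j) + (b (x j) (x i - x j) - f (x i - x j)) + b (x i - x j) (x i - x j) / 2.
    by rewrite -JD addrC subrK.
  rewrite !(sbZl hb) !(sbZr hb) (linear_formZ lf).
  have h1 := b_coercive (x i - x j).
  have := Jx i; have := Jx j; rewrite e1.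
  move: (i.+1%:R^-1) (j.+1%:R^-1) (J _) h1 => ei ej Jj.
  move: (b (x j) _) (b _ _) (f _) (c * _) => b1 b2 b3 b4.
  lra.
have [s xs] : exists s : V, x n @[n --> \oo] --> s.
  apply: cV => e e0.
  have ce : 0 < c * e ^+ 2 / 8 by rewrite divr_gt0// mulr_gt0// exprn_gt0.
  have /cvg_seqP/(_ _ ce)[N hN] := @cvg_inv_succ R.
  exists N => i j /hN hi /hN hj; move: hi hj; rewrite !subr0 !ger0_norm ?invr_ge0// => hi hj.
  rewrite -(@ltr_pXn2r _ 2)// ?nnegrE// ?ltW// -(ltr_pM2l c0).
  apply: (le_lt_trans (dist i j)).
  by move: (i.+1%:R^-1) (j.+1%:R^-1) hi hj => ei ej; lra.
have Cs : C s by exact: clC xs.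
have Js : J s <= m.
  have dn := cvg_dist0 xs.
  have M0 : J s = J s + ((M * `|s| + L) * 0 + M / 2 * 0 * 0) + 0 by lra.
  have : J s <= m + 0 + ((M * `|s| + L) * 0 + M / 2 * 0 * 0).
    apply: (@cvg_seq_lim_le _ (fun=> J s) (fun n => m + n.+1%:R^-1 +
      ((M * `|s| + L) * `|x n - s| + M / 2 * `|x n - s| * `|x n - s|))).
    - exact: cvg_cst.
    - apply: cvg_seqD; first by apply: cvg_seqD; [exact: cvg_cst|exact: cvg_inv_succ].
      by apply: cvg_seqD; [|apply: cvg_seqM => //]; exact: cvg_seqMl.
    - move=> n; have := Jx n.
      have -> : J (x n) = J (s + (x n - s)) by rewrite [s + _]addrC subrK.
      rewrite JD; move: (n.+1%:R^-1) => en.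
      have /ler_normlP[h1 _] := b_bounded s (x n - s).
      have /ler_normlP[_ h2] := f_bounded (x n - s).
      have h3 := b_coercive (x n - s).
      have h4 : 0 <= c * `|x n - s| ^+ 2 by rewrite mulr_ge0// ?sqr_ge0// ltW.
      have /ler_normlP[_ h5] := b_bounded (x n - s) (x n - s).
      lra.
  lra.
exists s => // t Ct; rewrite -subr_ge0.
set d := t - s.
(* [J s <= J (s + e *: d)] divided by [e]; the limit at 0 is then taken along [n.+1%:R^-1]. *)
have h (e : R) : 0 < e <= 1 -> 0 <= b s d - f d + e * (b d d / 2).
  move=> /andP[e0 e1].
  have : J s <= J (s + e *: d) 
    by rewrite (le_trans Js)// mJ//; apply: cvC => //; rewrite e1 ltW.
  rewrite JD !(sbZl hb) !(sbZr hb) (linear_formZ lf) => h0.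
  by rewrite -(pmulr_rge0 _ e0); lra.
have : 0 <= b s d - f d + 0 * (b d d / 2).
  apply: (@cvg_seq_lim_le _ (fun=> 0) (fun n => b s d - f d + n.+1%:R^-1 * (b d d / 2))).
  - exact: cvg_cst.
  - apply: cvg_seqD; first exact: cvg_cst.
    by apply: cvg_seqM; [exact: cvg_inv_succ|exact: cvg_cst].
  - by move=> n; apply: h; rewrite invr_gt0 ltr0n/= invf_le1 ?ler1n ?ltr0n.
by rewrite mul0r addr0.
Qed.

End quadratic_minimization.

(** The inner product is data added to an existing normed space: the control space comes with the
    mere existence of one, and [L2] and [H1_time] have their norms fixed in advance. *)
Class hilbert {R : realType} (V : normedModType R) := Hilbert {
  ip : V -> V -> R;
  ip_sym_bilinear : sym_bilinear ip;
  ip_norm : forall u, ip u u = `|u| ^+ 2;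
  hilbert_complete : cauchy_complete V }.

Section inner_product.
Context {R : realType} {V : normedModType R} {hV : hilbert V}.
Implicit Types u v w : V.

Let hb := @ip_sym_bilinear _ _ hV.

Lemma ipC u v : ip u v = ip v u. Proof. exact: sbC hb _ _. Qed.
Lemma ipDl u v w : ip (u + v) w = ip u w + ip v w. Proof. exact: sbDl. Qed.
Lemma ipDr u v w : ip w (u + v) = ip w u + ip w v. Proof. exact: sbDr. Qed.
Lemma ipZl a u w : ip (a *: u) w = a * ip u w. Proof. exact: sbZl. Qed.
Lemma ipZr a u w : ip w (a *: u) = a * ip w u. Proof. exact: sbZr. Qed.
Lemma ipNl u w : ip (- u) w = - ip u w. Proof. exact: sbNl. Qed.
Lemma ipNr u w : ip w (- u) = - ip w u. Proof. exact: sbNr. Qed.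
Lemma ip0l w : ip 0 w = 0. Proof. exact: sb0l. Qed.
Lemma ip0r w : ip w 0 = 0. Proof. exact: sb0r. Qed.
Lemma ipBl u v w : ip (u - v) w = ip u w - ip v w.
Proof. by rewrite ipDl ipNl. Qed.
Lemma ipBr u v w : ip w (u - v) = ip w u - ip w v.
Proof. by rewrite ipDr ipNr. Qed.
Lemma ip_suml (I : Type) (r : seq I) (F : I -> V) w :
  ip (\sum_(i <- r) F i) w = \sum_(i <- r) ip (F i) w.
Proof. exact: (linear_form_sum (sb_linear hb w)). Qed.
Lemma ip_linear w : linear_form (ip^~ w). Proof. exact: sb_linear hb w. Qed.
Lemma ip_linearr w : linear_form (ip w). Proof. exact: sb_linearr hb w. Qed.

Definition ipE := (ipBl, ipBr, ipDl, ipDr, ipZl, ipZr, ipNl, ipNr, ip0l, ip0r).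

Lemma ip_CS u v : `|ip u v| <= `|u| * `|v|.
Proof.
rewrite -(@ler_pXn2r _ 2)// ?nnegrE ?mulr_ge0// -normrX ger0_norm ?sqr_ge0//.
by rewrite exprMn -!ip_norm; apply: sb_CS => // x; rewrite ip_norm sqr_ge0.
Qed.

Lemma ip_le u v : ip u v <= `|u| * `|v|.
Proof. exact: le_trans (ler_norm _) (ip_CS u v). Qed.

Lemma ip_ext u v : (forall w, ip u w = ip v w) -> u = v.
Proof.
move=> uv; apply/subr0_eq/normr0_eq0/eqP; rewrite -sqrf_eq0 -ip_norm.
by rewrite {1}ipBl uv subrr.
Qed.

Lemma norm_sqrD u v : `|u + v| ^+ 2 = `|u| ^+ 2 + 2 * ip u v + `|v| ^+ 2.
Proof. by rewrite -!ip_norm !ipE (ipC v u); lra. Qed.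

Lemma norm_sqrB u v : `|u - v| ^+ 2 = `|u| ^+ 2 - 2 * ip u v + `|v| ^+ 2.
Proof. by rewrite -!ip_norm !ipE (ipC v u); lra. Qed.

Lemma cvg_ipl (u : nat -> V) l w : u n @[n --> \oo] --> l ->
  ip (u n) w @[n --> \oo] --> ip l w.
Proof.
move=> ul; apply: (cvg_seq_norm_le (d := fun n => `|w| * `|u n - l|)).
  by move=> n; rewrite -ipBl mulrC ip_CS.
by rewrite -[X in _ --> X](mulr0 `|w|); apply: cvg_seqMl; exact: cvg_dist0.
Qed.

(** The minimizer [s] of [|x|^2 / 2 - f x] over the whole space represents [f]: its inequality is
    tested with [s + x] and [s - x]. *)
Lemma riesz (f : V -> R) (L : R) : linear_form f ->
  (forall x, `|f x| <= L * `|x|) -> exists z, forall x, f x = ip x z.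
Proof.
move=> lf fL.
have [|//|s _ hs] := quadratic_argmin hilbert_complete hb ltr01 _ (M := 1) _ lf fL
  (C := setT) (ex_intro _ 0 I) (fun _ _ _ _ => I) (fun _ _ _ _ _ _ => I).
- by move=> x; rewrite mul1r ip_norm.
- by move=> x y; rewrite mul1r ip_CS.
exists s => x; have := hs (s + x) I; have := hs (s - x) I.
rewrite ![s + _]addrC !addrK (linear_formN lf) ipNr (ipC x s); lra.
Qed.

Definition is_projection (C : set V) (p : V -> V) :=
  forall x, C (p x) /\ forall t, C t -> ip (x - p x) (t - p x) <= 0.

(** Minimizing [|y|^2 / 2 - ip x y] over [C] is minimizing [|x - y|], so this is [quadratic_argmin]
    with [f = ip x]. *)
Lemma projection (C : set V) : C !=set0 -> seq_closed C -> seg_convex C ->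
  exists p, is_projection C p.
Proof.
move=> C0 clC cvC.
have h x : exists s, C s /\ forall t, C t -> ip (x - s) (t - s) <= 0; last first.
  by have [p hp] := choice h; exists p.
have fL y : `|ip x y| <= `|x| * `|y| by exact: ip_CS.
have [||s Cs hs] := quadratic_argmin hilbert_complete hb ltr01 _ (M := 1) _
  (ip_linearr x) fL C0 clC cvC.
- by move=> y; rewrite mul1r ip_norm.
- by move=> y z; rewrite mul1r ip_CS.
by exists s; split => // t Ct; rewrite ipBl subr_le0 hs.
Qed.

(** Sum of the angle inequalities at [p x] and [p y], each tested with the other point, then
    Cauchy-Schwarz. *)
Lemma projection_lipschitz C p x y : is_projection C p ->
  `|p x - p y| <= `|x - y|.
Proof.
move=> hp; have [Cx hx] := hp x; have [Cy hy] := hp y.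
have h1 := hx _ Cy; have h2 := hy _ Cx.
have h : `|p x - p y| ^+ 2 <= `|x - y| * `|p x - p y|.
  apply: le_trans (ip_le _ _); rewrite -ip_norm.
  by move: h1 h2; rewrite !ipE (ipC (p y) (p x)); lra.
have [->//|n0] := eqVneq `|p x - p y| 0.
have np : 0 < `|p x - p y| by rewrite lt0r n0 normr_ge0.
by rewrite -(ler_pM2r np) -expr2.
Qed.

(* Sequential weak convergence tested with inner products only; by Riesz it is
   the convergence tested with all continuous linear functionals. *)
Definition wcvg (u : nat -> V) (l : V) :=
  forall z, ip (u n) z @[n --> \oo] --> ip l z.

Lemma cvg_wcvg (u : nat -> V) l : u n @[n --> \oo] --> l -> wcvg u l.
Proof. by move=> ul z; exact: cvg_ipl. Qed.

Lemma wcvg_subseq (u : nat -> V) l (k : nat -> nat) : (forall n, (n <= k n)%N) ->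
  wcvg u l -> wcvg (u \o k) l.
Proof. by move=> kn ul z; exact: (cvg_seq_subseq kn (ul z)). Qed.

Lemma wcvg_linear_form (u : nat -> V) l (f : V -> R) (L : R) : linear_form f ->
  (forall x, `|f x| <= L * `|x|) -> wcvg u l -> f (u n) @[n --> \oo] --> f l.
Proof.
move=> lf fL ul; have [z fz] := riesz lf fL.
by under eq_fun do rewrite fz; rewrite fz; exact: ul.
Qed.

Lemma wcvg_unique (u : nat -> V) l l' : wcvg u l -> wcvg u l' -> l = l'.
Proof.
move=> h h'; apply: ip_ext => z.
exact: cvg_filter_unique (h z) (h' z).
Qed.

Lemma wcvg_norm_le (u : nat -> V) l (M : R) : wcvg u l -> (forall n, `|u n| <= M) -> `|l| <= M.
Proof.
move=> ul uM; have M0 : 0 <= M by exact: le_trans (uM 0%N).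
have [->|l0] := eqVneq l 0; first by rewrite normr0.
have lp : 0 < `|l| by rewrite normr_gt0.
rewrite -(ler_pM2r lp) -expr2 -ip_norm.
apply: (cvg_seq_lim_le (ul l) (cvg_cst (M * `|l|))) => n.
by apply: (le_trans (ip_le _ _)); rewrite ler_pM2r.
Qed.

(** Mazur's argument: the angle inequality at [p l], tested with [u n], is affine in [u n], so it
    survives the weak limit and becomes [|l - p l|^2 <= 0]. *)
Lemma wcvg_closed (u : nat -> V) l (C : set V) : seq_closed C -> seg_convex C ->
  (forall n, C (u n)) -> wcvg u l -> C l.
Proof.
move=> clC cvC Cu ul.
have [|p hp] := @projection C _ clC cvC; first by exists (u 0%N).
have [Cp hl] := hp l; suff <- : p l = l by [].
apply/esym/subr0_eq/normr0_eq0/eqP; rewrite -sqrf_eq0 eq_le sqr_ge0 andbT.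
rewrite -ip_norm.
apply: (cvg_seq_lim_le (u := fun n => ip (u n) (l - p l) - ip (p l) (l - p l))
    _ (cvg_cst (0 : R))) => [|n].
  by rewrite ipBl; apply: cvg_seqB; [exact: ul|exact: cvg_cst].
by rewrite -ipBl ipC hl.
Qed.

Lemma wcvg_ip (u w : nat -> V) l m (M : R) : wcvg u l ->
  (forall n, `|u n| <= M) -> w n @[n --> \oo] --> m ->
  ip (u n) (w n) @[n --> \oo] --> ip l m.
Proof.
move=> ul uM wm.
have -> : ip l m = ip l m + 0 by rewrite addr0.
have -> : (fun n => ip (u n) (w n)) = (fun n => ip (u n) m + ip (u n) (w n - m)).
  by apply/funext => n; rewrite ipBr addrC subrK.
apply: cvg_seqD => //.
apply: (cvg_seq_norm_le (d := fun n => M * `|w n - m|)).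
  by move=> n; rewrite subr0 (le_trans (ip_CS _ _))// ler_wpM2r.
by rewrite -[X in _ --> X](mulr0 M); apply: cvg_seqMl; exact: cvg_dist0.
Qed.

Lemma wcvgD (u w : nat -> V) l m : wcvg u l -> wcvg w m -> wcvg (fun n => u n + w n) (l + m).
Proof.
by move=> ul wm z; rewrite ipDl; under eq_fun do rewrite ipDl; exact: cvg_seqD.
Qed.

(* The limit is found along an ultrafilter, which converges when tested with any
   vector; along the subsequence the convergence is arranged only for tests with
   the u m, and extended to their closed span and its orthogonal complement. *)
Lemma bounded_wcvg_subseq (u : nat -> V) (M : R) : (forall n, `|u n| <= M) ->
  exists (k : nat -> nat) l, (forall n, (n <= k n)%N) /\ wcvg (u \o k) l.
Proof.
move=> uM.
have [F [uF subF]] := @ultraFilterLemma nat \oo _.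
have limF y : exists c : R, `|c| <= M * `|y| /\ (ip (u n) y @[n --> F] --> c).
  have [|c [ci hc]] := @segment_compact R (- (M * `|y|)) (M * `|y|)
      (fmap (fun n => ip (u n) y) F) _.
    apply: (@nearW _ F) => n; rewrite /= in_itv/= -ler_norml.
    by rewrite (le_trans (ip_CS _ _))// ler_wpM2r.
  exists c; split; first by move: ci; rewrite /= in_itv/= -ler_norml.
  apply/cvgrPdist_lt => e e0.
  have [//|nF] := in_ultra_setVsetC [set n | `|c - ip (u n) y| < e] uF.
  by have [r [/= nr cr]] := hc [set r | ~ `|c - r| < e] (ball c e) nF (nbhsx_ballx c e e0).
have [lam hlam'] := choice limF.
have lam_bnd y : `|lam y| <= M * `|y| by case: (hlam' y).
have hlam y : ip (u n) y @[n --> F] --> lam y by case: (hlam' y).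
have lam_lin : linear_form lam.
  move=> a x y; apply: (cvg_filter_unique (hlam (a *: x + y))) => //.
  under eq_fun do rewrite ipDr ipZr.
  by apply: cvgD => //; apply: cvgM => //; exact: cvg_cst.
have [z hz] := riesz lam_lin lam_bnd.
(* Finitely many tests at once: the sets of good indices belong to the ultrafilter, hence so does
   their intersection with a tail of the integers. *)
have near_k n : exists k, (n <= k)%N /\
    forall m, (m <= n)%N -> `|ip (u k) (u m) - ip z (u m)| < n.+1%:R^-1.
  have h1 : F [set k | (n <= k)%N] by apply: subF; exists n.
  have h2 m : F [set k | `|ip (u k) (u m) - ip z (u m)| < n.+1%:R^-1].
    have /cvgrPdist_lt := hlam (u m).
    move=> /(_ n.+1%:R^-1 (ltac:(by rewrite invr_gt0))).
    by apply: filterS => k; rewrite hz ipC distrC.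
  have h3 j : F [set k | forall m, (m < j)%N -> `|ip (u k) (u m) - ip z (u m)| < n.+1%:R^-1].
    elim: j => [|j IH]; first by apply: (@nearW _ F).
    apply: filterS2 IH (h2 j) => k hk hj m; rewrite ltnS leq_eqVlt => /orP[/eqP->//|].
    exact: hk.
  have [k [hk hkm]] := filter_ex (filterI h1 (h3 n.+1)).
  by exists k; split.
have [k hk] := choice near_k.
exists k, z; split; first by move=> n; case: (hk n).
pose Y : set V := [set y | @ip _ _ hV (u (k n)) y @[n --> \oo] --> @ip _ _ hV z y].
have Yu m : Y (u m).
  apply/cvg_seqP => e e0; have /cvg_seqP/(_ _ e0)[N hN] := @cvg_inv_succ R.
  exists (maxn N m) => n; rewrite geq_max => /andP[Nn mn].
  have [_ /(_ m mn)] := hk n; move=> /lt_trans; apply.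
  by have := hN n Nn; rewrite subr0 ger0_norm ?invr_ge0.
have cvY : seg_convex Y.
  move=> x y t Yx Yy _; rewrite /Y/= ipDr ipZr ipBr.
  under eq_fun do rewrite ipDr ipZr ipBr.
  by apply: cvg_seqD => //; apply: cvg_seqMl; exact: cvg_seqB.
have Yadd x y : Y x -> Y y -> Y (x + y).
  by move=> Yx Yy; rewrite /Y/= ipDr; under eq_fun do rewrite ipDr; exact: cvg_seqD.
have YZ a x : Y x -> Y (a *: x).
  by move=> Yx; rewrite /Y/= ipZr; under eq_fun do rewrite ipZr; exact: cvg_seqMl.
have clY : seq_closed Y.
  move=> y l Yy yl; apply/cvg_seqP => e e0.
  pose K := M + `|z| + 1.
  have M0 : 0 <= M by exact: le_trans (uM 0%N).
  have K0 : 0 < K by rewrite /K ltr_wpDl// addr_ge0.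
  have eK : 0 < e / 2 / K by rewrite !divr_gt0.
  have /cvg_seqP/(_ _ eK)[j /(_ j (leqnn _)) hj] := yl.
  have /cvg_seqP/(_ (e / 2))[|N hN] := Yy j; first by rewrite divr_gt0.
  exists N => n /hN h.
  have -> : ip (u (k n)) l - ip z l =
     (ip (u (k n)) (y j) - ip z (y j)) - ip (u (k n) - z) (y j - l).
    by rewrite !ipE; lra.
  apply: (le_lt_trans (ler_normB _ _)); rewrite [ltRHS]splitr; apply: ltr_leD => //.
  apply: (le_trans (ip_CS _ _)).
  have h1 : `|u (k n) - z| <= K.
    by rewrite (le_trans (ler_normB _ _))// /K -addrA lerD// lerDl.
  apply: (le_trans (ler_wpM2r (normr_ge0 _) h1)).
  by rewrite mulrC -ler_pdivlMr// ltW.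
have [p hp] : exists p, is_projection Y p.
  by apply: projection => //; exists (u 0%N).
move=> y; have [Yp hy] := hp y.
(* [Y] is a linear subspace, so the angle inequality at [p y] may be tested with [p y + u m] and
   [p y - u m]. *)
have orth m : ip (u m) (y - p y) = 0.
  apply/eqP; rewrite eq_le; apply/andP; split.
    have := hy _ (Yadd _ _ Yp (Yu m)).
    by rewrite [p y + _]addrC addrK ipC.
  have := hy _ (Yadd _ _ Yp (YZ (-1) _ (Yu m))).
  by rewrite [p y + _]addrC addrK ipC scaleN1r ipNl oppr_le0.
have orthz : ip z (y - p y) = 0.
  rewrite ipC -hz; apply: (cvg_filter_unique (hlam (y - p y))) => //.
  by under eq_fun do rewrite orth; exact: cvg_cst.
have -> : ip z y = ip z (p y).
  by apply/eqP; rewrite -subr_eq0 -ipBr orthz.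
have -> : (fun n => ip ((u \o k) n) y) = (fun n => ip (u (k n)) (p y)).
  by apply/funext => n /=; apply/eqP; rewrite -subr_eq0 -ipBr orth.
exact: Yp.
Qed.

End inner_product.

(** Stated for bare functions with an explicit constant: maps built by choice, such as [L2_map] or
    traces, come without a linear structure, and adjoints keep the same constant. *)
Definition bounded_linear {R : realType} {V W : normedModType R} (B : V -> W) (M : R) :=
  [/\ 0 <= M, forall a u v, B (a *: u + v) = a *: B u + B v &
      forall u, `|B u| <= M * `|u|].

Section bounded_linear.
Context {R : realType} {V W : normedModType R} (B : V -> W) (M : R).
Hypothesis bB : bounded_linear B M.

Lemma bounded_linearD u v : B (u + v) = B u + B v.
Proof. by case: bB => _ h _; rewrite -[u in LHS]scale1r h scale1r. Qed.

Lemma bounded_linear0 : B 0 = 0.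
Proof. by apply: (addrI (B 0)); rewrite -bounded_linearD !addr0. Qed.

Lemma bounded_linearZ a u : B (a *: u) = a *: B u.
Proof. by case: bB => _ h _; rewrite -[a *: u]addr0 h bounded_linear0 addr0. Qed.

Lemma bounded_linearB u v : B (u - v) = B u - B v.
Proof. by rewrite bounded_linearD -[- v]scaleN1r bounded_linearZ scaleN1r. Qed.

Lemma bounded_linear_le u : `|B u| <= M * `|u|. Proof. by case: bB. Qed.

Lemma bounded_linear_cvg (u : nat -> V) l : u n @[n --> \oo] --> l ->
  B (u n) @[n --> \oo] --> B l.
Proof.
move=> ul; apply: (cvg_seq_norm_le (d := fun n => M * `|u n - l|)).
  by move=> n; rewrite -bounded_linearB bounded_linear_le.
by rewrite -[X in _ --> X](mulr0 M); apply: cvg_seqMl; exact: cvg_dist0.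
Qed.

Lemma bounded_linear_ip_bounded {hW : hilbert W} z x :
  `|ip (B x) z| <= M * `|z| * `|x|.
Proof.
apply: (le_trans (ip_CS _ _)); rewrite mulrAC ler_wpM2r//.
exact: bounded_linear_le.
Qed.

Lemma bounded_linear_ip_linear {hW : hilbert W} z : linear_form (fun x => ip (B x) z).
Proof. by move=> a x y; rewrite bounded_linearD bounded_linearZ ipDl ipZl. Qed.

Lemma bounded_linear_wcvg {hV : hilbert V} {hW : hilbert W} (u : nat -> V) l :
  wcvg u l -> wcvg (B \o u) (B l).
Proof.
move=> ul z; apply: (wcvg_linear_form (f := fun x => ip (B x) z)) ul => //.
- exact: bounded_linear_ip_linear.
- exact: bounded_linear_ip_bounded.
Qed.

End bounded_linear.

(** * Lebesgue-Bochner spaces *)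

Section strong_measurability.
Context {dT} {T : measurableType dT} {R : realType}.
Implicit Types V W : normedModType R.

Definition step_restrict V (l : seq (set T * V)) (A : set T) :=
  [seq (p.1 `&` A, p.2) | p <- l].

Lemma step_fun_restrict V (l : seq (set T * V)) A x :
  step_fun (step_restrict l A) x = \1_A x *: step_fun l x.
Proof.
rewrite /step_fun big_map scaler_sumr; apply: eq_bigr => p _ /=.
by rewrite indicI /= scalerA mulrC.
Qed.

Lemma step_measurable_restrict V (l : seq (set T * V)) A : measurable A ->
  step_measurable l -> step_measurable (step_restrict l A).
Proof. by move=> mA ml _ /mapP[p /ml mp ->]; exact: measurableI. Qed.

Lemma step_fun_cst V (v : V) x : step_fun [:: (setT : set T, v)] x = v.
Proof. by rewrite /step_fun big_seq1 /= indicT scale1r. Qed.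

(** The sets of a step list may overlap, so the induction generalizes [phi]: on the first set the
    rest of the list is composed with [phi (v + _)], off it with [phi], and the two results are
    restricted to the set and its complement. *)
Lemma step_comp V W (l : seq (set T * V)) (phi : V -> W) : step_measurable l ->
  exists2 l', step_measurable l' & forall x, step_fun l' x = phi (step_fun l x).
Proof.
elim: l phi => [|[A v] l IH] phi ml.
  exists [:: (setT, phi 0)]; first by move=> p; rewrite inE => /eqP->; exact: measurableT.
  by move=> x; rewrite step_fun_cst /step_fun big_nil.
have mA : measurable A by apply: (ml (A, v)); rewrite inE eqxx.
have {}ml : step_measurable l by move=> p pl; apply: ml; rewrite inE pl orbT.
have [l1 m1 e1] := IH (fun w => phi (v + w)) ml.
have [l2 m2 e2] := IH phi ml.
exists (step_restrict l1 A ++ step_restrict l2 (~` A)).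
  apply: step_measurable_cat; apply: step_measurable_restrict => //.
  exact: measurableC.
move=> x; rewrite step_cat !step_fun_restrict e1 e2 /step_fun big_cons /=.
rewrite !indicE in_setC; by case: (x \in A); rewrite /= ?scale1r ?scale0r ?scale1r ?addr0 ?add0r.
Qed.

Lemma strongly_measurable_comp V W (phi : V -> W) (f : T -> V) :
  (forall (u : nat -> V) l, u n @[n --> \oo] --> l -> phi (u n) @[n --> \oo] --> phi l) ->
  strongly_measurable f -> strongly_measurable (phi \o f).
Proof.
move=> hphi [s [ms sf]].
have [s' hs'] := choice (fun n => let: ex_intro2 l h1 h2 := step_comp phi (ms n) in
  ex_intro (fun l => step_measurable l /\ forall x, step_fun l x = phi (step_fun (s n) x))
    l (conj h1 h2)).
exists s'; split=> [n|x]; first by case: (hs' n).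
rewrite [X in X x @[x --> _] --> _](_ : _ = fun n => phi (step_fun (s n) x)); first exact: hphi.
by apply/funext => n; case: (hs' n).
Qed.

Lemma strongly_measurable_cst V (v : V) : strongly_measurable (fun _ : T => v).
Proof.
exists (fun=> [:: (setT, v)]); split; first by move=> n p; rewrite inE => /eqP->; exact: measurableT.
by move=> x; under eq_fun do rewrite step_fun_cst; exact: cvg_cst.
Qed.

Lemma strongly_measurable_restrict V A (f : T -> V) : measurable A ->
  strongly_measurable f -> strongly_measurable (fun x => \1_A x *: f x).
Proof.
move=> mA [s [ms sf]]; exists (fun n => step_restrict (s n) A); split.
  by move=> n; exact: step_measurable_restrict.
by move=> x; under eq_fun do rewrite step_fun_restrict; apply: cvgZ; [exact: cvg_cst|exact: sf].
Qed.

Lemma strongly_measurableB V (f g : T -> V) : strongly_measurable f ->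
  strongly_measurable g -> strongly_measurable (fun x => f x - g x).
Proof.
move=> mf mg; rewrite (_ : (fun x => _) = f \+ (-1) \*: g).
  by apply: strongly_measurableD => //; exact: strongly_measurableZ.
by apply/funext => x /=; rewrite scaleN1r.
Qed.

Lemma strongly_measurable_scale V (g : T -> R) (f : T -> V) :
  strongly_measurable (g : T -> R^o) -> strongly_measurable f ->
  strongly_measurable (fun x => g x *: f x).
Proof.
move=> [s [ms sg]] [t [mt tf]].
exists (fun n => [seq (p.1 `&` q.1, (p.2 : R) *: q.2) | p <- s n, q <- t n]); split.
  move=> n _ /allpairsP[[p q] [/= /(ms n) mp /(mt n) mq ->]]; exact: measurableI.
move=> x.
rewrite [X in X x @[x --> _] --> _](_ : _ =
    fun n => (step_fun (s n) x : R) *: step_fun (t n) x); last first.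
  apply/funext => n; rewrite /step_fun big_allpairs_dep /= scaler_suml.
  apply: eq_bigr => p _; rewrite scaler_sumr; apply: eq_bigr => q _.
  by rewrite indicI /= !scalerA mulrAC.
by apply: cvgZ; [exact: sg|exact: tf].
Qed.

(** Each step function is cut to the set where its norm is at most [2 * |f|]. If [f x] is not 0, the
    factor 2 leaves room for [x] to lie in all late sets; if it is 0, the cut functions vanish at
    [x]. *)
Lemma strongly_measurable_dominated V (f : T -> V) : strongly_measurable f ->
  exists s : nat -> seq (set T * V), [/\ forall n, step_measurable (s n),
    forall x, step_fun (s n) x @[n --> \oo] --> f x &
    forall n x, `|step_fun (s n) x| <= 2 * `|f x|].
Proof.
move=> mf; have mnf := strongly_measurable_norm mf; have [s [ms sf]] := mf.
pose B n := [set x | `|step_fun (s n) x| <= 2 * `|f x|].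
have mB n : measurable (B n).
  rewrite -[B n]setTI; apply: measurable_fun_le => //.
    exact: (measurable_step_comp (fun v => `|v|)).
  exact: measurable_funM.
have bnd n x : `|step_fun (step_restrict (s n) (B n)) x| <= 2 * `|f x|.
  rewrite step_fun_restrict indicE; case: (boolP (x \in B n)) => [|_].
    by rewrite inE scale1r.
  by rewrite scale0r normr0 mulr_ge0.
exists (fun n => step_restrict (s n) (B n)); split=> // [n|x].
  exact: step_measurable_restrict.
have [fx0|fx0] := eqVneq (f x) 0.
  rewrite fx0; apply: (cvg_seq_norm_le (d := fun=> 0)); last exact: cvg_cst.
  by move=> n; have := bnd n x; rewrite fx0 normr0 mulr0 subr0.
have fxp : 0 < `|f x| by rewrite normr_gt0.
apply/cvg_seqP => e e0; have /cvg_seqP h := sf x.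
have [N1 h1] := h _ e0; have [N2 h2] := h _ fxp.
exists (maxn N1 N2) => n; rewrite geq_max => /andP[n1 n2].
have Bx : B n x.
  rewrite /B/= -[step_fun _ x](subrK (f x)); apply: le_trans (ler_normD _ _) _.
  by have := h2 _ n2; lra.
by rewrite step_fun_restrict indicE (mem_set Bx) scale1r; exact: h1.
Qed.

End strong_measurability.

Lemma cvg_sqr0 {R : realType} (d : nat -> R) : (forall n, 0 <= d n) ->
  (d n ^+ 2) @[n --> \oo] --> 0 -> d n @[n --> \oo] --> 0.
Proof.
move=> d0 /cvg_seqP h; apply/cvg_seqP => e e0.
have [N hN] := h _ (exprn_gt0 2 e0); exists N => n /hN.
rewrite !subr0 !ger0_norm ?exprn_ge0// => hn.
by rewrite -(@ltr_pXn2r _ 2)// ?nnegrE// ltW.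
Qed.

Lemma cvg_EFin_seq {R : realType} (u : nat -> R) (l : R) :
  (u n)%:E @[n --> \oo] --> l%:E -> u n @[n --> \oo] --> l.
Proof. by move=> /fine_cvg. Qed.

Section L2_convergence.
Context {dT} {T : measurableType dT} {R : realType}.
Variable mu : {measure set T -> \bar R}.

Lemma ae_eq_Rintegral (f g : T -> R) : measurable_fun setT f ->
  measurable_fun setT g -> {ae mu, forall x, f x = g x} ->
  \int[mu]_x f x = \int[mu]_x g x.
Proof.
move=> mf mg fg; congr fine; apply: ae_eq_integral => //.
- exact/measurable_EFinP.
- exact/measurable_EFinP.
- by apply: filterS fg => x -> _.
Qed.

Lemma ae_Rintegral_ge0 (f : T -> R) : measurable_fun setT f ->
  {ae mu, forall x, 0 <= f x} -> 0 <= \int[mu]_x f x.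
Proof.
move=> mf f0; rewrite (@ae_eq_Rintegral _ (fun x => `|f x|))//.
- by apply: Rintegral_ge0.
- exact: measurableT_comp.
- by apply: filterS f0 => x fx; rewrite ger0_norm.
Qed.

Lemma ae_le_Rintegral (f g : T -> R) : mu.-integrable setT (EFin \o f) ->
  mu.-integrable setT (EFin \o g) -> {ae mu, forall x, f x <= g x} ->
  \int[mu]_x f x <= \int[mu]_x g x.
Proof.
move=> intf intg fg; rewrite -subr_ge0 -RintegralB//.
have /integrableP[/measurable_EFinP mf _] := intf.
have /integrableP[/measurable_EFinP mg _] := intg.
apply: ae_Rintegral_ge0; first exact: measurable_funB.
by apply: filterS fg => x; rewrite subr_ge0.
Qed.

Lemma is_L2P (V : normedModType R) (f : T -> V) : is_L2 mu f <->
  strongly_measurable f /\ (\int[mu]_x (`|f x| ^+ 2)%:E < +oo)%E.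
Proof.
have e : (\int[mu]_x (`|f x| `^ 2)%:E = \int[mu]_x (`|f x| ^+ 2)%:E)%E.
  by apply: eq_integral => x _; rewrite powR_mulrn.
split=> -[mf h]; split=> //.
- by move: h; rewrite normEE e; apply: lty_poweRy; rewrite invr_neq0.
- by rewrite normEE e; exact: poweR_lty.
Qed.

Section normed.
Context {V : normedModType R}.
Implicit Types (f : T -> V) (u v : L2 mu V).

Lemma strongly_measurable_sqr f : strongly_measurable f ->
  measurable_fun setT (fun x => `|f x| ^+ 2).
Proof. by move=> /strongly_measurable_norm mf; exact: measurable_funX. Qed.

Lemma integrable_sqr f : is_L2 mu f -> mu.-integrable setT (EFin \o (fun x => `|f x| ^+ 2)).
Proof.
move=> /is_L2P[mf fi]; apply/integrableP; split.
  by apply/measurable_EFinP; exact: strongly_measurable_sqr.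
rewrite (_ : (\int[mu]_x _)%E = (\int[mu]_x (`|f x| ^+ 2)%:E)%E)//.
by apply: eq_integral => x _; rewrite /= ger0_norm ?sqr_ge0.
Qed.

Lemma is_L2_le f (g : T -> R) : strongly_measurable f ->
  mu.-integrable setT (EFin \o g) -> (forall x, `|f x| ^+ 2 <= g x) -> is_L2 mu f.
Proof.
move=> mf /integrableP[mg gi] fg; apply/is_L2P; split=> //; apply: le_lt_trans gi.
apply: ge0_le_integral => //.
- by apply/measurable_EFinP; exact: strongly_measurable_sqr.
- exact: measurableT_comp.
- by move=> x _ /=; rewrite lee_fin (le_trans (fg x))// ler_norm.
Qed.

Lemma L2_strongly_measurable u : strongly_measurable u.
Proof. by case: (L2_reprP u). Qed.

Lemma L2_normE_ae u f : strongly_measurable f -> {ae mu, forall x, u x = f x} ->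
  ((`|u| ^+ 2)%:E = \int[mu]_x (`|f x| ^+ 2)%:E)%E.
Proof.
move=> mf uf.
have -> : (\int[mu]_x (`|f x| ^+ 2)%:E = \int[mu]_x (`|u x| ^+ 2)%:E)%E.
  apply: ge0_ae_eq_integral => //.
  - by apply/measurable_EFinP; exact: strongly_measurable_sqr.
  - by apply/measurable_EFinP; apply: strongly_measurable_sqr; exact: L2_strongly_measurable.
  - by apply: filterS uf => x -> _.
have i0 : (0 <= \int[mu]_x (`|u x| ^+ 2)%:E)%E.
  by apply: integral_ge0 => x _; rewrite lee_fin sqr_ge0.
have [_ ifin] := iffLR (is_L2P u) (L2_reprP u).
have : ((L2_norm u)%:E = (\int[mu]_x (`|u x| ^+ 2)%:E) `^ 2^-1)%E.
  rewrite L2_normE normEE; congr poweR.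
  by apply: eq_integral => x _; rewrite powR_mulrn.
move: i0 ifin; case: (integral _ _ _) => //= r r0 _ [ur].
have -> : `|u| = r `^ 2^-1 by exact: ur.
by rewrite -powR_mulrn ?powR_ge0// -powRrM mulVf// powRr1// -lee_fin.
Qed.

Lemma L2_norm_sqrE u : ((`|u| ^+ 2)%:E = \int[mu]_x (`|u x| ^+ 2)%:E)%E.
Proof.
apply: L2_normE_ae; first exact: L2_strongly_measurable.
exact: aeW.
Qed.

Lemma L2_norm_sqr u : `|u| ^+ 2 = \int[mu]_x `|u x| ^+ 2.
Proof. by rewrite /Rintegral -L2_norm_sqrE. Qed.

Definition L2_of f (hf : is_L2 mu f) : L2 mu V :=
  \pi_(L2 mu V)%qT (MkL2fun (mem_set hf : f \in @L2_pred _ _ _ mu V)).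

Lemma L2_ofE f (hf : is_L2 mu f) : {ae mu, forall x, L2_of hf x = f x}.
Proof. exact: L2_repr_pi. Qed.

Lemma L2_reprB u v : {ae mu, forall x, L2_repr (u - v) x = u x - v x}.
Proof.
have h := L2_reprD u (- v); have h' := L2_reprZ (-1) v.
by apply: filterS2 h h' => x -> ; rewrite !scaleN1r => ->.
Qed.

Lemma L2_sqr_le u (g : T -> R) : mu.-integrable setT (EFin \o g) ->
  {ae mu, forall x, `|u x| ^+ 2 <= g x} -> `|u| ^+ 2 <= \int[mu]_x g x.
Proof.
move=> ig ug; rewrite L2_norm_sqr; apply: ae_le_Rintegral => //.
by apply: integrable_sqr; exact: L2_reprP.
Qed.

Lemma L2_dominated (u_ : nat -> L2 mu V) u (g : T -> R) :
  mu.-integrable setT (EFin \o g) ->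
  {ae mu, forall x, u_ n x @[n --> \oo] --> u x} ->
  (forall n, {ae mu, forall x, `|u_ n x - u x| ^+ 2 <= g x}) ->
  u_ n @[n --> \oo] --> u.
Proof.
move=> ig cu hg.
apply: (cvg_seq_norm_le (d := fun n => `|u_ n - u|)) => //.
apply: cvg_sqr0 => //; apply: cvg_EFin_seq.
have mB n : strongly_measurable (fun x => u_ n x - u x).
  by apply: strongly_measurableB; exact: L2_strongly_measurable.
have mfn n : measurable_fun setT (fun x => (`|u_ n x - u x| ^+ 2)%:E).
  by apply/measurable_EFinP; exact: strongly_measurable_sqr.
have cf : {ae mu, forall x, setT x ->
    (`|u_ n x - u x| ^+ 2)%:E @[n --> \oo] --> (cst 0%E : T -> \bar R) x}.
  apply: filterS cu => x cx _; apply: cvg_EFin; first exact: nearW.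
  rewrite /= -[X in _ --> X](expr0n R 2).
  by apply: cvg_seqM; exact: cvg_dist0.
have bf : {ae mu, forall x n, setT x ->
    (`|(`|u_ n x - u x| ^+ 2)%:E| <= (EFin \o g) x)%E}.
  apply: filterS (ae_foralln hg) => x hx n _.
  by rewrite /= ger0_norm ?sqr_ge0// lee_fin.
have [_ _] := dominated_convergence measurableT mfn (measurable_cst _) cf ig bf.
rewrite /= integral0 => h; apply: cvg_trans h; apply: near_eq_cvg; apply: nearW => n.
by rewrite /= (L2_normE_ae (mB n) (L2_reprB (u_ n) u)).
Qed.

End normed.

Lemma L2_norm_le (V W : normedModType R) (u : L2 mu V) (w : L2 mu W) (M : R) : 0 <= M ->
  {ae mu, forall x, `|u x| <= M * `|w x|} -> `|u| <= M * `|w|.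
Proof.
move=> M0 h; rewrite -(@ler_pXn2r _ 2)// ?nnegrE ?mulr_ge0// exprMn.
have iw : mu.-integrable setT (EFin \o (fun x => `|w x| ^+ 2)).
  by apply/integrable_sqr/L2_reprP.
apply: (@le_trans _ _ (\int[mu]_x (M ^+ 2 * `|w x| ^+ 2))).
  apply: L2_sqr_le.
    by rewrite (_ : _ \o _ = fun x => ((M ^+ 2)%:E * (`|w x| ^+ 2)%:E)%E)//; exact: integrableZl.
  by apply: filterS h => x hx; rewrite -exprMn lerXn2r ?nnegrE ?mulr_ge0.
rewrite RintegralZl// ler_wpM2l ?sqr_ge0//.
by rewrite L2_norm_sqr.
Qed.
End L2_convergence.

(** * Completeness of L^2 *)

Section L2_completeness.
Context {dT} {T : measurableType dT} {R : realType}.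
Variable mu : {measure set T -> \bar R}.
Context {V : normedModType R}.
Implicit Types (f : T -> V) (u v : L2 mu V).

(** Multiplied by [4 ^+ n] it is the summable [2^-(n+1)], so the factor [4^-n] is left as a
    pointwise rate of decay for squared norms. *)
Definition fast_rate n : R := (2 ^ n.+1)%:R^-1 / 4 ^+ n.

Lemma fast_rate_gt0 n : 0 < fast_rate n.
Proof. by rewrite divr_gt0 ?invr_gt0 ?exprn_gt0// ltr0n expn_gt0. Qed.

(** [g] is the sum of the series of [4 ^+ n * |w n|^2], which is integrable by monotone convergence,
    hence finite almost everywhere; each term is at most the sum. *)
Lemma L2_fast_dominated (w : nat -> L2 mu V) :
  (forall n, `|w n| ^+ 2 <= fast_rate n) -> exists g : T -> R,
    [/\ forall x, 0 <= g x, mu.-integrable setT (EFin \o g) &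
        {ae mu, forall x, forall n, `|w n x| ^+ 2 <= g x / 4 ^+ n}].
Proof.
move=> wn.
have p4 n : 0 < 4 ^+ n :> R by rewrite exprn_gt0.
pose F n x : \bar R := (4 ^+ n * `|w n x| ^+ 2)%:E.
have F0 n x : (0 <= F n x)%E by rewrite lee_fin mulr_ge0 ?sqr_ge0// ltW.
have mF n : measurable_fun setT (F n).
  apply/measurable_EFinP; apply: measurable_funM => //.
  by apply: strongly_measurable_sqr; exact: L2_strongly_measurable.
pose S x : \bar R := (\sum_(0 <= n <oo) F n x)%E.
have S0 x : (0 <= S x)%E by apply: nneseries_ge0 => n _ _; exact: F0.
have mS : measurable_fun setT S.
  by apply: ge0_emeasurable_sum => // n x _ _; exact: F0.
have intS : mu.-integrable setT S.
  apply/integrableP; split=> //.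
  under eq_integral do rewrite gee0_abs//.
  rewrite integral_nneseries//.
  apply: (@le_lt_trans _ _ (\sum_(0 <= n <oo) (1 / (2 ^ n.+1)%:R)%:E)%E); last first.
    by apply: (le_lt_trans (epsilon_trick0 _ ler01)); rewrite ltry.
  apply: lee_nneseries => [n _ _|n _]; first by apply: integral_ge0.
  rewrite /F; under eq_integral do rewrite EFinM.
  rewrite ge0_integralZl//; last first.
    by apply/measurable_EFinP/strongly_measurable_sqr/L2_strongly_measurable.
  rewrite -L2_norm_sqrE -EFinM lee_fin div1r.
  by rewrite mulrC -ler_pdivlMr//; exact: wn.
exists (fine \o S); split.
- by move=> x; exact: fine_ge0.
- apply/integrableP; split.
    by apply/measurable_EFinP; exact: measurableT_comp.
  have /integrableP[_] := intS; apply: le_lt_trans.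
  apply: ge0_le_integral => //.
  + by do 2!apply: measurableT_comp => //; exact: measurableT_comp.
  + exact: measurableT_comp.
  + by move=> x _ /=; case: (S x) (S0 x) => [r _|_|]//=; rewrite ?normr0 ?leey.
- apply: filterS (integrable_ae measurableT intS) => x /(_ I) fS n.
  rewrite ler_pdivlMr// mulrC -lee_fin /= fineK//.
  rewrite -[leLHS]/(F n x).
  apply: le_trans (nneseries_lim_ge n.+1 _); last by move=> k _ _; exact: F0.
  by rewrite big_nat_recr//= leeDr// sume_ge0.
Qed.

Lemma L2_cvg_ae_subseq (u_ : nat -> L2 mu V) u : u_ n @[n --> \oo] --> u ->
  exists k : nat -> nat, (forall n, (n <= k n)%N) /\
    {ae mu, forall x, u_ (k n) x @[n --> \oo] --> u x}.
Proof.
move=> /cvg_seqP uu.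
have /choice[k hk] : forall n, exists k, (n <= k)%N /\ `|u_ k - u| ^+ 2 <= fast_rate n.
  move=> n; have e0 : 0 < Num.sqrt (fast_rate n) by rewrite sqrtr_gt0 fast_rate_gt0.
  have [N hN] := uu _ e0; exists (maxn n N); rewrite leq_maxl; split=> //.
  rewrite -(sqr_sqrtr (ltW (fast_rate_gt0 n))) lerXn2r ?nnegrE ?sqrtr_ge0// ltW//.
  by apply: hN; exact: leq_maxr.
exists k; split; first by move=> n; case: (hk n).
have [g [g0 ig hg]] := L2_fast_dominated (fun n => proj2 (hk n)).
have hB := ae_foralln (fun n => L2_reprB (u_ (k n)) u).
apply: filterS2 hg hB => x hx hxB.
apply: (cvg_seq_norm_le (d := fun n => `|u_ (k n) x - u x|)) => //.
apply: cvg_sqr0 => //.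
apply: (cvg_seq_norm_le (d := fun n => g x / 4 ^+ n)) => [n|].
  by rewrite subr0 ger0_norm ?sqr_ge0// -hxB.
rewrite -[X in _ --> X](mulr0 (g x)); apply: cvg_seqMl.
under eq_fun do rewrite -exprVn; apply: cvg_expr.
by rewrite ger0_norm// invf_lt1// ltr1n.
Qed.

End L2_completeness.

Section completeness_of_L2.
Context {dT} {T : measurableType dT} {R : realType}.
Variable mu : {measure set T -> \bar R}.
Context {V : normedModType R}.
Implicit Types (f : T -> V) (u v : L2 mu V).

Lemma integrable_scale (c : R) (g : T -> R) : mu.-integrable setT (EFin \o g) ->
  mu.-integrable setT (EFin \o (fun x => c * g x)).
Proof.
move=> ig; rewrite (_ : _ \o _ = fun x => (c%:E * (g x)%:E)%E)//.
exact: integrableZl.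
Qed.

Lemma integrable_add (f g : T -> R) : mu.-integrable setT (EFin \o f) ->
  mu.-integrable setT (EFin \o g) -> mu.-integrable setT (EFin \o (fun x => f x + g x)).
Proof.
move=> intf ig; rewrite (_ : _ \o _ = (EFin \o f) \+ (EFin \o g))%E//.
exact: integrableD.
Qed.

Lemma geometric_steps (W : normedModType R) (s : nat -> W) (C : R) :
  (forall n, `|s n.+1 - s n| <= C * 2^-1 ^+ n) ->
  forall n j, `|s (n + j)%N - s n| <= 2 * C * 2^-1 ^+ n.
Proof.
move=> hs n j.
have C0 : 0 <= C by have := hs 0%N; rewrite expr0 mulr1; exact: le_trans.
suff : `|s (n + j)%N - s n| <= 2 * C * (2^-1 ^+ n - 2^-1 ^+ (n + j)).
  move/le_trans; apply; rewrite ler_wpM2l ?mulr_ge0//.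
  by rewrite lerBlDr lerDl exprn_ge0// invr_ge0.
elim: j => [|j IH]; first by rewrite addn0 !subrr normr0 mulr0.
rewrite addnS -[s _.+1](subrK (s (n + j)%N)) -addrA.
apply: le_trans (ler_normD _ _) _; have := hs (n + j)%N; rewrite exprS; lra.
Qed.

Lemma cauchy_subseq_cvg (W : normedModType R) (s : nat -> W) (l : W) (k : nat -> nat) :
  (forall e : R, 0 < e -> exists N, forall m n, (N <= m)%N -> (N <= n)%N ->
    `|s m - s n| < e) -> (forall n, (n <= k n)%N) ->
  s (k n) @[n --> \oo] --> l -> s n @[n --> \oo] --> l.
Proof.
move=> cs kn /cvg_seqP sl; apply/cvg_seqP => e e0.
have e2 : 0 < e / 2 by rewrite divr_gt0.
have [N1 h1] := cs _ e2; have [N2 h2] := sl _ e2.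
exists (maxn N1 N2) => n; rewrite geq_max => /andP[n1 n2].
rewrite -[s n](subrK (s (k n))) -addrA; apply: le_lt_trans (ler_normD _ _) _.
rewrite [ltRHS]splitr ltrD//; last exact: h2.
by apply: h1 => //; exact: leq_trans (kn n).
Qed.

Lemma L2_step_dense u (e : R) : 0 < e ->
  exists (l : seq (set T * V)) (hl : is_L2 mu (step_fun l)),
    step_measurable l /\ `|L2_of hl - u| < e.
Proof.
move=> e0; have [s [ms su sb]] := strongly_measurable_dominated (L2_strongly_measurable u).
have ig := integrable_sqr (L2_reprP u).
have hs n : is_L2 mu (step_fun (s n)).
  apply: (is_L2_le _ (integrable_scale 4 ig)).
    by exists (fun=> s n); split=> [_|x]; [exact: ms|exact: cvg_cst].
  move=> x; have -> : 4 * `|u x| ^+ 2 = (2 * `|u x|) ^+ 2 by rewrite exprMn; lra.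
  by rewrite lerXn2r ?nnegrE ?mulr_ge0.
have : (fun n => L2_of (hs n)) n @[n --> \oo] --> u.
  apply: (L2_dominated (integrable_scale 9 ig)).
    apply: filterS (ae_foralln (fun n => L2_ofE (hs n))) => x hx.
    by under eq_fun do rewrite hx; exact: su.
  move=> n; apply: filterS (L2_ofE (hs n)) => x ->.
  have -> : 9 * `|u x| ^+ 2 = (3 * `|u x|) ^+ 2 by rewrite exprMn; lra.
  rewrite lerXn2r ?nnegrE ?mulr_ge0//.
  by apply: le_trans (ler_normB _ _) _; have := sb n x; lra.
move=> /cvg_seqP/(_ _ e0)[N /(_ N (leqnn _)) hN].
by exists (s N), (hs N).
Qed.

(** A strongly measurable function must be the limit of step functions at every point. So the
    sequence is first replaced by step functions at distance [n.+1%:R^-1], a fast subsequence of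
    these is taken, and the null set where it may diverge is cut out of the steps; the limit is then
    strongly measurable by construction. *)
Lemma L2_complete : cauchy_complete V -> cauchy_complete (L2 mu V).
Proof.
move=> cV u uc.
have hw n : exists p : {l : seq (set T * V) | is_L2 mu (step_fun l)},
    step_measurable (sval p) /\ `|L2_of (proj2_sig p) - u n| < n.+1%:R^-1.
  have [|l [hl [ml hlu]]] := L2_step_dense (u n) (e := n.+1%:R^-1).
    by rewrite invr_gt0.
  by exists (exist (fun l => is_L2 mu (step_fun l)) l hl); split.
have [p hp] := choice hw.
pose w n := L2_of (proj2_sig (p n)).
have wu : w n - u n @[n --> \oo] --> (0 : L2 mu V).
  apply: (cvg_seq_norm_le (d := fun n => n.+1%:R^-1)) => [n|]; last exact: cvg_inv_succ.
  by rewrite subr0 ltW//; case: (hp n).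
have wc (e : R) : 0 < e -> exists N, forall m n, (N <= m)%N -> (N <= n)%N ->
    `|w m - w n| < e.
  move=> e0; have e3 : 0 < e / 3 by rewrite divr_gt0.
  have [N1 h1] := uc _ e3; have /cvg_seqP/(_ _ e3)[N2 h2] := wu.
  exists (maxn N1 N2) => m n; rewrite !geq_max => /andP[m1 m2] /andP[n1 n2].
  have -> : w m - w n = (w m - u m) + (u m - u n) - (w n - u n).
    by rewrite opprB addrA !addrA !subrK.
  apply: le_lt_trans (ler_normB _ _) _.
  have := ler_normD (w m - u m) (u m - u n).
  have := h1 m n m1 n1; have := h2 m m2; have := h2 n n2; rewrite !subr0; lra.
have hK n : exists K, forall i j, (K <= i)%N -> (K <= j)%N ->
    `|w i - w j| ^+ 2 <= fast_rate n :> R.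
  have e0 : 0 < Num.sqrt (fast_rate n) :> R by rewrite sqrtr_gt0 fast_rate_gt0.
  have [N hN] := wc _ e0; exists N => i j Ni Nj.
  rewrite -(sqr_sqrtr (ltW (fast_rate_gt0 n))) lerXn2r ?nnegrE ?sqrtr_ge0// ltW//.
  exact: hN.
have [K hKn] := choice hK.
(* The sum makes [k] monotone and at least [K n]; the summand [n] makes it a subsequence. *)
pose k n := (n + \sum_(j < n.+1) K j)%N.
have kS n : (k n <= k n.+1)%N by rewrite /k [in leqRHS]big_ord_recr leq_add//= leq_addr.
have Kk n : (K n <= k n)%N by rewrite /k big_ord_recr/= addnA leq_addl.
have [g [g0 ig hg]] := L2_fast_dominated (w := fun n => w (k n.+1) - w (k n))
  (fun n => hKn n _ _ (leq_trans (Kk n) (kS n)) (Kk n)).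
pose st n := step_fun (sval (p (k n))).
have hae : {ae mu, forall x, forall n, `|st n.+1 x - st n x| <= Num.sqrt (g x) * 2^-1 ^+ n}.
  have h1 := ae_foralln (fun n => L2_reprB (w (k n.+1)) (w (k n))).
  have h2 := ae_foralln (fun n => L2_ofE (proj2_sig (p (k n)))).
  apply: filterS3 hg h1 h2 => x hgx h1x h2x n.
  have := hgx n; rewrite h1x !h2x -/(st n) -/(st n.+1) => h.
  rewrite -(@ler_pXn2r _ 2)// ?nnegrE ?mulr_ge0 ?sqrtr_ge0 ?exprn_ge0 ?invr_ge0//.
  rewrite exprMn sqr_sqrtr// (le_trans h)// -exprM mulnC exprM exprVn.
  by rewrite exprVn -[(2 ^+ 2 : R)]/(2 * 2) (_ : 2 * 2 = 4) //; ring.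
have [N [mN N0 hN]] := hae.
pose st' n := step_fun (step_restrict (sval (p (k n))) (~` N)).
have hst x n : `|st' n.+1 x - st' n x| <= Num.sqrt (g x) * 2^-1 ^+ n.
  rewrite /st' !step_fun_restrict -scalerBr indicE in_setC.
  case: (boolP (x \in N)) => [xN|]; rewrite /= ?scale0r ?scale1r.
    by rewrite normr0 mulr_ge0 ?sqrtr_ge0 ?exprn_ge0 ?invr_ge0.
  by rewrite notin_setE => xN; apply: contrapT => h; apply: xN; apply: hN => /(_ n).
have hst2 x n j : `|st' (n + j)%N x - st' n x| <= 2 * Num.sqrt (g x) * 2^-1 ^+ n.
  exact: (geometric_steps (s := fun n => st' n x)).
have geo0 x : 2 * Num.sqrt (g x) * 2^-1 ^+ n @[n --> \oo] --> 0.
  rewrite -[X in _ --> X](mulr0 (2 * Num.sqrt (g x))); apply: cvg_seqMl.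
  by apply: cvg_expr; rewrite ger0_norm// invf_lt1// ltr1n.
have hf x : exists v : V, st' n x @[n --> \oo] --> v.
  apply: cV => e e0; have e2 : 0 < e / 2 by rewrite divr_gt0.
  have /cvg_seqP/(_ _ e2)[M hM] := geo0 x.
  exists M => i j Mi Mj.
  have := hM M (leqnn _); rewrite subr0 => /(le_lt_trans (ler_norm _)) hM'.
  have := hst2 x M (i - M)%N; have := hst2 x M (j - M)%N; rewrite !subnKC// => h1 h2.
  rewrite -[st' i x](subrK (st' M x)) -addrA.
  by apply: le_lt_trans (ler_normD _ _) _; rewrite [`|st' M x - _|]distrC; lra.
have [f hfx] := choice hf.
have mf : strongly_measurable f.
  exists (fun n => step_restrict (sval (p (k n))) (~` N)); split=> // n.
  apply: step_measurable_restrict; first exact: measurableC.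
  by case: (hp (k n)).
have fst x n : `|f x - st' n x| <= 2 * Num.sqrt (g x) * 2^-1 ^+ n.
  apply: (cvg_seq_lim_le (u := fun j => `|st' (n + j)%N x - st' n x|) _ (cvg_cst _)) => //.
  apply: cvg_norm; apply: cvg_seqB; last exact: cvg_cst.
  by apply: (cvg_seq_subseq (u := fun n => st' n x) (k := fun j => (n + j)%N)) => // j; exact: leq_addl.
have sq4 x : (2 * Num.sqrt (g x)) ^+ 2 = 4 * g x by rewrite exprMn sqr_sqrtr//; ring.
have st'L2 : is_L2 mu (st' 0%N).
  have ist0 := integrable_sqr (proj2_sig (p (k 0%N))).
  apply: (is_L2_le _ ist0).
    exists (fun=> step_restrict (sval (p (k 0%N))) (~` N)); split; last by move=> x; exact: cvg_cst.
    move=> _; apply: step_measurable_restrict; first exact: measurableC.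
    by case: (hp (k 0%N)).
  move=> x; rewrite /st' step_fun_restrict indicE.
  by case: (_ \in _); rewrite /= ?scale1r// scale0r normr0 expr0n sqr_ge0.
(* From [|f| <= |st' 0| + 2 * sqrt g] and [(a + b)^2 <= 2 * a^2 + 2 * b^2], whence the factors 2 and
   8. *)
have f2 : is_L2 mu f.
  apply: (is_L2_le mf (integrable_add (integrable_scale 2 (integrable_sqr st'L2))
     (integrable_scale 8 ig))) => x.
  have := fst x 0%N; rewrite expr0 mulr1.
  rewrite -(@ler_pXn2r _ 2)// ?nnegrE ?mulr_ge0 ?sqrtr_ge0// sq4 => h.
  have h2 : `|f x| <= `|f x - st' 0%N x| + `|st' 0%N x|.
    by rewrite -[f x in leLHS](subrK (st' 0%N x)) ler_normD.
  have := normr_ge0 (f x); have := normr_ge0 (st' 0%N x); move: h2 h.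
  set a := `|f x|; set b := `|_ - _|; set c := `|_| => h2 h c0 a0.
  have h3 : a ^+ 2 <= (b + c) ^+ 2 by rewrite lerXn2r ?nnegrE// addr_ge0// normr_ge0.
  have h4 : 0 <= (b - c) ^+ 2 by exact: sqr_ge0.
  nra.
exists (L2_of f2).
apply: (cauchy_subseq_cvg uc (k := k)); first by move=> n; exact: leq_addr.
have wF : w (k n) @[n --> \oo] --> L2_of f2.
  have hw' : {ae mu, forall x, (forall n, L2_repr (w (k n)) x = st' n x) /\ L2_of f2 x = f x}.
    have h2 := ae_foralln (fun n => L2_ofE (proj2_sig (p (k n)))).
    have h3 : {ae mu, forall x, ~ N x} by exists N; split=> // x /contrapT.
    apply: filterS3 h2 h3 (L2_ofE f2) => x h2x Nx ->; split=> // n; rewrite h2x.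
    rewrite /st' step_fun_restrict indicE in_setC.
    by rewrite (_ : (x \in N) = false) ?scale1r//; apply/negbTE; rewrite notin_setE.
  apply: (L2_dominated (integrable_scale 4 ig)).
    by apply: filterS hw' => x [h1 ->]; under eq_fun do rewrite h1; exact: hfx.
  move=> n; apply: filterS hw' => x [-> ->]; rewrite -sq4 lerXn2r ?nnegrE ?mulr_ge0 ?sqrtr_ge0//.
  rewrite distrC (le_trans (fst x n))// ler_piMr ?mulr_ge0 ?sqrtr_ge0//.
  by rewrite exprn_ile1// ?invr_ge0// invf_le1// ler1n.
have -> : (fun n => u (k n)) = (fun n => w (k n) - (w (k n) - u (k n))).
  by apply/funext => n; rewrite opprB addrC subrK.
rewrite -[L2_of f2]subr0; apply: cvg_seqB => //.
by apply: (cvg_seq_subseq (u := fun n => w n - u n)) => // n; exact: leq_addr.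
Qed.

End completeness_of_L2.

Section L2_class.
Context {dT} {T : measurableType dT} {R : realType}.
Variable mu : {measure set T -> \bar R}.
Context {V : normedModType R}.

(* The class of f, or the junk value 0 when f is not square integrable. *)
Definition L2_class (f : T -> V) : L2 mu V :=
  xget 0 [set u : L2 mu V | {ae mu, forall x, u x = f x}].

Lemma L2_classE (f : T -> V) : is_L2 mu f -> {ae mu, forall x, L2_class f x = f x}.
Proof.
move=> hf; rewrite /L2_class; case: xgetP => [y _ //|/(_ (L2_of hf))].
by case; exact: L2_ofE.
Qed.

Lemma L2_repr_lin a (u v : L2 mu V) :
  {ae mu, forall x, L2_repr (a *: u + v) x = a *: u x + v x}.
Proof. by apply: filterS2 (L2_reprD (a *: u) v) (L2_reprZ a u) => x -> ->. Qed.

Lemma L2_ae_eq (u v : L2 mu V) (f : T -> V) : {ae mu, forall x, u x = f x} ->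
  {ae mu, forall x, v x = f x} -> u = v.
Proof. by move=> uf vf; apply: L2_ext; apply: filterS2 uf vf => x -> ->. Qed.

Lemma ae_constraint_closed (K : set V) : seq_closed K ->
  seq_closed [set u : L2 mu V | {ae mu, forall x, K (L2_repr u x)}].
Proof.
move=> clK u l Ku ul; have [k [kn h]] := L2_cvg_ae_subseq ul.
apply: filterS2 h (ae_foralln (fun n => Ku (k n))) => x hx Kx.
exact: clK hx.
Qed.

Lemma ae_constraint_convex (K : set V) : seg_convex K ->
  seg_convex [set u : L2 mu V | {ae mu, forall x, K (L2_repr u x)}].
Proof.
move=> cvK u v t Ku Kv t01.
have h1 := L2_reprD u (t *: (v - u)); have h2 := L2_reprZ t (v - u).
have h3 := L2_reprB v u.
have h4 : {ae mu, forall x, L2_repr (u + t *: (v - u)) x =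
      L2_repr u x + t *: (L2_repr v x - L2_repr u x)}.
  by apply: filterS3 h1 h2 h3 => x -> -> ->.
by apply: filterS3 h4 Ku Kv => x -> Kux Kvx; exact: cvK.
Qed.

End L2_class.

(** * L^2 as a Hilbert space *)

Section L2_inner_product.
Context {dT} {T : measurableType dT} {R : realType}.
Variable mu : {measure set T -> \bar R}.
Context {V : normedModType R} {hV : hilbert V}.
Implicit Types (f g : T -> V) (u v : L2 mu V).

Lemma measurable_ip f g : strongly_measurable f -> strongly_measurable g ->
  measurable_fun setT (fun x => ip (f x) (g x)).
Proof.
move=> mf mg.
(* Polarization reduces the claim to measurability of norms. *)
rewrite (_ : (fun x => _) = fun x => (`|f x + g x| ^+ 2 - `|f x - g x| ^+ 2) * 4^-1).
  apply: measurable_funM => //; apply: measurable_funB; apply: strongly_measurable_sqr.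
    exact: strongly_measurableD.
  exact: strongly_measurableB.
by apply/funext => x; rewrite norm_sqrD norm_sqrB; field.
Qed.

Lemma integrable_ip f g : is_L2 mu f -> is_L2 mu g ->
  mu.-integrable setT (EFin \o (fun x => ip (f x) (g x))).
Proof.
move=> f2 g2.
apply: le_integrable (integrable_add (integrable_sqr f2) (integrable_sqr g2)) => //.
  by apply/measurable_EFinP; apply: measurable_ip; [case: f2|case: g2].
move=> x _ /=; rewrite lee_fin (le_trans (ip_CS _ _))//.
rewrite [leRHS]ger0_norm ?addr_ge0 ?sqr_ge0//.
have : 0 <= (`|f x| - `|g x|) ^+ 2 by exact: sqr_ge0.
by have := normr_ge0 (f x); have := normr_ge0 (g x); nra.
Qed.

Definition L2_ip u v : R := \int[mu]_x ip (u x) (v x).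

Lemma L2_ip_ae u v f g : strongly_measurable f -> strongly_measurable g ->
  {ae mu, forall x, u x = f x} -> {ae mu, forall x, v x = g x} ->
  L2_ip u v = \int[mu]_x ip (f x) (g x).
Proof.
move=> mf mg uf vg; apply: ae_eq_Rintegral.
- by apply: measurable_ip; exact: L2_strongly_measurable.
- exact: measurable_ip.
- by apply: filterS2 uf vg => x -> ->.
Qed.

Lemma L2_ip_sym_bilinear : sym_bilinear L2_ip.
Proof.
split=> [u v|w a u v]; first by apply: eq_Rintegral => x _; rewrite ipC.
have h := L2_repr_lin a u v.
have sm := @L2_strongly_measurable _ _ _ mu V.
rewrite (L2_ip_ae _ (sm w) h (aeW _ (fun x => erefl))); last first.
  by apply: strongly_measurableD (sm v); exact: strongly_measurableZ.
have iu := integrable_ip (L2_reprP u) (L2_reprP w).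
have iv := integrable_ip (L2_reprP v) (L2_reprP w).
rewrite /L2_ip -RintegralZl// -RintegralD//; last exact: integrable_scale.
by apply: eq_Rintegral => x _; rewrite ip_linear.
Qed.

Lemma L2_ip_norm u : L2_ip u u = `|u| ^+ 2.
Proof. by rewrite L2_norm_sqr; apply: eq_Rintegral => x _; rewrite ip_norm. Qed.

(* Sealed, since unification would otherwise unfold [ip] to an integral. *)
Lemma L2_hilbert_sealed : {h : hilbert (L2 mu V) | @ip _ _ h = L2_ip}.
Proof.
by exists (Hilbert L2_ip_sym_bilinear L2_ip_norm (L2_complete (@hilbert_complete _ _ hV))).
Qed.

#[export] Instance L2_hilbert : hilbert (L2 mu V) := proj1_sig L2_hilbert_sealed.

Lemma L2_ipE u v f g : strongly_measurable f -> strongly_measurable g ->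
  {ae mu, forall x, u x = f x} -> {ae mu, forall x, v x = g x} ->
  ip u v = \int[mu]_x ip (f x) (g x).
Proof. by rewrite (proj2_sig L2_hilbert_sealed); exact: L2_ip_ae. Qed.

End L2_inner_product.

Section L2_map.
Context {dT} {T : measurableType dT} {R : realType}.
Variable mu : {measure set T -> \bar R}.
Context {V W : normedModType R} (B : V -> W) (M : R).
Hypothesis bB : bounded_linear B M.

Lemma is_L2_bounded_linear (f : T -> V) : is_L2 mu f -> is_L2 mu (B \o f).
Proof.
move=> f2; have [mf _] := f2.
apply: (is_L2_le _ (integrable_scale (M ^+ 2) (integrable_sqr f2))) => [|x].
  by apply: strongly_measurable_comp mf => u l; exact: (bounded_linear_cvg bB).
rewrite -exprMn lerXn2r ?nnegrE ?mulr_ge0//; first by case: bB.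
exact: (bounded_linear_le bB).
Qed.

Definition L2_map (u : L2 mu V) : L2 mu W := L2_class mu (B \o u).

Lemma L2_mapE u : {ae mu, forall x, L2_map u x = B (u x)}.
Proof. by apply: L2_classE; apply: is_L2_bounded_linear; exact: L2_reprP. Qed.

Lemma L2_map_bounded_linear : bounded_linear L2_map M.
Proof.
have [M0 lB _] := bB; split=> // [a u v|u].
  have h : {ae mu, forall x, L2_repr (a *: L2_map u + L2_map v) x =
      a *: B (L2_repr u x) + B (L2_repr v x)}.
    by apply: filterS3 (L2_repr_lin a (L2_map u) (L2_map v)) (L2_mapE u) (L2_mapE v) => x -> -> ->.
  apply: L2_ae_eq h.
  by apply: filterS2 (L2_mapE (a *: u + v)) (L2_repr_lin a u v) => x -> ->; rewrite lB.
apply: L2_norm_le => //; apply: filterS (L2_mapE u) => x ->.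
exact: (bounded_linear_le bB).
Qed.

End L2_map.

Section finite_measure_L2.
Context {dT} {T : measurableType dT} {R : realType}.
Variable mu : {measure set T -> \bar R}.
Hypothesis mu_fin : (mu setT < +oo)%E.
Context {V : normedModType R}.

Lemma integrable_cst (c : R) : mu.-integrable setT (EFin \o (fun=> c)).
Proof.
apply/integrableP; split; first by apply/measurable_EFinP; exact: measurable_cst.
rewrite (_ : (\int[mu]_x _)%E = (\int[mu]_x (cst `|c|%:E) x)%E)// integral_cst//.
by rewrite lte_mul_pinfty// lee_fin.
Qed.

Lemma is_L2_bounded (f : T -> V) (M : R) : strongly_measurable f ->
  (forall x, `|f x| <= M) -> is_L2 mu f.
Proof.
move=> mf fM; apply: (is_L2_le mf (integrable_cst (M ^+ 2))) => x.
by rewrite lerXn2r ?nnegrE// (le_trans _ (fM x)).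
Qed.

Lemma L2_norm_bound (u : L2 mu V) (M : R) : 0 <= M ->
  {ae mu, forall x, `|u x| <= M} -> `|u| ^+ 2 <= M ^+ 2 * fine (mu setT).
Proof.
move=> M0 uM; rewrite -Rintegral_cst//; apply: L2_sqr_le; first exact: integrable_cst.
by apply: filterS uM => x h; rewrite lerXn2r ?nnegrE.
Qed.

(** For projections onto convex sets, which are nonlinear and may move 0; the constant [p 0] is
    square integrable since the measure is finite. *)
Lemma is_L2_lipschitz (p : V -> V) (f : T -> V) : (forall x y, `|p x - p y| <= `|x - y|) ->
  is_L2 mu f -> is_L2 mu (p \o f).
Proof.
move=> hp f2; have [mf _] := f2.
apply: (is_L2_le _ (integrable_add (integrable_scale 2 (integrable_sqr f2))
   (integrable_cst (2 * `|p 0| ^+ 2)))) => [|x].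
  apply: strongly_measurable_comp mf => u l ul.
  by apply: (cvg_seq_norm_le (d := fun n => `|u n - l|)) => //; exact: cvg_dist0.
have : `|p (f x)| <= `|f x| + `|p 0|.
  rewrite -[p (f x)](subrK (p 0)) (le_trans (ler_normD _ _))// lerD2r.
  by have := hp (f x) 0; rewrite subr0.
rewrite /=; have := normr_ge0 (f x); have := normr_ge0 (p 0); have := normr_ge0 (p (f x)).
move: `|p (f x)| `|f x| `|p 0| => a b c a0 c0 b0 abc.
have : a ^+ 2 <= (b + c) ^+ 2 by rewrite lerXn2r ?nnegrE// addr_ge0.
have : 0 <= (b - c) ^+ 2 by exact: sqr_ge0.
nra.
Qed.

End finite_measure_L2.

Section indicators.
Context {dT} {T : measurableType dT} {R : realType}.
Variable mu : {measure set T -> \bar R}.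
Hypothesis mu_fin : (mu setT < +oo)%E.
Context {V : normedModType R} {hV : hilbert V}.

Definition L2_ind (A : set T) (y : V) : L2 mu V := L2_class mu (fun x => \1_A x *: y).

Lemma strongly_measurable_ind (A : set T) (y : V) : measurable A ->
  strongly_measurable (fun x => \1_A x *: y).
Proof.
by move=> mA; apply: strongly_measurable_restrict => //; exact: strongly_measurable_cst.
Qed.

Lemma L2_indE (A : set T) (y : V) : measurable A ->
  {ae mu, forall x, L2_ind A y x = \1_A x *: y}.
Proof.
move=> mA; apply: L2_classE; apply: (is_L2_bounded mu_fin (M := `|y|)).
  exact: strongly_measurable_ind.
by move=> x; rewrite indicE; case: (_ \in _); rewrite /= ?scale1r// scale0r normr0.
Qed.

Lemma L2_ind_ip (A : set T) (y : V) (u : L2 mu V) : measurable A ->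
  ip (L2_ind A y) u = \int[mu]_(x in A) ip y (u x).
Proof.
move=> mA; rewrite (L2_ipE (strongly_measurable_ind y mA) (L2_strongly_measurable u)
  (L2_indE y mA) (aeW _ (fun x => erefl))) [RHS]Rintegral_mkcond.
apply: eq_Rintegral => x _; rewrite patchE indicE ipZl.
by case: (_ \in _); rewrite /= ?mul1r ?mul0r.
Qed.

Lemma L2_ind_norm (A : set T) (y : V) : measurable A ->
  `|L2_ind A y| ^+ 2 = `|y| ^+ 2 * fine (mu A).
Proof.
move=> mA; rewrite -L2_ip_norm (L2_ip_ae (strongly_measurable_ind y mA)
  (strongly_measurable_ind y mA) (L2_indE y mA) (L2_indE y mA)).
rewrite -[RHS]Rintegral_cst// [RHS]Rintegral_mkcond.
apply: eq_Rintegral => x _; rewrite patchE indicE ipZl ipZr ip_norm.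
by case: (_ \in _); rewrite /= ?mul1r ?mul0r.
Qed.

Lemma L2_ind_linear (A : set T) a (y z : V) : measurable A ->
  L2_ind A (a *: y + z) = a *: L2_ind A y + L2_ind A z.
Proof.
move=> mA; apply: L2_ext.
have h : {ae mu, forall x, L2_repr (a *: L2_ind A y + L2_ind A z) x =
    a *: (\1_A x *: y) + \1_A x *: z}.
  by apply: filterS3 (L2_repr_lin a (L2_ind A y) (L2_ind A z)) (L2_indE y mA) (L2_indE z mA) => x -> -> ->.
by apply: filterS2 (L2_indE (a *: y + z) mA) h => x -> ->; rewrite scalerDr !scalerA mulrC.
Qed.

(** Step functions are dense: for nonzero [u] some step function [w], orthogonal to [u], is closer
    to [u] than [|u|], against Cauchy-Schwarz for [w - u] and [u]. *)
Lemma L2_ind_total (u : L2 mu V) :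
  (forall A y, measurable A -> ip (L2_ind A y) u = 0) -> u = 0.
Proof.
move=> hu.
have step (l : seq (set T * V)) : step_measurable l ->
    exists2 w : L2 mu V, {ae mu, forall x, w x = step_fun l x} & ip w u = 0.
  elim: l => [_|[A v] l IH ml].
    exists 0; last by rewrite ip0l.
    by apply: filterS (L2_repr0 mu V) => x ->; rewrite /step_fun big_nil.
  have mA : measurable A by apply: (ml (A, v)); rewrite inE eqxx.
  have [|w wl wu] := IH; first by move=> p pl; apply: ml; rewrite inE pl orbT.
  exists (L2_ind A v + w); last by rewrite ipDl hu// wu addr0.
  apply: filterS3 (L2_reprD (L2_ind A v) w) (L2_indE v mA) wl => x -> -> ->.
  by rewrite /step_fun big_cons.
apply/normr0_eq0/eqP/negPn/negP => u0.
have up : 0 < `|u| by rewrite lt0r u0 normr_ge0.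
have [l [hl [ml hlu]]] := L2_step_dense u up.
have [w wl wu] := step _ ml.
have wE : w = L2_of hl by apply: L2_ae_eq wl (L2_ofE hl).
pose proof (ip_CS (w - u) u) as h; move: h; rewrite ipBl wu sub0r ip_norm normrN normrX normr_id expr2.
by rewrite ler_pM2r// leNgt wE hlu.
Qed.

End indicators.

Section limn_einf_bounds.
Context {R : realType}.

Lemma limn_einf_ge0 (u : nat -> \bar R) : (forall n, (0 <= u n)%E) ->
  (0 <= limn_einf u)%E.
Proof.
move=> u0; rewrite limn_einf_lim; apply: lime_ge; first exact: is_cvg_einfs.
by apply: nearW => n; apply: le_ereal_inf_tmp => _ [k _ <-].
Qed.

Lemma limn_einf_le (u : nat -> \bar R) (c : \bar R) :
  (exists N, forall n, (N <= n)%N -> (u n <= c)%E) -> (limn_einf u <= c)%E.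
Proof.
move=> [N uc]; rewrite limn_einf_lim; apply: lime_le; first exact: is_cvg_einfs.
apply: nearW => n; apply: (@le_trans _ _ (u (maxn N n))); last by rewrite uc// leq_maxl.
by apply: ereal_inf_lbound; exists (maxn N n) => //=; exact: leq_maxr.
Qed.

End limn_einf_bounds.

(** * Bochner integrals *)

Section bochner_integration.
Context {dT} {T : measurableType dT} {R : realType}.
Variable mu : {measure set T -> \bar R}.
Hypothesis mu_fin : (mu setT < +oo)%E.

Lemma mu_set_lty (A : set T) : measurable A -> (mu A < +oo)%E.
Proof. by move=> mA; apply: le_lt_trans mu_fin; apply: le_measure; rewrite ?inE. Qed.

Lemma measurable_step_dist (V : normedModType R) (l1 l2 : seq (set T * V)) :
  step_measurable l1 -> step_measurable l2 ->
  measurable_fun setT (fun x => (`|step_fun l1 x - step_fun l2 x|)%:E).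
Proof.
move=> m1 m2; apply/measurable_EFinP; apply: strongly_measurable_norm.
apply: strongly_measurableB.
- by exists (fun=> l1); split=> // x; exact: cvg_cst.
- by exists (fun=> l2); split=> // x; exact: cvg_cst.
Qed.

Section bounded_linear_image.
Context {V W : normedModType R} (B : V -> W) (M : R) (bB : bounded_linear B M).

Definition step_map (l : seq (set T * V)) := [seq (p.1, B p.2) | p <- l].

Lemma bounded_linear_sum (I : Type) (r : seq I) (F : I -> V) :
  B (\sum_(i <- r) F i) = \sum_(i <- r) B (F i).
Proof.
elim: r => [|i r IH]; first by rewrite !big_nil (bounded_linear0 bB).
by rewrite !big_cons (bounded_linearD bB) IH.
Qed.

Lemma step_fun_map l x : step_fun (step_map l) x = B (step_fun l x).
Proof.
rewrite /step_fun bounded_linear_sum big_map.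
by apply: eq_bigr => p _; rewrite (bounded_linearZ bB).
Qed.

Lemma step_integral_map l : step_integral mu (step_map l) = B (step_integral mu l).
Proof.
rewrite /step_integral bounded_linear_sum big_map.
by apply: eq_bigr => p _; rewrite (bounded_linearZ bB).
Qed.

Lemma bochner_integral_map (f : T -> V) I :
  bochner_integral mu f I -> bochner_integral mu (B \o f) (B I).
Proof.
have [M0 _ _] := bB.
move=> [s [ms sf sc sI]]; exists (fun n => step_map (s n)); split.
- by move=> n _ /mapP[p /(ms n) hp ->].
- apply: filterS sf => x hx; under eq_fun do rewrite step_fun_map.
  exact: (bounded_linear_cvg bB).
- move=> e e0; have M1 : 0 < M + 1 by rewrite ltr_wpDl.
  have [N hN] := sc (e / (M + 1)) (divr_gt0 e0 M1); exists N => m n Nm Nn.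
  have mB := measurable_step_dist (step_integrableW (ms m)) (step_integrableW (ms n)).
  apply: (@le_lt_trans _ _ (\int[mu]_x ((M + 1)%:E * (`|step_fun (s m) x - step_fun (s n) x|)%:E))%E).
    apply: ge0_le_integral => //.
    + apply: measurable_step_dist => p /mapP[q hq ->].
        by have [] := ms m _ hq.
      by have [] := ms n _ hq.
    + by apply: measurable_funeM.
    + move=> x _; rewrite -EFinM lee_fin !step_fun_map -(bounded_linearB bB).
      by rewrite (le_trans (bounded_linear_le bB _))// ler_wpM2r// lerDl.
  rewrite ge0_integralZl//; last by rewrite lee_fin ltW.
  by rewrite muleC -lte_pdivlMr//; exact: hN.
- under eq_fun do rewrite step_integral_map.
  exact: (bounded_linear_cvg bB).
Qed.

End bounded_linear_image.

Lemma integrable_step (l : seq (set T * R^o)) : step_measurable l ->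
  mu.-integrable setT (EFin \o (step_fun l : T -> R)) /\
  \int[mu]_x (step_fun l x : R) = step_integral mu l.
Proof.
elim: l => [_|[A c] l IH ml].
  have -> : (step_fun [::] : T -> R) = fun=> 0 by apply/funext => x; rewrite /step_fun big_nil.
  split; first exact: (integrable_cst mu_fin).
  by rewrite /step_integral big_nil Rintegral_cst// mul0r.
have mA : measurable A by apply: (ml (A, c)); rewrite inE eqxx.
have [|il el] := IH; first by move=> p pl; apply: ml; rewrite inE pl orbT.
have e : (step_fun ((A, c) :: l) : T -> R) = fun x => c * \1_A x + (step_fun l x : R).
  by apply/funext => x; rewrite /step_fun big_cons /= mulrC.
have iA : mu.-integrable setT (EFin \o (fun x => \1_A x : R)).
  apply: le_integrable (integrable_cst mu_fin 1) => //.
    by apply/measurable_EFinP; exact: measurable_indic.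
  by move=> x _; rewrite /= lee_fin indicE normr1; case: (_ \in _); rewrite /= ?normr1// normr0.
have icA := integrable_scale c iA.
rewrite e; split; first exact: integrable_add.
rewrite RintegralD// RintegralZl// el /step_integral big_cons /=.
congr (_ + _); rewrite [X in _ * X](_ : _ = fine (mu A)) 1?mulrC//.
by rewrite /Rintegral integral_indic// setIT.
Qed.

(** Fatou turns the Cauchy property in mean of the steps into convergence in mean to [f], so [f] is
    integrable and the integrals of the steps tend to its Lebesgue integral. *)
Lemma bochner_integral_real (f : T -> R) (I : R) : measurable_fun setT f ->
  bochner_integral mu (f : T -> R^o) (I : R^o) -> \int[mu]_x f x = I.
Proof.
move=> mf [s [ms sf sc sI]].
have ms' n := step_integrableW (ms n).
have close (e : R) : 0 < e -> exists N, forall m, (N <= m)%N ->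
    (\int[mu]_x (`|(step_fun (s m) x : R) - f x|)%:E <= e%:E)%E.
  move=> e0; have [N hN] := sc e e0; exists N => m Nm.
  pose F n x := (`|(step_fun (s m) x : R) - step_fun (s (N + n)%N) x|)%:E.
  have mF n : measurable_fun setT (F n) by exact: measurable_step_dist.
  have F0 n x : setT x -> (0 <= F n x)%E by rewrite lee_fin.
  have hF := fatou mu measurableT mF F0.
  apply: (@le_trans _ _ (\int[mu]_x limn_einf (F^~ x))%E).
    apply: ae_ge0_le_integral => //.
    - apply/measurable_EFinP; apply: measurableT_comp => //; apply: measurable_funB => //.
      by have := measurable_step_comp (fun v : R^o => v : R) (ms' m).
    - by move=> x _; apply: limn_einf_ge0 => n; exact: F0.
    - rewrite /limn_einf; apply: measurableT_comp => //.
      by apply: measurable_fun_limn_esup => n; exact: measurableT_comp.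
    - apply: filterS sf => x sfx _.
      rewrite (_ : limn_einf _ = (`|(step_fun (s m) x : R) - f x|)%:E)//.
      apply: (cvg_limn_einf_sup _).1; apply: cvg_EFin; first exact: nearW.
      apply: cvg_norm; apply: cvg_seqB; first exact: cvg_cst.
      by apply: (cvg_seq_subseq (u := fun n => step_fun (s n) x) (k := fun n => (N + n)%N)) => // n; exact: leq_addl.
  apply: (le_trans hF).
  apply: limn_einf_le; exists 0%N => n _.
  by apply/ltW/hN => //; exact: leq_addr.
have [is_ es] : (forall n, mu.-integrable setT (EFin \o (step_fun (s n) : T -> R))) /\
    forall n, \int[mu]_x (step_fun (s n) x : R) = step_integral mu (s n).
  by split=> n; have [] := integrable_step (ms' n).
have intf : mu.-integrable setT (EFin \o f).
  have [N /(_ N (leqnn _)) hN] := close 1 ltr01.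
  have id : mu.-integrable setT (EFin \o (fun x => (step_fun (s N) x : R) - f x)).
    apply/integrableP; split; last by apply: (le_lt_trans hN); rewrite ltry.
    apply/measurable_EFinP; apply: measurable_funB => //.
    by have := measurable_step_comp (fun v : R^o => v : R) (ms' N).
  rewrite (_ : _ \o _ = EFin \o (fun x => (step_fun (s N) x : R) +
     (-1) * ((step_fun (s N) x : R) - f x))).
    by apply: integrable_add => //; exact: integrable_scale.
  by apply/funext => x /=; congr (_%:E); ring.
apply: (cvg_filter_unique (V := R^o) (F := \oo) (u := fun n => step_integral mu (s n))) => //.
apply/cvg_seqP => e e0; have [N hN] := close (e / 2) (divr_gt0 e0 (ltr0n _ 2)).
exists N => n /hN h; rewrite -es -RintegralB//.
apply: (@le_lt_trans _ _ (e / 2)); last by rewrite ltr_pdivrMr// mulr2n mulrDr mulr1 ltrDl.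
apply: le_trans (le_normr_Rintegral _ _) _ => //.
  rewrite (_ : _ \o _ = EFin \o (fun x => (step_fun (s n) x : R) + (-1) * f x)).
    by apply: integrable_add => //; exact: integrable_scale.
  by apply/funext => x /=; congr (_%:E); ring.
rewrite -lee_fin /Rintegral fineK// ge0_fin_numE; last by apply: integral_ge0.
by apply: le_lt_trans h _; rewrite ltry.
Qed.

Context {V : normedModType R} {hV : hilbert V}.

Lemma ip_bounded_linear (y : V) : bounded_linear (fun x => ip x y : R^o) `|y|.
Proof.
split=> // [a u v|u]; first by rewrite ip_linear.
by rewrite mulrC; exact: ip_CS.
Qed.

(** The functional [ip^~ y] commutes with the Bochner integral. In this way the integrals in
    [weak_dt] become inner products. *)
Lemma bochner_ip (f : T -> V) I y : strongly_measurable f ->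
  bochner_integral mu f I -> ip I y = \int[mu]_x ip (f x) y.
Proof.
move=> mf /(bochner_integral_map (ip_bounded_linear y)) /bochner_integral_real ->//.
by apply: measurable_ip => //; exact: strongly_measurable_cst.
Qed.

(** The sets of a step list may overlap, so norms cannot be added term by term; the integral [z] is
    tested with itself instead. *)
Lemma step_integral_le (l : seq (set T * V)) : step_measurable l ->
  `|step_integral mu l| <= \int[mu]_x `|step_fun l x|.
Proof.
move=> ml; set z := step_integral mu l.
have mz : step_measurable (step_map (fun x => ip x z : R^o) l).
  by move=> _ /mapP[p /ml hp ->].
have [iz ez] := integrable_step mz.
have il : mu.-integrable setT (EFin \o (fun x => `|step_fun l x|)).
  have mn : measurable_fun setT (fun x => `|step_fun l x|).
    exact: (measurable_step_comp (fun v => `|v|)).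
  elim: l ml {z mz iz ez} mn => [_|[A v] l IH ml] mn.
    rewrite (_ : (fun x => _) = fun=> 0); first exact: (integrable_cst mu_fin).
    by apply/funext => x; rewrite /step_fun big_nil normr0.
  have mA : measurable A by apply: (ml (A, v)); rewrite inE eqxx.
  have ml' : step_measurable l by move=> p pl; apply: ml; rewrite inE pl orbT.
  have mn' : measurable_fun setT (fun x => `|step_fun l x|).
    exact: (measurable_step_comp (fun v => `|v|)).
  apply: le_integrable (integrable_add (IH ml' mn') (integrable_cst mu_fin `|v|)) => //.
    exact/measurable_EFinP.
  move=> x _; rewrite /= lee_fin normr_id [leRHS]ger0_norm ?addr_ge0//.
  rewrite /step_fun big_cons /= addrC (le_trans (ler_normD _ _))// lerD2l normrZ indicE.
  by case: (_ \in _); rewrite /= ?normr1 ?mul1r// normr0 mul0r.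
have h : `|z| ^+ 2 <= `|z| * \int[mu]_x `|step_fun l x|.
  rewrite -ip_norm -[X in X <= _](step_integral_map (ip_bounded_linear z)) -ez -RintegralZl//.
  apply: le_Rintegral => //; first exact: integrable_scale.
  by move=> x _; rewrite (step_fun_map (ip_bounded_linear z)) mulrC; exact: ip_le.
have [z0|z0] := eqVneq `|z| 0; first by rewrite z0 Rintegral_ge0.
have zp : 0 < `|z| by rewrite lt0r z0 normr_ge0.
by rewrite -(ler_pM2l zp) -expr2.
Qed.

Lemma bochner_exists (f : T -> V) : is_L2 mu f -> exists I, bochner_integral mu f I.
Proof.
move=> f2; have [mf _] := f2.
have [s [ms sf sb]] := strongly_measurable_dominated mf.
have mdf n : measurable_fun setT (fun x => (`|step_fun (s n) x - f x|)%:E).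
  apply/measurable_EFinP; apply: strongly_measurable_norm; apply: strongly_measurableB => //.
  by exists (fun=> s n); split=> // x; exact: cvg_cst.
(* The steps stay within [3 * |f|] of [f], and [3 * |f| <= 3 + 3 * |f|^2], which is integrable for a
   finite measure. *)
have ig : mu.-integrable setT (EFin \o (fun x => 3 + `|f x| ^+ 2 * 3)).
  apply: integrable_add; first exact: (integrable_cst mu_fin).
  by under [fun x => _ * 3]eq_fun do rewrite mulrC; exact/integrable_scale/integrable_sqr.
have bnd n x : `|step_fun (s n) x - f x| <= 3 + `|f x| ^+ 2 * 3.
  apply: le_trans (ler_normB _ _) _; have := sb n x.
  have : 0 <= (`|f x| - 1) ^+ 2 by exact: sqr_ge0.
  by have := normr_ge0 (f x); nra.
have L1 : (\int[mu]_x (`|step_fun (s n) x - f x|)%:E)%E @[n --> \oo] --> 0%E.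
  have cf : {ae mu, forall x, setT x -> (`|step_fun (s n) x - f x|)%:E @[n --> \oo]
      --> (cst 0%E : T -> \bar R) x}.
    apply: aeW => x _; apply: cvg_EFin; first exact: nearW.
    exact: cvg_dist0.
  have bf : {ae mu, forall x n, setT x ->
      (`|(`|step_fun (s n) x - f x|)%:E| <= (EFin \o (fun x => 3 + `|f x| ^+ 2 * 3)%R) x)%E}.
    by apply: aeW => x n _; rewrite /= normr_id lee_fin.
  have [_ _] := dominated_convergence measurableT mdf (measurable_cst _) cf ig bf.
  by rewrite /= integral0.
have iB n : mu.-integrable setT (EFin \o (fun x => `|step_fun (s n) x - f x|)).
  apply: le_integrable ig => //; first exact: mdf.
  move=> x _ /=; rewrite lee_fin normr_id.
  exact: le_trans (bnd n x) (ler_norm _).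
have cs (e : R) : 0 < e -> exists N, forall m n, (N <= m)%N -> (N <= n)%N ->
    (\int[mu]_x (`|step_fun (s m) x - step_fun (s n) x|)%:E < e%:E)%E.
  move=> e0; have e2 : 0 < e / 2 by rewrite divr_gt0.
  have /cvg_EFin_seq /cvg_seqP/(_ _ e2)[N hN] : (\int[mu]_x `|step_fun (s n) x - f x|)%:E
      @[n --> \oo] --> (0 : R)%:E.
    apply: cvg_trans L1; apply: near_eq_cvg; apply: nearW => n /=.
    by rewrite /Rintegral fineK//; exact: (integrable_fin_num measurableT (iB n)).
  exists N => m n Nm Nn.
  apply: (@le_lt_trans _ _ (\int[mu]_x ((`|step_fun (s m) x - f x|)%:E +
      (`|step_fun (s n) x - f x|)%:E))%E).
    apply: ge0_le_integral => //.
    - exact: measurable_step_dist.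
    - exact: emeasurable_funD.
    - move=> x _; rewrite -EFinD lee_fin.
      have -> : step_fun (s m) x - step_fun (s n) x =
        (step_fun (s m) x - f x) - (step_fun (s n) x - f x) by rewrite opprB addrA subrK.
      exact: ler_normB.
  rewrite ge0_integralD//.
  have e1 k : (\int[mu]_x (`|step_fun (s k) x - f x|)%:E)%E =
      (\int[mu]_x `|step_fun (s k) x - f x|)%:E.
    by rewrite /Rintegral fineK//; exact: (integrable_fin_num measurableT (iB k)).
  have := hN m Nm; have := hN n Nn; rewrite !subr0 !ger0_norm ?Rintegral_ge0//.
  by rewrite !e1 -EFinD lte_fin; lra.
have [I hI] : exists I : V, step_integral mu (s n) @[n --> \oo] --> I.
  apply: hilbert_complete => e /cs[N hN]; exists N => m n Nm Nn.
  have -> : step_integral mu (s m) - step_integral mu (s n) =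
      step_integral mu (s m ++ scale_step (-1) (s n)).
    by rewrite step_integral_cat step_integral_scale scaleN1r.
  apply: le_lt_trans (step_integral_le _) _.
    by apply: step_measurable_cat => //; exact: step_measurable_scale.
  have h := hN m n Nm Nn.
  rewrite -lte_fin; apply: le_lt_trans h.
  rewrite /Rintegral; under eq_integral do rewrite step_cat step_scale scaleN1r.
  rewrite fineK// ge0_fin_numE; last by apply: integral_ge0.
  by apply: lt_trans (hN m n Nm Nn) _; rewrite ltry.
exists I, s; split=> //; last by apply: aeW.
by move=> n p pn; split; [exact: ms pn|apply: mu_set_lty; exact: ms pn].
Qed.

End bochner_integration.

(** * Functions of time *)

Section uniform_partition.
Context {R : realType} {V : normedModType R}.
Implicit Types (b t : R) (n i : nat).

Definition pt b n i : R := b * i%:R / n.+1%:R.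

(** Open on the left, so that the pieces are disjoint, cover []0, b]] and are intervals as in
    [time_ind]. *)
Definition piece b n i : set R := `]pt b n i, pt b n i.+1]%classic.

Definition pc_list b n (x : nat -> V) : seq (set (measurableTypeR R) * V) :=
  [seq (piece b n i, x i) | i : 'I_n.+1].

Definition pc b n (x : nat -> V) : measurableTypeR R -> V := step_fun (pc_list b n x).

Lemma pcE b n x t : pc b n x t = \sum_(i < n.+1) \1_(piece b n i) t *: x i.
Proof. by rewrite /pc /step_fun /pc_list /image_mem big_map big_enum. Qed.

Lemma measurable_piece b n i : measurable (piece b n i : set (measurableTypeR R)).
Proof. exact: measurable_itv. Qed.

Lemma pt0 b n : pt b n 0 = 0. Proof. by rewrite /pt mulr0 mul0r. Qed.

Lemma ptn b n : pt b n n.+1 = b. Proof. by rewrite /pt mulfK. Qed.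

Lemma ptS b n i : pt b n i.+1 = pt b n i + b / n.+1%:R.
Proof. by rewrite /pt -[i.+1%:R]natr1 mulrDr mulr1 mulrDl. Qed.

Lemma pt_le b n i j : 0 <= b -> (i <= j)%N -> pt b n i <= pt b n j.
Proof.
by move=> b0 ij; rewrite /pt ler_wpM2r ?invr_ge0// ler_wpM2l// ler_nat.
Qed.

Lemma pt_ge0 b n i : 0 <= b -> 0 <= pt b n i.
Proof. by move=> b0; rewrite -(pt0 b n) pt_le. Qed.

Lemma pt_leb b n i : 0 <= b -> (i <= n.+1)%N -> pt b n i <= b.
Proof. by move=> b0 h; rewrite -[leRHS](ptn b n) pt_le. Qed.

Lemma piece_uniq b n i j t : 0 <= b -> piece b n i t -> piece b n j t -> i = j.
Proof.
move=> b0; rewrite /piece /= !in_itv/= => /andP[a1 a2] /andP[b1 b2].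
apply/eqP; rewrite eqn_leq; apply/andP; split; rewrite leqNgt; apply/negP => h.
- by have := pt_le n b0 h; rewrite leNgt (lt_le_trans a1 b2).
- by have := pt_le n b0 h; rewrite leNgt (lt_le_trans b1 a2).
Qed.

Lemma piece_exists b n t : 0 < t <= b -> exists2 i, (i < n.+1)%N & piece b n i t.
Proof.
move=> /andP[t0 tb].
have ex : exists i, t <= pt b n i by exists n.+1; rewrite ptn.
case: (ex_minnP ex) => -[|m]; first by rewrite pt0 leNgt t0.
move=> tm hm; exists m; first by rewrite -ltnS ltnS; apply: hm; rewrite ptn.
rewrite /piece/= in_itv/= tm andbT ltNge; apply/negP => /hm.
by rewrite ltnn.
Qed.

Lemma pc_eq b n x i t : 0 <= b -> (i < n.+1)%N -> piece b n i t -> pc b n x t = x i.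
Proof.
move=> b0 ni it; rewrite pcE (bigD1 (Ordinal ni))//= big1 => [|j /eqP ji].
  by rewrite addr0 indicE mem_set// scale1r.
rewrite indicE (_ : t \in _ = false) ?scale0r//; apply/negbTE; rewrite notin_setE => jt.
by apply: ji; apply: val_inj => /=; exact: (piece_uniq b0 jt it).
Qed.

Lemma pc_out b n x t : 0 <= b -> ~ (0 < t <= b) -> pc b n x t = 0.
Proof.
move=> b0 ht; rewrite pcE big1// => i _.
rewrite indicE (_ : t \in _ = false) ?scale0r//; apply/negbTE; rewrite notin_setE => jt.
apply: ht; move: jt; rewrite /piece/= in_itv/= => /andP[h1 h2].
rewrite (le_lt_trans (pt_ge0 n i b0) h1) (le_trans h2)// pt_leb//.
Qed.

Lemma piece_dist b n i t : 0 <= b -> piece b n i t ->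
  (`|pt b n i - t| <= b / n.+1%:R) /\ (`|pt b n i.+1 - t| <= b / n.+1%:R).
Proof.
move=> b0; rewrite /piece/= in_itv/= ptS => /andP[h1 h2].
have w0 : 0 <= b / n.+1%:R by rewrite divr_ge0.
move: (b / n.+1%:R) w0 h1 h2 => w w0 h1 h2.
split; rewrite ler_norml; apply/andP; split; lra.
Qed.

Lemma width_cvg0 b : b / n.+1%:R @[n --> \oo] --> 0.
Proof. by rewrite -[X in _ --> X](mulr0 b); apply: cvg_seqMl; exact: cvg_inv_succ. Qed.

Definition cont_on b (g : R -> V) := forall t, 0 <= t <= b -> forall e : R, 0 < e ->
  exists2 r : R, 0 < r & forall s, 0 <= s <= b -> `|s - t| < r -> `|g s - g t| < e.

(** The flag [l] selects left or right end points of the pieces as sampling points; summation by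
    parts needs one of each. *)
Lemma cont_on_pc b (g : R -> V) t (l : bool) : 0 <= b -> cont_on b g -> 0 < t <= b ->
  pc b n (fun i => g (pt b n (i + l))) t @[n --> \oo] --> g t.
Proof.
move=> b0 cg t0b; have /andP[t0 tb] := t0b.
apply/cvg_seqP => e e0.
have [|r r0 hr] := cg t _ e e0; first by rewrite ltW.
have /cvg_seqP/(_ _ r0)[N hN] := width_cvg0 b.
exists N => n Nn; have [i ni it] := piece_exists n t0b.
rewrite (pc_eq _ b0 ni it); apply: hr.
  by rewrite pt_ge0//= pt_leb//; case: l; rewrite ?addn1// addn0 ltnW.
have := hN n Nn; rewrite subr0 ger0_norm ?divr_ge0//; apply: le_lt_trans.
by case: l; rewrite ?addn1 ?addn0; have [] := piece_dist b0 it.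
Qed.

Lemma strongly_measurable_pc b n x : strongly_measurable (pc b n x).
Proof.
exists (fun=> pc_list b n x); split; last by move=> t; exact: cvg_cst.
by move=> _ _ /mapP[i _ ->]; exact: measurable_piece.
Qed.

Lemma strongly_measurable_cont b (g : R -> V) : 0 <= b -> cont_on b g ->
  strongly_measurable (fun t : measurableTypeR R => \1_(`]0, b]%classic) t *: g t).
Proof.
move=> b0 cg; exists (fun n => pc_list b n (fun i => g (pt b n (i + true)))); split.
  by move=> n _ /mapP[i _ ->]; exact: measurable_piece.
move=> t; rewrite -/(pc _ _ _).
have [t0b|t0b] := boolP (0 < t <= b).
  by rewrite indicE mem_set ?scale1r; [exact: cont_on_pc|rewrite /= in_itv].
rewrite indicE (_ : t \in _ = false) ?scale0r; last first.
  by apply/negbTE; rewrite notin_setE/= in_itv; exact/negP.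
rewrite [X in X @ _ --> _](_ : _ = fun=> 0); first exact: cvg_cst.
by apply/funext => n; apply: pc_out => //; exact/negP.
Qed.

Lemma within_continuousP b (g : R -> V) :
  {within `[0, b], continuous g} <-> cont_on b g.
Proof.
rewrite subspace_continuousP; split=> h t.
  move=> t0b e e0.
  have := h t; rewrite /= in_itv/= => /(_ t0b) /cvgrPdist_lt /(_ e e0).
  rewrite near_withinE => /nbhs_ballP[r /= r0 hr]; exists r => // s s0b st.
  by rewrite distrC; apply: hr; rewrite /= ?in_itv//= /ball/= distrC.
rewrite /= in_itv/= => t0b; apply/cvgrPdist_lt => e e0.
have [r r0 hr] := h t t0b e e0.
rewrite near_withinE; apply/nbhs_ballP; exists r => //= s; rewrite /ball/= => st s0b.
by rewrite distrC; apply: hr; [move: s0b; rewrite in_itv|rewrite distrC].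
Qed.

End uniform_partition.

(** * Null sets of times and uniqueness of continuous representatives *)

Section time_interval.
Context {R : realType} (T : R) (T0 : 0 < T).
Notation mu := (time_measure T).

Lemma time_measureE (A : set (measurableTypeR R)) :
  mu A = lebesgue_measure (A `&` (`]0, T[%classic : set (measurableTypeR R))).
Proof. by []. Qed.

Lemma time_measure_itv (a b : R) : 0 <= a -> a <= b -> b <= T ->
  mu (`]a, b]%classic : set (measurableTypeR R)) = (b - a)%:E.
Proof.
move=> a0 ab bT; rewrite time_measureE.
(* The measure lives on the open interval []0, T[]: the right end point is kept for [b < T] and
   lost, at no cost, for [b = T]. *)
have [bltT|] := ltP b T.
  rewrite (_ : _ `&` _ = `]a, b]%classic); last first.
    apply/seteqP; split=> t /=; first by case.
    rewrite !in_itv/= => /andP[h1 h2]; rewrite h1 h2; split=> //.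
    by rewrite (le_lt_trans a0 h1) (le_lt_trans h2).
  rewrite lebesgue_measure_itv/= lte_fin; case: ifPn => // h.
  suff -> : b = a by rewrite subrr.
  by apply/eqP; rewrite eq_le ab leNgt h.
move=> Tb; have {bT Tb}bT : b = T by apply/eqP; rewrite eq_le bT Tb.
rewrite (_ : _ `&` _ = `]a, b[%classic); last first.
  apply/seteqP; split=> t /=; rewrite !in_itv/= -?bT.
    by move=> [/andP[-> _] /andP[_ ->]].
  by move=> /andP[h1 h2]; rewrite h1 h2 (ltW h2) (le_lt_trans a0 h1).
rewrite lebesgue_measure_itv/= lte_fin; case: ifPn => // h.
suff -> : b = a by rewrite subrr.
by apply/eqP; rewrite eq_le ab leNgt h.
Qed.

Lemma time_measureT : mu setT = T%:E.
Proof.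
rewrite time_measureE setTI lebesgue_measure_itv/= lte_fin T0.
by rewrite sube0.
Qed.

Lemma time_fin : (mu setT < +oo)%E. Proof. by rewrite time_measureT ltry. Qed.

Lemma ae_time (P : R -> Prop) : (forall t, 0 < t < T -> P t) -> {ae mu, forall t, P t}.
Proof.
move=> hP; exists (~` `]0, T[%classic); split.
- by apply: measurableC; exact: measurable_itv.
- by rewrite time_measureE setICl measure0.
- by move=> t /= nP; rewrite in_itv/= => h; apply: nP; exact: hP.
Qed.

Lemma ae_time_exists (P : R -> Prop) (a b : R) : 0 <= a -> a < b -> b <= T ->
  {ae mu, forall t, P t} -> exists t, a < t <= b /\ P t.
Proof.
move=> a0 ab bT [N [mN N0 hN]]; apply: contrapT => h.
have sub : (`]a, b]%classic : set (measurableTypeR R)) `<=` N.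
  by move=> t /=; rewrite in_itv/= => tab; apply: hN => /= Pt; apply: h; exists t.
have : (mu (`]a, b]%classic : set (measurableTypeR R)) <= mu N)%E.
  by apply: le_measure => //; rewrite inE.
by rewrite N0 time_measure_itv// ?(ltW ab)// lee_fin leNgt subr_gt0 ab.
Qed.

(** Every neighbourhood of [t] in [[0, T]] contains an interval of positive measure, in which the
    two functions agree somewhere. The interval is taken to the right of [t], and to the left for
    [t = T]. *)
Lemma cont_on_unique {V : normedModType R} (g h : R -> V) : cont_on T g -> cont_on T h ->
  {ae mu, forall t, g t = h t} -> forall t, 0 <= t <= T -> g t = h t.
Proof.
move=> cg ch gh t t0T; apply/subr0_eq/normr0_eq0/eqP/negPn/negP => ne.
pose e := `|g t - h t| / 2.
have e0 : 0 < e by rewrite divr_gt0// lt0r ne normr_ge0.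
have [r1 r10 h1] := cg t t0T e e0; have [r2 r20 h2] := ch t t0T e e0.
pose r := Num.min r1 r2; have r0 : 0 < r by rewrite lt_min r10.
have /andP[t0 tT] := t0T.
have [s [s0T st] ghs] : exists2 s, 0 <= s <= T /\ `|s - t| < r & g s = h s.
  have [tlt|] := ltP t T.
    pose b := Num.min T (t + r / 2).
    have tb : t < b by rewrite /b lt_min tlt ltrDl divr_gt0.
    have bT : b <= T by rewrite /b ge_min lexx.
    have [s [/andP[as_ sb] ghs]] := ae_time_exists t0 tb bT gh.
    exists s => //; move: sb; rewrite /b le_min => /andP[sT sr].
    rewrite (le_trans t0 (ltW as_)) sT; split=> //.
    by rewrite gtr0_norm ?subr_gt0//; lra.
  move=> Tt; have {Tt tT} tT : t = T by apply/eqP; rewrite eq_le tT Tt.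
  pose a := Num.max 0 (t - r / 2).
  have a0 : 0 <= a by rewrite /a le_max lexx.
  have at_ : a < t by rewrite /a gt_max tT T0/= ltrBlDr ltrDl divr_gt0.
  have tT' : t <= T by rewrite tT.
  have [s [/andP[as_ sb] ghs]] := ae_time_exists a0 at_ tT' gh.
  exists s => //; move: as_; rewrite /a gt_max => /andP[s0 sr].
  rewrite (ltW s0) -tT sb; split=> //.
  by rewrite ler0_norm ?subr_le0// opprB; lra.
move: st; rewrite lt_min => /andP[st1 st2].
have := h1 s s0T st1; have := h2 s s0T st2; rewrite ghs => a1 a2.
have : `|g t - h t| < e + e.
  have -> : g t - h t = (h s - h t) - (h s - g t) by rewrite opprB [RHS]addrC subrKA.
  by apply: le_lt_trans (ler_normB _ _) _; rewrite ltrD.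
by rewrite /e -splitr ltxx.
Qed.

End time_interval.

(** * Primitives of square integrable functions *)

Section primitive.
Context {R : realType} (T : R) (T0 : 0 < T) {V : normedModType R} {hV : hilbert V}.
Notation mu := (time_measure T).
Notation L2t := (L2 mu V).
Let mfin := time_fin T0.
Implicit Types (u v w : L2t) (x y z : V).

Definition time_ind a b y : L2t := L2_ind mu (`]a, b]%classic : set (measurableTypeR R)) y.

Lemma time_indE a b y : {ae mu, forall t, time_ind a b y t = \1_(`]a, b]%classic) t *: y}.
Proof. exact: L2_indE mfin _ _ _ (measurable_itv _). Qed.

Lemma time_ind_linear a b c y z :
  time_ind a b (c *: y + z) = c *: time_ind a b y + time_ind a b z.
Proof. by apply: (L2_ind_linear mfin); exact: measurable_itv. Qed.

Lemma time_ind_sqr a b y : 0 <= a -> a <= b -> b <= T ->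
  `|time_ind a b y| ^+ 2 = `|y| ^+ 2 * (b - a).
Proof.
move=> a0 ab bT; rewrite (L2_ind_norm mfin _ (measurable_itv _)).
by rewrite time_measure_itv.
Qed.

Lemma time_ind_norm a b y : 0 <= a -> a <= b -> b <= T ->
  `|time_ind a b y| = Num.sqrt (b - a) * `|y|.
Proof.
move=> a0 ab bT; apply/eqP; rewrite -(@eqrXn2 _ 2)// ?mulr_ge0 ?sqrtr_ge0//.
by rewrite time_ind_sqr// exprMn sqr_sqrtr ?subr_ge0// mulrC.
Qed.

Lemma time_ind_cat a b c y : a <= b -> b <= c ->
  time_ind a c y = time_ind a b y + time_ind b c y.
Proof.
move=> ab bc; apply: L2_ae_eq (time_indE a c y) _.
apply: filterS3 (L2_reprD (time_ind a b y) (time_ind b c y)) (time_indE a b y) (time_indE b c y).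
move=> t -> -> ->; rewrite -scalerDl; congr (_ *: _).
rewrite !indicE -natrD; congr (_%:R).
rewrite !mem_setE !in_itv/=.
case: (ltP a t) => at_ /=; last first.
  by have -> : (b < t) = false by apply/negbTE; rewrite -leNgt (le_trans at_ ab).
by case: (leP t b) => bt /=; rewrite ?(le_trans bt bc).
Qed.

(* The Riesz representative of y |-> int_0^t ip y (v s) ds; this avoids Bochner
   integrals of v over subintervals. *)
Definition primitive v t : V :=
  xget 0 [set z : V | forall y, ip y z = ip (time_ind 0 t y) v].

Lemma primitiveE v t y : 0 <= t <= T -> ip y (primitive v t) = ip (time_ind 0 t y) v.
Proof.
move=> /andP[t0 tT]; have [z hz] : exists z, forall y, ip (time_ind 0 t y) v = ip y z.
  apply: (riesz (L := Num.sqrt (t - 0) * `|v|)).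
    by move=> c x y'; rewrite time_ind_linear ip_linear.
  move=> x; apply: le_trans (ip_CS _ _) _.
  by rewrite time_ind_norm// mulrAC.
rewrite /primitive; case: xgetP => [w _ -> //|/(_ z)].
by case=> y'; rewrite hz.
Qed.

Lemma primitiveB v a b y : 0 <= a -> a <= b -> b <= T ->
  ip y (primitive v b - primitive v a) = ip (time_ind a b y) v.
Proof.
move=> a0 ab bT.
have ha : 0 <= a <= T by rewrite a0 (le_trans ab bT).
have hb : 0 <= b <= T by rewrite bT (le_trans a0 ab).
rewrite ipBr (primitiveE v y ha) (primitiveE v y hb).
by rewrite (time_ind_cat y a0 ab) ipDl addrC addKr.
Qed.

(** Cauchy-Schwarz against an indicator yields Hoelder continuity of exponent 1/2; the increment [z]
    is tested with itself. *)
Lemma primitive_lipschitz v a b : 0 <= a -> a <= b -> b <= T ->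
  `|primitive v b - primitive v a| <= Num.sqrt (b - a) * `|v|.
Proof.
move=> a0 ab bT; set z := _ - _.
have h : `|z| ^+ 2 <= `|z| * (Num.sqrt (b - a) * `|v|).
  rewrite -ip_norm primitiveB//; apply: le_trans (ip_le _ _) _.
  by rewrite time_ind_norm// [leRHS]mulrCA mulrA.
have [->|z0] := eqVneq `|z| 0; first by rewrite mulr_ge0// sqrtr_ge0.
have zp : 0 < `|z| by rewrite lt0r z0 normr_ge0.
by rewrite -(ler_pM2l zp) -expr2.
Qed.

Lemma primitive0 v : primitive v 0 = 0.
Proof.
apply: ip_ext => w; rewrite ip0l ipC primitiveE ?lexx ?ltW//.
have -> : time_ind 0 0 w = 0; last by rewrite ip0l.
apply/normr0_eq0/eqP; rewrite -sqrf_eq0 time_ind_sqr ?lexx ?ltW//.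
by rewrite subrr mulr0.
Qed.

Lemma primitive_linear t c v w : 0 <= t <= T ->
  primitive (c *: v + w) t = c *: primitive v t + primitive w t.
Proof.
move=> t0T; apply: ip_ext => y; rewrite ![ip _ y]ipC ipDr ipZr !primitiveE//.
by rewrite ipDr ipZr.
Qed.

Lemma primitive_cont x v : cont_on T (fun t => x + primitive v t).
Proof.
move=> t t0T e e0.
have v1 : 0 < `|v| + 1 by rewrite ltr_wpDl.
exists ((e / (`|v| + 1)) ^+ 2) => [|s s0T st]; first by rewrite exprn_gt0// divr_gt0.
have -> : x + primitive v s - (x + primitive v t) = primitive v s - primitive v t.
  by rewrite opprD addrACA subrr add0r.
have key a b : 0 <= a <= T -> 0 <= b <= T -> a <= b ->
    `|b - a| < (e / (`|v| + 1)) ^+ 2 -> `|primitive v b - primitive v a| < e.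
  move=> /andP[a0 aT] /andP[b0 bT] ab; rewrite ger0_norm ?subr_ge0// => h.
  apply: le_lt_trans (primitive_lipschitz v a0 ab bT) _.
  apply: (@le_lt_trans _ _ (Num.sqrt (b - a) * (`|v| + 1))).
    by rewrite ler_wpM2l ?sqrtr_ge0// lerDl.
  rewrite -ltr_pdivlMr// -(@ltr_pXn2r _ 2)// ?nnegrE ?sqrtr_ge0 ?divr_ge0 ?(ltW e0) ?(ltW v1)//.
  by rewrite sqr_sqrtr// subr_ge0.
have [ts|/ltW ts] := leP t s; first exact: key.
by rewrite distrC; apply: key => //; rewrite distrC.
Qed.

End primitive.

Section hilbert_adjoint.
Context {R : realType} {V W : normedModType R} {hV : hilbert V} {hW : hilbert W}.

Lemma adjoint_exists (B : V -> W) (M : R) : bounded_linear B M ->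
  exists2 C : W -> V, bounded_linear C M & forall x y, ip (B x) y = ip x (C y).
Proof.
move=> bB; have [M0 _ _] := bB.
have h y : exists z, forall x, ip (B x) y = ip x z.
  apply: (riesz (bounded_linear_ip_linear bB y)) => x.
  exact: (bounded_linear_ip_bounded bB).
have [C hC] := choice h; exists C => //; split=> // [a u v|u].
  by apply: ip_ext => w; rewrite ipC -hC ipDr ipZr !hC ipDl ipZl !(ipC w).
have k : `|C u| ^+ 2 <= `|C u| * (M * `|u|).
  rewrite -ip_norm -hC (le_trans (ip_le _ _))// mulrA ler_wpM2r// mulrC.
  exact: (bounded_linear_le bB).
have [->|z0] := eqVneq `|C u| 0; first by rewrite mulr_ge0.
have zp : 0 < `|C u| by rewrite lt0r z0 normr_ge0.
by rewrite -(ler_pM2l zp) -expr2.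
Qed.

End hilbert_adjoint.

Lemma L2_map_ip {dT} {T : measurableType dT} {R : realType} (mu : {measure set T -> \bar R})
    {V W : normedModType R} {hV : hilbert V} {hW : hilbert W} (B : V -> W) (C : W -> V) (M : R)
    (u : L2 mu V) (w : L2 mu W) :
  bounded_linear B M -> bounded_linear C M -> (forall x y, ip (B x) y = ip x (C y)) ->
  ip (L2_map B u) w = ip u (L2_map C w).
Proof.
move=> bB bC BC.
have sm (X Y : normedModType R) (D : X -> Y) (z : L2 mu X) : bounded_linear D M ->
    strongly_measurable (fun x => D (z x)).
  move=> bD; apply: strongly_measurable_comp (L2_strongly_measurable z) => s l.
  exact: (bounded_linear_cvg bD).
rewrite (L2_ipE (sm _ _ _ u bB) (L2_strongly_measurable w) (L2_mapE bB u) (aeW _ (fun x => erefl))).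
rewrite (L2_ipE (L2_strongly_measurable u) (sm _ _ _ w bC) (aeW _ (fun x => erefl)) (L2_mapE bC w)).
by apply: eq_Rintegral => x _; rewrite BC.
Qed.

Lemma L2_repr_sum {dT} {T : measurableType dT} {R : realType} (mu : {measure set T -> \bar R})
    {V : normedModType R} (I : Type) (r : seq I) (F : I -> L2 mu V) :
  {ae mu, forall x, L2_repr (\sum_(i <- r) F i) x = \sum_(i <- r) F i x}.
Proof.
elim: r => [|i r IH].
  by rewrite big_nil; apply: filterS (L2_repr0 mu V) => x ->; rewrite big_nil.
rewrite big_cons; apply: filterS2 (L2_reprD (F i) (\sum_(j <- r) F j)) IH => x -> ->.
by rewrite big_cons.
Qed.

(** * Integration by parts in time *)

Section integration_by_parts.
Context {R : realType} (T : R) (T0 : 0 < T) {V : normedModType R} {hV : hilbert V}.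
Notation mu := (time_measure T).
Notation L2t := (L2 mu V).
Let mfin := time_fin T0.
Implicit Types (u v w : L2t) (x y z : V).

Lemma cont_on_bounded (g : R -> V) : cont_on T g ->
  exists2 M, 0 <= M & forall t, 0 <= t <= T -> `|g t| <= M.
Proof.
move=> cg.
have cn : {within `[0, T], continuous (fun t => `|g t| : R)}.
  have : cont_on T (fun t => `|g t| : R^o).
    move=> t t0T e e0; have [r r0 hr] := cg t t0T e e0; exists r => // s s0T st.
    by apply: le_lt_trans (hr s s0T st); rewrite ler_dist_dist.
  by move/within_continuousP.
have [c _ hc] := EVT_max (ltW T0) cn.
by exists `|g c| => // t t0T; apply: hc; rewrite in_itv.
Qed.

Lemma cont_onW (b : R) (g : R -> V) : b <= T -> cont_on T g -> cont_on b g.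
Proof.
move=> bT cg t /andP[t0 tb] e e0.
have [|r r0 hr] := cg t _ e e0; first by rewrite t0 (le_trans tb).
by exists r => // s /andP[s0 sb]; apply: hr; rewrite s0 (le_trans sb).
Qed.

(** Integrals over []0, b]] become inner products in the fixed space over []0, T[]. *)
Definition time_cut b (g : R -> V) : L2t := L2_class mu (fun t => \1_(`]0, b]%classic) t *: g t).

Lemma time_cutE b (g : R -> V) : 0 <= b <= T -> cont_on T g ->
  {ae mu, forall t, time_cut b g t = \1_(`]0, b]%classic) t *: g t}.
Proof.
move=> /andP[b0 bT] cg; have [M M0 hM] := cont_on_bounded cg.
apply: L2_classE; apply: (is_L2_bounded mfin (M := M)).
  by apply: strongly_measurable_cont => //; exact: cont_onW cg.
move=> t; rewrite indicE mem_setE in_itv/=.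
case: (boolP (0 < t <= b)) => [/andP[t0 tb]|_].
  by rewrite scale1r hM// (ltW t0) (le_trans tb).
by rewrite scale0r normr0.
Qed.

Lemma time_classE (g : R -> V) : cont_on T g ->
  {ae mu, forall t, time_cut T g t = g t}.
Proof.
move=> cg; have T1 : 0 <= T <= T by rewrite lexx ltW.
have h : {ae mu, forall t, 0 < t < T} by exact: ae_time.
apply: filterS2 (time_cutE T1 cg) h => t -> /andP[t0 tT].
by rewrite indicE mem_setE in_itv/= t0 ltW// scale1r.
Qed.

Definition pcL b n (x : nat -> V) : L2t :=
  \sum_(i < n.+1) time_ind T (pt b n i) (pt b n i.+1) (x i).

Lemma pcLE b n (x : nat -> V) : {ae mu, forall t, pcL b n x t = pc b n x t}.
Proof.
have h := ae_foralln (fun i => time_indE T0 (pt b n i) (pt b n i.+1) (x i)).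
have h2 := L2_repr_sum (index_enum 'I_n.+1)
  (fun i : 'I_n.+1 => time_ind T (pt b n i) (pt b n i.+1) (x i)).
apply: filterS2 h2 h => t -> ht; rewrite pcE.
by apply: eq_bigr => i _; rewrite ht.
Qed.

Lemma pcL_ip b n (x : nat -> V) v : 0 <= b <= T -> ip (pcL b n x) v =
  \sum_(i < n.+1) ip (x i) (primitive v (pt b n i.+1) - primitive v (pt b n i)).
Proof.
move=> /andP[b0 bT]; rewrite ip_suml; apply: eq_bigr => i _.
rewrite primitiveB ?pt_ge0 ?pt_le//.
by rewrite (le_trans (pt_leb b0 (ltn_ord i))).
Qed.

Lemma pcL_cvg b (g : R -> V) (l : bool) : 0 <= b <= T -> cont_on T g ->
  pcL b n (fun i => g (pt b n (i + l))) @[n --> \oo] --> time_cut b g.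
Proof.
move=> b0T cg; have /andP[b0 bT] := b0T; have [M M0 hM] := cont_on_bounded cg.
have cgb := cont_onW bT cg.
have pcM n (t : R) : `|pc b n (fun i => g (pt b n (i + l))) t| <= M.
  have [t0b|/negP t0b] := boolP (0 < t <= b); last by rewrite pc_out// normr0.
  have [i ni it] := piece_exists n t0b; rewrite (pc_eq _ b0 ni it) hM//.
  rewrite pt_ge0//= (le_trans _ bT)// pt_leb//.
  by case: l; rewrite ?addn1// addn0 ltnW.
apply: (L2_dominated (g := fun=> (2 * M) ^+ 2)).
- exact: integrable_cst mfin _.
- apply: filterS2 (time_cutE b0T cg)
    (ae_foralln (fun n => pcLE b n (fun i => g (pt b n (i + l))))) => t -> ht.
  under eq_fun do rewrite ht.
  have [t0b|t0b] := boolP (0 < t <= b).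
    by rewrite indicE mem_setE in_itv/= t0b scale1r; exact: cont_on_pc.
  rewrite indicE mem_setE in_itv/= (negbTE t0b) scale0r.
  apply: (cvg_seq_norm_le (d := fun=> 0)) => [n|]; last exact: cvg_cst.
  by rewrite pc_out ?subr0 ?normr0//; exact/negP.
- move=> n; apply: filterS2 (time_cutE b0T cg)
    (pcLE b n (fun i => g (pt b n (i + l)))) => t -> ->.
  rewrite lerXn2r ?nnegrE ?mulr_ge0//; apply: le_trans (ler_normB _ _) _.
  rewrite mulr2n mulrDl mul1r lerD//.
  rewrite indicE mem_setE in_itv/=; case: (boolP (0 < t <= b)) => [/andP[t0 tb]|_].
    by rewrite scale1r hM// (ltW t0) (le_trans tb).
  by rewrite scale0r normr0.
Qed.

(* Abel summation over uniform partitions, whose sums are inner products with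
   piecewise constant interpolants. *)
Lemma time_by_parts b x y v w : 0 <= b <= T ->
  ip (x + primitive v b) (y + primitive w b) - ip x y =
  ip (time_cut b (fun t => y + primitive w t)) v +
  ip (time_cut b (fun t => x + primitive v t)) w.
Proof.
move=> b0T; have /andP[b0 bT] := b0T.
pose f t := x + @primitive _ T V hV v t; pose g t := y + @primitive _ T V hV w t.
have cf : cont_on T f by exact: primitive_cont.
have cg : cont_on T g by exact: primitive_cont.
have f0 : f 0 = x by rewrite /f (primitive0 T0) addr0.
have g0 : g 0 = y by rewrite /g (primitive0 T0) addr0.
(* Each increment of [ip f g] splits exactly as [ip (f' - f) g' + ip f (g' - g)], primes denoting
   values at the right end; hence right samples for [g] and left samples for [f]. *)
have sums n : ip (f b) (g b) - ip x y =
    ip (pcL b n (fun i => g (pt b n (i + true)))) v +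
    ip (pcL b n (fun i => f (pt b n (i + false)))) w.
  rewrite !pcL_ip// -big_split/=.
  transitivity (\sum_(0 <= i < n.+1) (ip (f (pt b n i.+1)) (g (pt b n i.+1)) -
      ip (f (pt b n i)) (g (pt b n i)))).
    by rewrite telescope_sumr// ptn pt0 f0 g0.
  rewrite big_mkord; apply: eq_bigr => i _; rewrite addn1 addn0.
  have -> : primitive v (pt b n i.+1) - primitive v (pt b n i) =
    f (pt b n i.+1) - f (pt b n i) by rewrite /f opprD addrACA subrr add0r.
  have -> : primitive w (pt b n i.+1) - primitive w (pt b n i) =
    g (pt b n i.+1) - g (pt b n i) by rewrite /g opprD addrACA subrr add0r.
  by rewrite !ipBr (ipC (g _) (f (pt b n i.+1))) (ipC (g _) (f (pt b n i))); ring.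
apply: (cvg_filter_unique (V := R^o) (F := \oo) (u := fun=> ip (f b) (g b) - ip x y)).
  exact: cvg_cst.
under eq_fun => n do rewrite (sums n).
by apply: (@cvg_seqD _ R^o); apply: cvg_ipl; exact: pcL_cvg.
Qed.

End integration_by_parts.

Section primitive_map.
Context {R : realType} (T : R) (T0 : 0 < T) {V W : normedModType R}
  {hV : hilbert V} {hW : hilbert W}.
Notation mu := (time_measure T).

(** The primitive is defined by duality, so [B] is carried over by its adjoint [C], which maps
    [time_ind T 0 t y] to [time_ind T 0 t (C y)]. *)
Lemma primitive_map (B : V -> W) (M : R) (v : L2 mu V) t : bounded_linear B M ->
  0 <= t <= T -> B (primitive v t) = primitive (L2_map B v) t.
Proof.
move=> bB t0T; have [C bC BC] := adjoint_exists bB.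
apply: ip_ext => y; rewrite BC ![ip _ y]ipC ipC !primitiveE//.
rewrite [RHS]ipC (L2_map_ip _ _ bB bC BC) [RHS]ipC; congr (ip _ _).
apply: L2_ae_eq (time_indE T0 0 t (C y)) _.
apply: filterS2 (L2_mapE bC (time_ind T 0 t y)) (time_indE T0 0 t y) => s -> ->.
by rewrite (bounded_linearZ bC).
Qed.

End primitive_map.

(** * Test functions and weak time derivatives *)

Section test_functions.
Context {R : realType} (T : R) (T0 : 0 < T).
Notation mu := (time_measure T).
Notation leb := (@lebesgue_measure R).

Lemma Rintegral_time_lebesgue (D : set (measurableTypeR R)) (f : R -> R) :
  D `<=` `]0, T[%classic -> \int[mu]_(t in D) f t = \int[leb]_(t in D) f t.
Proof.
move=> DT; congr fine; apply: eq_measure_integral => A mA AD.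
by rewrite time_measureE setIidl//; exact: subset_trans DT.
Qed.

Lemma cont_on_continuous {V : normedModType R} b (g : R -> V) : continuous g -> cont_on b g.
Proof. by move=> cg; apply/within_continuousP; exact: continuous_subspaceT. Qed.

Lemma cont_on_scale {V : normedModType R} (b : R) (f : R -> R) (y : V) :
  cont_on b (f : R -> R^o) -> cont_on b (fun t => f t *: y).
Proof.
move=> cf t t0b e e0; have y1 : 0 < `|y| + 1 by rewrite ltr_wpDl.
have [r r0 hr] := cf t t0b _ (divr_gt0 e0 y1); exists r => // s s0b st.
rewrite -scalerBl normrZ; have := hr s s0b st; rewrite ltr_pdivlMr// => /(le_lt_trans _); apply.
by rewrite ler_wpM2l// lerDl.
Qed.

Lemma time_cut_eq {V : normedModType R} b (f g : R -> V) :
  (forall t, 0 <= t <= b -> f t = g t) -> time_cut T b f = time_cut T b g.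
Proof.
move=> fg; congr (L2_class _ _); apply/funext => t; rewrite indicE mem_setE in_itv/=.
case: (boolP (0 < t <= b)) => [/andP[t0 tb]|_]; last by rewrite !scale0r.
by rewrite fg// (ltW t0).
Qed.

Lemma time_test_derivable phi : time_test T phi -> forall t, derivable phi t 1.
Proof. by move=> [h _ _]; exact: (h 0%N). Qed.

Lemma time_test_continuous phi : time_test T phi ->
  continuous phi /\ continuous (derive1 phi).
Proof.
move=> [h _ _]; split=> t; apply/differentiable_continuous/derivable1_diffP.
- exact: (h 0%N).
- exact: (h 1%N).
Qed.

Lemma time_test_bnd phi : time_test T phi -> phi 0 = 0 /\ phi T = 0.
Proof.
move=> [_ _ s]; have h t : ~ (0 < t < T) -> phi t = 0.
  move=> nt; apply/eqP/negPn/negP => ne; apply: nt.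
  have : support_of phi t by apply: subset_closure.
  by move=> /s; rewrite /= in_itv.
by split; apply: h; rewrite ltxx ?andbF.
Qed.

Lemma continuous_integrable_itv (f : R -> R) t : continuous f ->
  leb.-integrable `[0, t] (EFin \o f).
Proof.
move=> cf; have cw : {within `[0, t], continuous f} by exact: continuous_subspaceT.
by apply: continuous_compact_integrable => //; exact: segment_compact.
Qed.

Lemma ftc_lebesgue (phi : R -> R) t : (forall s, derivable phi s 1) ->
  continuous (derive1 phi) -> 0 < t ->
  \int[leb]_(s in `]0, t]) derive1 phi s = phi t - phi 0.
Proof.
move=> dphi cphi t0.
have cw : {within `[0, t], continuous (derive1 phi)} by exact: continuous_subspaceT.
have it := continuous_integrable_itv t cphi.
have cphi0 : continuous phi.
  by move=> s; apply/differentiable_continuous/derivable1_diffP.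
have D : derivable_oo_LRcontinuous phi 0 t.
  split; first by move=> s _; exact: dphi.
  - by apply: cvg_at_right_filter; exact: cphi0.
  - by apply: cvg_at_left_filter; exact: cphi0.
have := continuous_FTC2 t0 cw D (fun _ _ => erefl).
rewrite Rintegral_itv_obnd_cbnd; last first.
  by apply: integrableS it => //; exact: subset_itv_oc_cc.
by rewrite /Rintegral => ->.
Qed.

Context {V : normedModType R} {hV : hilbert V}.
Notation L2t := (L2 mu V).
Let mfin := time_fin T0.
Implicit Types (u v w : L2t) (x y z : V).

Lemma strongly_measurable_time_ind (a b : R) z :
  strongly_measurable (fun t : measurableTypeR R => \1_(`]a, b]%classic) t *: z).
Proof. by apply: strongly_measurable_ind; exact: measurable_itv. Qed.

(** The fundamental theorem of calculus for [phi] under the inner product, on the open interval;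
    continuity adds the end points. With [phi] a test function it feeds the integration by parts,
    with [phi] the identity it gives primitives of constants. *)
Lemma primitive_derive (phi : R -> R) y t : (forall s, derivable phi s 1) ->
  continuous (derive1 phi) -> 0 <= t <= T ->
  phi t *: y = phi 0 *: y + primitive (time_cut T T (fun s => derive1 phi s *: y)) t.
Proof.
move=> dphi cphi; move: t.
have cphi0 : continuous phi.
  by move=> s; apply/differentiable_continuous/derivable1_diffP.
have T1 : 0 <= T <= T by rewrite lexx ltW.
have cy : cont_on T (fun s => derive1 phi s *: y).
  by apply: cont_on_scale; exact: cont_on_continuous.
apply: (cont_on_unique T0).
- by apply: cont_on_scale; exact: cont_on_continuous.
- exact: primitive_cont.
apply: ae_time => // t /andP[t0 tT].
have tT1 : 0 <= t <= T by rewrite !ltW.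
apply/eqP; rewrite addrC -subr_eq -scalerBl; apply/eqP.
apply: ip_ext => z; rewrite ipZl [RHS]ipC primitiveE//.
rewrite (L2_ipE (strongly_measurable_time_ind 0 t z)
  (strongly_measurable_cont (ltW T0) cy) (time_indE T0 0 t z) (time_cutE T0 T1 cy)).
rewrite (_ : (fun s => _) = (fun s => (ip y z * derive1 phi s)) \_ (`]0, t]%classic : set R)); last first.
  apply/funext => s; rewrite patchE !indicE !mem_setE !in_itv/=.
  case: (boolP (0 < s <= t)) => [/andP[s0 st]|_]; last by rewrite scale0r ip0l.
  by rewrite s0 (le_trans st (ltW tT)) !scale1r ipZr ipC mulrC.
rewrite -Rintegral_mkcond Rintegral_time_lebesgue; last first.
  by move=> s /=; rewrite !in_itv/= => /andP[-> st]; exact: le_lt_trans tT.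
rewrite RintegralZl//; last first.
  apply: integrableS (continuous_integrable_itv t cphi) => //.
  exact: subset_itv_oc_cc.
by rewrite ftc_lebesgue// mulrC.
Qed.

Lemma is_L2_scale (psi : R -> R) u : continuous psi ->
  is_L2 mu (fun t => (\1_(`]0, T]%classic) t * psi t) *: u t).
Proof.
move=> cpsi; have cp : cont_on T (psi : R -> R^o) by exact: cont_on_continuous.
have [M M0 hM] := cont_on_bounded T0 cp.
apply: (is_L2_le _ (integrable_scale (M ^+ 2) (integrable_sqr (L2_reprP u)))) => [|t].
  apply: strongly_measurable_scale (L2_strongly_measurable u).
  exact: (strongly_measurable_cont (ltW T0) cp).
rewrite normrZ exprMn ler_wpM2r ?sqr_ge0// lerXn2r ?nnegrE//.
rewrite indicE mem_setE in_itv/=; case: (boolP (0 < t <= T)) => [/andP[t0 tT]|_].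
  by rewrite mul1r hM// (ltW t0).
by rewrite mul0r normr0.
Qed.

Lemma ae_time_scale (psi : R -> R) u :
  {ae mu, forall t, (\1_(`]0, T]%classic) t * psi t) *: u t = psi t *: u t}.
Proof.
apply: ae_time => // t /andP[t0 tT].
by rewrite indicE mem_setE in_itv/= t0 (ltW tT) mul1r.
Qed.

Lemma bochner_scale_ip (psi : R -> R) u I y : continuous psi ->
  bochner_integral mu (fun t => psi t *: u t) I ->
  ip I y = ip (time_cut T T (fun t => psi t *: y)) u.
Proof.
move=> cpsi hI.
have T1 : 0 <= T <= T by rewrite lexx ltW.
have cy : cont_on T (fun s => psi s *: y).
  by apply: cont_on_scale; exact: cont_on_continuous.
have [ms _] := is_L2_scale u cpsi.
have hI' : bochner_integral mu (fun t => (\1_(`]0, T]%classic) t * psi t) *: u t) I.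
  apply: bochner_integral_ae hI; apply: ae_time => // t /andP[t0 tT].
  by rewrite indicE mem_setE in_itv/= t0 (ltW tT) mul1r.
rewrite (bochner_ip mfin y ms hI').
rewrite (L2_ipE (strongly_measurable_cont (ltW T0) cy) (L2_strongly_measurable u)
  (time_cutE T0 T1 cy) (aeW mu (fun t => erefl (u t)))).
by apply: eq_Rintegral => t _; rewrite !ipZl mulrA (ipC y).
Qed.

Lemma bochner_scale_exists (psi : R -> R) u : continuous psi ->
  exists I, bochner_integral mu (fun t => psi t *: u t) I.
Proof.
move=> cpsi; have [I hI] := bochner_exists mfin (is_L2_scale u cpsi).
by exists I; apply: bochner_integral_ae hI; exact: ae_time_scale.
Qed.

(** Bochner integrals disappear from the weak derivative: for these integrands they always exist,
    and their inner products with all [y] determine them. *)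
Lemma weak_dt_ipP u v : weak_dt u v <-> forall phi y, time_test T phi ->
  ip (time_cut T T (fun t => derive1 phi t *: y)) u = - ip (time_cut T T (fun t => phi t *: y)) v.
Proof.
split=> [h phi y tphi|h phi tphi]; have [c1 c2] := time_test_continuous tphi.
  have [I [I1 I2]] := h phi tphi.
  by rewrite -(bochner_scale_ip y c2 I1) -(bochner_scale_ip y c1 I2) ipNl opprK.
have [I I1] := bochner_scale_exists u c2; have [J J1] := bochner_scale_exists v c1.
exists I; split => //; have -> : - I = J; last by [].
apply: ip_ext => y; rewrite ipNl (bochner_scale_ip y c2 I1) (bochner_scale_ip y c1 J1).
by rewrite h// opprK.
Qed.

(** Integration by parts against [phi t *: y], which vanishes at 0 and [T]. *)
Lemma weak_dt_primitive x v : weak_dt (time_cut T T (fun t => x + primitive v t)) v.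
Proof.
apply/weak_dt_ipP => phi y tphi.
have [c1 c2] := time_test_continuous tphi; have d1 := time_test_derivable tphi.
have [p0 pT] := time_test_bnd tphi.
have T1 : 0 <= T <= T by rewrite lexx ltW.
pose w := time_cut T T (fun s => derive1 phi s *: y).
have hw t : 0 <= t <= T -> phi t *: y = phi 0 *: y + primitive w t.
  exact: primitive_derive.
pose proof (time_by_parts T0 x (phi 0 *: y) v w T1) as bp; move: bp.
rewrite -(hw T T1) p0 pT !scale0r !ip0r subrr -/w.
rewrite (_ : time_cut T T (fun t => 0 + primitive w t) = time_cut T T (fun t => phi t *: y)); last first.
  by apply: time_cut_eq => t t0T; rewrite hw// p0 scale0r.
by move=> /esym/eqP; rewrite addrC addr_eq0 ipC => /eqP.
Qed.

(** For each [y] the scalar function [ip y w] has zero integral over every initial interval, hence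
    vanishes almost everywhere by Lebesgue differentiation; [L2_ind_total] then gives [w = 0]. *)
Lemma primitive_inj w : (forall t, 0 <= t <= T -> primitive w t = 0) -> w = 0.
Proof.
move=> hw; apply: (L2_ind_total mfin) => A y mA.
pose h t : R := @ip _ _ hV y (L2_repr w t).
have mh : measurable_fun setT h.
  apply: measurable_ip (L2_strongly_measurable w).
  exact: strongly_measurable_cst.
have hmu : mu.-integrable setT (EFin \o h).
  apply: integrable_ip (L2_reprP w).
  by apply: (is_L2_bounded mfin (M := `|y|)) => //; exact: strongly_measurable_cst.
have mT : measurable (`]0, T[%classic : set (measurableTypeR R)) by exact: measurable_itv.
have hleb : leb.-integrable `]0, T[ (EFin \o h).
  have /integrableP[_ hlt] := integrableS measurableT mT (@subsetT _ _) hmu.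
  apply/integrableP; split; first by apply/measurable_EFinP; exact: measurable_funTS.
  apply: le_lt_trans hlt; rewrite le_eqVlt; apply/orP; left; apply/eqP.
  by apply: eq_measure_integral => B mB BT; rewrite time_measureE setIidl.
pose g := h \_ (`]0, T[%classic : set R).
have Fx (s : R) : \int[leb]_(t in `]-oo, s]) g t = 0.
  rewrite /g -Rintegral_mkcondr -Rintegral_time_lebesgue; last by move=> t [].
  rewrite -L2_ind_ip//; last first.
    by apply: measurableI; exact: measurable_itv.
  (* [s] is clamped to [[0, T]], since [g] is [h] extended by 0 to the whole line. *)
  pose c := Num.max 0 (Num.min s T).
  have c0T : 0 <= c <= T by rewrite /c le_max lexx/= ge_max (ltW T0)/= ge_min lexx orbT.
  rewrite (_ : L2_ind _ _ _ = time_ind T 0 c y).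
    by rewrite -primitiveE// hw// ip0r.
  apply: L2_ae_eq (L2_indE mfin _ _) _; first by apply: measurableI; exact: measurable_itv.
  have ht : {ae mu, forall t, 0 < t < T} by exact: ae_time.
  apply: filterS2 (time_indE T0 0 c y) ht => t -> /andP[t0 tT].
  rewrite !indicE in_setI !mem_setE !in_itv/= t0 tT /= andbT.
  by rewrite /c le_max le_min leNgt t0/= (ltW tT) andbT.
have gint : leb.-integrable setT (EFin \o g).
  by rewrite /g -restrict_EFin; apply/(integrable_mkcond _ mT).
have gy (s : R) : leb.-integrable `]-oo, s] (EFin \o g) by exact: integrableS gint.
have g0 : {ae leb, forall t, g t = 0}.
  have hF := FTC1Ny gy (integrable_locally mT hleb).
  move: hF; apply: filterS; first exact: (ae_filter_ringOfSetsType leb).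
  move=> t [_]; rewrite (_ : (fun x : R => \int[leb]_(s in `]-oo, x]) g s) = cst 0); last by apply/funext => s; exact: Fx.
  by rewrite derive1_cst => <-.
have h0 : {ae mu, forall t, h t = 0}.
  have [N [mN N0 hN]] := g0.
  have N0' : {ae mu, forall t, ~ N t}.
    exists N; split => // [|t /contrapT//].
    rewrite time_measureE; apply/eqP; rewrite eq_le measure_ge0 andbT -N0.
    by apply: le_measure; rewrite ?inE//; apply: measurableI.
  have ht : {ae mu, forall t, 0 < t < T} by exact: ae_time.
  apply: filterS2 N0' ht => t nN t0T.
  have : g t = 0 by apply: contrapT => gt; apply: nN; apply: hN.
  by rewrite /g patchE mem_setE in_itv/= t0T.
rewrite L2_ind_ip// Rintegral_mkcond (@ae_eq_Rintegral _ _ _ mu _ (fun=> 0)).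
- by rewrite Rintegral_cst// mul0r.
- by apply/(measurable_restrictT _ mA); exact: measurable_funTS.
- exact: measurable_cst.
- by apply: filterS h0 => t ht; rewrite patchE; case: ifP.
Qed.

End test_functions.

(** * Smooth bump functions *)

Section bump_functions.
Context {R : realType}.
Implicit Types (f g : R -> R) (t : R).

(** Differentiability with explicit derivatives, so that sums, products and affine substitutions go
    by induction on the order; [ndiff_derivable] translates it into the [derive1n] of
    [time_test]. *)
Fixpoint ndiff n f : Prop := if n is m.+1
  then exists2 f', (forall t, is_derive t 1 f (f' t)) & ndiff m f' else True.

Lemma ndiffD n f g : ndiff n f -> ndiff n g -> ndiff n (fun t => f t + g t).
Proof.
elim: n f g => [//|n IH] f g [f' df nf] [g' dg ng].
exists (fun t => f' t + g' t); last exact: IH.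
by move=> t; have := is_deriveD (df t) (dg t).
Qed.

Lemma ndiffW n f : ndiff n.+1 f -> ndiff n f.
Proof. by elim: n f => [//|n IH] f [f' df nf]; exists f' => //; exact: IH. Qed.

Lemma ndiffM n f g : ndiff n f -> ndiff n g -> ndiff n (fun t => f t * g t).
Proof.
elim: n f g => [//|n IH] f g nf ng; have [f' df nf'] := nf; have [g' dg ng'] := ng.
exists (fun t => f t * g' t + g t * f' t).
  by move=> t; have := is_deriveM (df t) (dg t).
by apply: ndiffD; apply: IH => //; exact: ndiffW.
Qed.

Lemma ndiff_cst n (c : R) : ndiff n (fun=> c).
Proof. by elim: n c => [//|n IH] c; exists (fun=> 0) => // t; exact: is_derive_cst. Qed.

Lemma ndiff_affine n f (c d : R) : ndiff n f -> ndiff n (fun t => f (c * t + d)).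
Proof.
elim: n f => [//|n IH] f [f' df nf].
exists (fun t => f' (c * t + d) * c); last by apply: ndiffM; [exact: IH|exact: ndiff_cst].
move=> t; have h : is_derive t 1 (fun t : R => c * t + d) c.
  have h1 := is_deriveZ c (is_derive_id t (1 : R)).
  by have := is_deriveD h1 (is_derive_cst d t 1); rewrite addr0 -[c *: 1]/(c * 1) mulr1.
exact: (is_derive1_comp (df _) h).
Qed.

(* The derivatives of flat 0 are linear combinations of these functions. *)
Definition flat (m : nat) t : R := if 0 < t then t^-1 ^+ m * expR (- t^-1) else 0.

(** From [exp y = exp (y / (k + 1)) ^ (k + 1)] and [exp z >= 1 + z]. *)
Lemma expRN_le (y : R) (k : nat) : 0 < y -> expR (- y) <= (k.+1%:R / y) ^+ k.+1.
Proof.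
move=> y0; rewrite expRN -[leRHS]invrK lef_pV2 ?posrE ?expR_gt0//; last first.
  by rewrite invr_gt0 exprn_gt0// divr_gt0.
rewrite -exprVn invf_div.
have -> : expR y = expR (y / k.+1%:R) ^+ k.+1.
  by rewrite -expRM_natl mulrC divfK.
by rewrite lerXn2r ?nnegrE ?expR_ge0 ?divr_ge0 ?(ltW y0)// (le_trans _ (expR_ge1Dx _))// lerDr.
Qed.

(** The exponential bound of order [m + 1] beats [t^-m] by one power of [t], which is enough for
    continuity at 0. *)
Lemma flat_le m t : `|flat m t| <= m.+1%:R ^+ m.+1 * `|t|.
Proof.
rewrite /flat; case: ifPn => t0; last by rewrite normr0 mulr_ge0// exprn_ge0.
rewrite ger0_norm; last by rewrite mulr_ge0 ?expR_ge0// exprn_ge0// invr_ge0 ltW.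
rewrite gtr0_norm//.
have tV : 0 < t^-1 by rewrite invr_gt0.
apply: le_trans (ler_wpM2l _ (expRN_le m tV)) _; first by rewrite exprn_ge0// ltW.
rewrite exprMn invrK mulrCA ler_wpM2l ?exprn_ge0//.
by rewrite exprS mulrCA -exprMn mulVf ?gt_eqF// expr1n mulr1.
Qed.

Lemma flat_cont0 m : {for 0, continuous (flat m)}.
Proof.
have f0 : flat m 0 = 0 by rewrite /flat ltxx.
apply/cvgrPdist_lt => e e0; rewrite f0.
have M0 : 0 < m.+1%:R ^+ m.+1 :> R by rewrite exprn_gt0.
apply/nbhs_ballP; exists (e / m.+1%:R ^+ m.+1) => /=; first by rewrite divr_gt0.
move=> t; rewrite /ball/= !sub0r !normrN => ht.
by apply: le_lt_trans (flat_le m t) _; rewrite mulrC -ltr_pdivlMr.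
Qed.

Lemma flat_derive m t :
  is_derive t 1 (flat m) ((- m%:R) * flat m.+1 t + flat m.+2 t).
Proof.
have [t0|t0|<-] := ltgtP 0 t.
- have nt0 : (id : R -> R) t != 0 by rewrite gt_eqF.
  have dV := is_deriveV nt0 (is_derive_id t (1 : R)).
  have dX := is_deriveX m dV.
  have dN := is_deriveN dV.
  have dE := is_derive1_comp (is_derive_expR _) dN.
  have dM := is_deriveM dX dE.
  apply: (near_eq_is_derive (f := (fun s : R => s^-1) ^+ m * (expR \o (- (fun s : R => s^-1))))).
    near=> s; have s0 : 0 < s by near: s; exact: lt_nbhsr.
    rewrite /flat s0 /GRing.mul /=; congr (_ * _).
    by elim: m {dX dM} => [|k IH]; rewrite ?expr0// !exprS -IH.
  apply: (is_derive_eq dM); rewrite /flat t0 /=.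
  have eX k : ((fun s : R => s^-1) ^+ k) t = t^-1 ^+ k.
    by elim: k => [|k IH]; rewrite ?expr0// !exprS -IH.
  rewrite eX /GRing.scale /= -exprVn mulr1 [(- (fun s : R => s^-1)) t]/(- t^-1).
  by move: (expR _) => E; case: m {dX dM eX} => [|k]; rewrite /= !exprS ?expr0; ring.
- apply: (near_eq_is_derive (f := cst 0)).
    near=> s; have s0 : s < 0 by near: s; exact: lt_nbhsl.
    by rewrite /flat ltNge ltW.
  apply: (is_derive_eq (is_derive_cst _ _ _)).
  by rewrite /flat !ltNge !ltW//= mulr0 addr0.
(* At 0 the difference quotient of [flat m] is [flat m.+1], which is continuous there. *)
- apply/is_derive1_caratheodory; exists (flat m.+1); split.
  + move=> z; rewrite [flat m 0]/flat ltxx !subr0 /flat; case: ifPn => z0; last by rewrite mul0r.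
    have zn : z != 0 by rewrite gt_eqF.
    by rewrite exprS; field.
  + exact: flat_cont0.
  + by rewrite /flat ltxx mulr0 addr0.
Unshelve. all: by end_near. Qed.

Lemma ndiff_flat n m : ndiff n (flat m).
Proof.
elim: n m => [//|n IH] m; exists (fun t => (- m%:R) * flat m.+1 t + flat m.+2 t).
  exact: flat_derive.
by apply: ndiffD => //; apply: ndiffM => //; exact: ndiff_cst.
Qed.

(** One factor vanishes for [t <= a], the other for [t >= b]. In between the arguments of [flat 0]
    grow with [k], so the values tend to 1 and the bump to an indicator. The arguments are written
    in the form that [ndiff_affine] matches. *)
Definition bump (k : nat) (a b t : R) :=
  flat 0 (k.+1%:R * t + - (k.+1%:R * a)) * flat 0 (- k.+1%:R * t + k.+1%:R * b).

Lemma bumpE k a b t :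
  bump k a b t = flat 0 (k.+1%:R * (t - a)) * flat 0 (k.+1%:R * (b - t)).
Proof. by rewrite /bump; congr (flat 0 _ * flat 0 _); ring. Qed.

Lemma ndiff_bump n k a b : ndiff n (bump k a b).
Proof. by apply: ndiffM; apply: ndiff_affine; exact: ndiff_flat. Qed.

Lemma flat0_itv t : 0 <= flat 0 t <= 1.
Proof.
rewrite /flat; case: ifPn => t0; last by rewrite lexx ler01.
by rewrite expr0 mul1r expR_ge0 -expR0 ler_expR oppr_le0 invr_ge0 ltW.
Qed.

Lemma bump_out k a b t : ~ (a < t < b) -> bump k a b t = 0.
Proof.
move=> h; rewrite bumpE /flat !pmulr_rgt0// !subr_gt0.
case: (ltP a t) => [at_|]; last by rewrite mul0r.
by case: (ltP t b) => [tb|]; [exfalso; apply: h; rewrite at_|rewrite mulr0].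
Qed.

Lemma bump_itv k a b t : 0 <= bump k a b t <= 1.
Proof.
have /andP[h1 h2] := flat0_itv (k.+1%:R * t + - (k.+1%:R * a)).
have /andP[h3 h4] := flat0_itv (- k.+1%:R * t + k.+1%:R * b).
by rewrite /bump mulr_ge0//= mulr_ile1.
Qed.

Lemma flat0_cvg (c : R) : 0 < c -> flat 0 (k.+1%:R * c) @[k --> \oo] --> (1 : R).
Proof.
move=> c0; have E k : flat 0 (k.+1%:R * c) = expR (- c^-1 * k.+1%:R^-1).
  by rewrite /flat mulr_gt0// expr0 mul1r invfM mulNr mulrC.
have h : (- c^-1 * k.+1%:R^-1 : R) @[k --> \oo] --> (0 : R).
  by rewrite -[X in _ --> X](mulr0 (- c^-1)); apply: cvg_seqMl; exact: cvg_inv_succ.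
have h2 : expR (- c^-1 * k.+1%:R^-1) @[k --> \oo] --> expR (0 : R).
  exact: (cvg_comp _ _ h (@continuous_expR R 0)).
by under eq_fun do rewrite E; move: h2; rewrite expR0.
Qed.

Lemma bump_cvg a b t : a < t < b -> bump k a b t @[k --> \oo] --> (1 : R).
Proof.
rewrite -subr_gt0 -[t < b]subr_gt0 => /andP[/flat0_cvg h1 /flat0_cvg h2].
by under eq_fun do rewrite bumpE; have := cvg_seqM h1 h2; rewrite mulr1.
Qed.

End bump_functions.

(** * Functions with vanishing weak derivative *)

Section du_bois_reymond.
Context {R : realType} (T : R) (T0 : 0 < T).
Notation mu := (time_measure T).
Notation leb := (@lebesgue_measure R).
Let mfin := time_fin T0.

Lemma ndiff_derivable n (f : R -> R) : ndiff n.+1 f -> forall t, derivable (derive1n n f) t 1.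
Proof.
elim: n f => [|n IH] f [f' df nf] t; first by case: (df t).
have -> : derive1n n.+1 f = derive1n n f'.
  rewrite /derive1n iterSr; congr (iter n _ _); apply/funext => s.
  by rewrite derive1E; case: (df s).
exact: IH.
Qed.

Lemma ndiff_continuous (f : R -> R) : ndiff 1 f -> continuous f.
Proof.
by move=> nf t; apply/differentiable_continuous/derivable1_diffP; exact: (ndiff_derivable nf).
Qed.

Lemma Rintegral_support (m : {measure set (measurableTypeR R) -> \bar R})
    (D : set (measurableTypeR R)) (f : R -> R) :
  (forall t, ~ D t -> f t = 0) -> \int[m]_(t in D) f t = \int[m]_t f t.
Proof.
move=> h; rewrite Rintegral_mkcond; congr Rintegral; apply/funext => t.
by rewrite patchE; case: ifPn => //; rewrite notin_setE => /h ->.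
Qed.

(** The primitive from minus infinity vanishes to the left of [a] and, since [rho] has zero mean, to
    the right of [b]; so its support lies in [[a, b]]. *)
Lemma primitive_time_test (a b : R) (rho : R -> R) : 0 < a -> b < T ->
  (forall n, ndiff n rho) -> (forall t, ~ (a < t < b) -> rho t = 0) ->
  \int[mu]_t rho t = 0 -> exists2 phi, time_test T phi & derive1 phi = rho.
Proof.
move=> a0 bT nrho rho0 I0.
have crho : continuous rho by exact: ndiff_continuous (nrho 1%N).
have sup0T t : ~ (`]0, T[%classic : set R) t -> rho t = 0.
  move=> nt; apply: rho0 => /andP[at_ tb]; apply: nt.
  by rewrite /= in_itv/= (lt_trans a0 at_) (lt_trans tb bT).
have irho : leb.-integrable setT (EFin \o rho).
  have mT : measurable (`[0, T]%classic : set (measurableTypeR R)) by exact: measurable_itv.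
  have := continuous_integrable_itv T crho => /(integrable_mkcond _ mT).
  congr (_.-integrable _ _); apply/funext => t; rewrite /= patchE.
  case: ifPn => //; rewrite notin_setE => nt; rewrite /= sup0T// => t0T; apply: nt.
  exact: subset_itv_oo_cc t0T.
pose phi t := \int[leb]_(s in `]-oo, t]) rho s.
have dphi t : derivable phi t 1 /\ derive1 phi t = rho t.
  have tt : t < t + 1 by rewrite ltrDl.
  have it : leb.-integrable [set` Interval -oo%O (BRight (t + 1))] (EFin \o rho).
    exact: integrableS irho.
  exact: (continuous_FTC1 tt it (ltNyr _) (crho t)).
have dE : derive1 phi = rho by apply/funext => t; case: (dphi t).
have total : \int[leb]_t rho t = 0.
  rewrite -(Rintegral_support leb sup0T) -(@Rintegral_time_lebesgue _ T)//.
  by rewrite Rintegral_support.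
have phil t : t <= a -> phi t = 0.
  move=> ta; rewrite /phi Rintegral_mkcond (_ : _ \_ _ = fun=> 0) ?Rintegral_cst ?mul0r//.
  apply/funext => s; rewrite patchE; case: ifPn => //; rewrite inE/= in_itv/= => st.
  by apply: rho0 => /andP[+ _]; rewrite ltNge (le_trans st).
have phir t : b <= t -> phi t = 0.
  move=> bt; rewrite /phi Rintegral_support// => s; rewrite /= in_itv/= => /negP; rewrite -ltNge => ts.
  by apply: rho0 => /andP[_]; rewrite ltNge (le_trans bt) // ltW.
exists phi => //.
have clsub : support_of phi `<=` `[a, b]%classic.
  have cl : closed `[a, b]%classic.
    by apply: compact_closed; [exact: Rhausdorff|exact: segment_compact].
  rewrite /support_of [X in _ `<=` X](iffLR (closure_id _) cl); apply: closureS.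
  move=> t /= /eqP pt; rewrite in_itv/=; apply/andP; split.
    by rewrite leNgt; apply/negP => ta; apply: pt; apply: phil; exact: ltW.
  by rewrite leNgt; apply/negP => ta; apply: pt; apply: phir; exact: ltW.
split.
- case=> [|n] t; first by case: (dphi t).
  rewrite /derive1n iterSr dE; exact: (ndiff_derivable (nrho n.+1)).
- apply: (subclosed_compact _ (@segment_compact R a b)) clsub.
  exact: closed_closure.
- by apply: subset_trans clsub _ => t /=; rewrite !in_itv/= => /andP[h1 h2]; rewrite (lt_le_trans a0 h1) (le_lt_trans h2).
Qed.

Lemma ae_time_neq (b : R) : {ae mu, forall t : measurableTypeR R, t <> b}.
Proof.
exists [set b]; split; [exact: measurable_set1| |by move=> t /contrapT ->].
rewrite time_measureE; apply/eqP; rewrite eq_le measure_ge0 andbT.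
rewrite -(lebesgue_measure_set1 b); apply: le_measure; rewrite ?inE; last exact: subIsetl.
  by apply: measurableI; [exact: measurable_set1|exact: measurable_itv].
exact: measurable_set1.
Qed.

Lemma bump_cvg_ind a b t : t <> b ->
  bump k a b t @[k --> \oo] --> (\1_(`]a, b]%classic) t : R).
Proof.
move=> tb; rewrite indicE mem_setE in_itv/=; have [h|/negP h] := boolP (a < t < b).
  by have /andP[at_ tb'] := h; rewrite at_ (ltW tb')/=; exact: bump_cvg.
have -> : (a < t <= b) = false.
  apply/negP => /andP[at_ tb']; apply: h; rewrite at_ lt_neqAle tb' andbT.
  exact/eqP.
by under eq_fun do rewrite bump_out//; exact: cvg_cst.
Qed.

Lemma bump_integral_cvg a b : 0 <= a -> a <= b -> b <= T ->
  \int[mu]_t bump k a b t @[k --> \oo] --> b - a.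
Proof.
move=> a0 ab bT.
have cb k : continuous (bump k a b) by apply: ndiff_continuous; exact: ndiff_bump.
have mb k : measurable_fun setT (fun t : measurableTypeR R => (bump k a b t)%:E).
  by apply/measurable_EFinP; exact: continuous_measurable_fun.
have mI : measurable_fun setT (fun t : measurableTypeR R => (\1_(`]a, b]%classic) t : R)%:E).
  by apply/measurable_EFinP; apply: measurable_indic; exact: measurable_itv.
have ig : mu.-integrable setT (EFin \o (fun=> 1 : R)) by exact: (integrable_cst mfin).
have cf : {ae mu, forall t : measurableTypeR R, setT t -> (bump k a b t)%:E @[k --> \oo] -->
    (\1_(`]a, b]%classic) t : R)%:E}.
  apply: filterS (ae_time_neq b) => t tb _; apply: cvg_EFin; first exact: nearW.
  exact: bump_cvg_ind.
have bf : {ae mu, forall (t : measurableTypeR R) k, setT t ->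
    (`|(bump k a b t)%:E| <= (EFin \o (fun=> 1)%R) t)%E}.
  apply: aeW => t k _; have /andP[b0 b1] := bump_itv k a b t.
  by rewrite /= lee_fin ger0_norm.
have [_ _] := dominated_convergence measurableT mb mI cf ig bf.
rewrite integral_indic ?setIT// time_measure_itv// => h.
apply: (cvg_EFin_seq (u := fun k => \int[mu]_t bump k a b t)); apply: cvg_trans h.
apply: near_eq_cvg; apply: nearW => k; rewrite /Rintegral fineK//.
apply: (integrable_fin_num measurableT); apply: le_integrable ig => // t _ /=.
have /andP[b0 b1] := bump_itv k a b t.
by rewrite lee_fin normr1 ger0_norm.
Qed.

Context {V : normedModType R} {hV : hilbert V}.
Notation L2t := (L2 mu V).
Implicit Types (u v w : L2t) (x y z : V).

Definition bump_class k a b y : L2t := time_cut T T (fun t => bump k a b t *: y).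

Lemma bump_cont_on k a b y : cont_on T (fun t => bump k a b t *: y).
Proof.
apply: cont_on_scale; apply: cont_on_continuous; apply: ndiff_continuous.
exact: ndiff_bump.
Qed.

Lemma bump_class_cvg a b y : 0 <= a -> b <= T ->
  bump_class k a b y @[k --> \oo] --> time_ind T a b y.
Proof.
move=> a0 bT.
have hE k := time_classE T0 (bump_cont_on k a b y).
apply: (L2_dominated (g := fun=> `|y| ^+ 2)).
- exact: integrable_cst mfin _.
- apply: filterS3 (ae_foralln hE) (time_indE T0 a b y) (ae_time_neq b) => t ht -> tb.
  by under eq_fun do rewrite ht; apply: cvgZ; [exact: bump_cvg_ind|exact: cvg_cst].
- move=> k; apply: filterS2 (hE k) (time_indE T0 a b y) => t -> ->.
  rewrite -scalerBl normrZ lerXn2r ?nnegrE ?mulr_ge0// ler_piMl//.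
  have /andP[b0 b1] := bump_itv k a b t; rewrite ler_norml indicE.
  by case: (_ \in _); rewrite /=; lra.
Qed.

(** Combinations of two bumps with zero mean are derivatives of test functions, so the product of
    [u] with a bump is proportional to the integral of the bump. In the limit of indicators,
    increments of the primitive of [u] are proportional to the length of the interval: the primitive
    is affine and [u] is constant. *)
Lemma du_bois_reymond u : (forall phi y, time_test T phi ->
    ip (time_cut T T (fun t => derive1 phi t *: y)) u = 0) ->
  exists c, u = time_cut T T (fun=> c).
Proof.
move=> hu.
have key k l a b a' b' y : 0 < a -> b < T -> 0 < a' -> b' < T ->
    (\int[mu]_t bump l a' b' t) * ip (bump_class k a b y) u =
    (\int[mu]_t bump k a b t) * ip (bump_class l a' b' y) u.
  move=> a0 bT a0' bT'.
  set m := \int[mu]_t bump l a' b' t; set m' := \int[mu]_t bump k a b t.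
  pose rho t := m * bump k a b t + (- m') * bump l a' b' t.
  have ib j c d : mu.-integrable setT (EFin \o bump j c d).
    apply: le_integrable (integrable_cst mfin 1) => //.
      apply/measurable_EFinP; apply: continuous_measurable_fun; apply: ndiff_continuous.
      exact: ndiff_bump.
    move=> t _ /=; have /andP[b0 b1] := bump_itv j c d t.
    by rewrite lee_fin normr1 ger0_norm.
  have [|||||phi tphi dphi] := @primitive_time_test (Num.min a a') (Num.max b b') rho.
  - by rewrite lt_min a0.
  - by rewrite gt_max bT.
  - by move=> n; apply: ndiffD; apply: ndiffM; try exact: ndiff_cst; exact: ndiff_bump.
  - move=> t ht; rewrite /rho !bump_out ?mulr0 ?addr0// => /andP[h1 h2]; apply: ht.
      by rewrite gt_min h1 orbT lt_max h2 orbT.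
    by rewrite gt_min h1 lt_max h2.
  - rewrite /rho RintegralD//; try exact: integrable_scale (ib _ _ _).
    by rewrite !RintegralZl// -/m -/m'; ring.
  have e : time_cut T T (fun t => derive1 phi t *: y) =
      m *: bump_class k a b y + (- m') *: bump_class l a' b' y.
    rewrite dphi; apply: L2_ae_eq (time_classE T0 _) _.
      apply: cont_on_scale; apply: cont_on_continuous; apply: ndiff_continuous.
      by apply: ndiffD; apply: ndiffM; try exact: ndiff_cst; exact: ndiff_bump.
    have h1 := L2_repr_lin m (bump_class k a b y) ((- m') *: bump_class l a' b' y).
    have h2 := L2_reprZ (- m') (bump_class l a' b' y).
    have h3 : {ae mu, forall t, bump_class k a b y t = bump k a b t *: y /\
        bump_class l a' b' y t = bump l a' b' t *: y}.
      apply: filterS2 (time_classE T0 (bump_cont_on k a b y))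
        (time_classE T0 (bump_cont_on l a' b' y)) => t; by split.
    by apply: filterS3 h1 h2 h3 => t -> -> [-> ->]; rewrite /rho scalerDl !scalerA.
  have := hu phi y tphi; rewrite e ipDl !ipZl => /eqP; rewrite mulNr subr_eq0 => /eqP ->.
  by [].
have key2 a b a' b' y : 0 < a -> a <= b -> b < T -> 0 < a' -> a' <= b' -> b' < T ->
    (b' - a') * ip (time_ind T a b y) u = (b - a) * ip (time_ind T a' b' y) u.
  move=> a0 ab bT a0' ab' bT'.
  (* First the limit in [l] with [k] fixed, then the limit in [k]. *)
  have l1 k : (b' - a') * ip (bump_class k a b y) u =
      (\int[mu]_t bump k a b t) * ip (time_ind T a' b' y) u.
    apply: (cvg_filter_unique (V := R^o) (F := \oo)
      (u := fun l => (\int[mu]_t bump l a' b' t) * ip (bump_class k a b y) u)).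
      apply: cvg_seqM; last exact: cvg_cst.
      by apply: bump_integral_cvg; rewrite // ltW.
    under eq_fun do rewrite key//.
    apply: cvg_seqMl; apply: cvg_ipl; apply: bump_class_cvg; exact: ltW.
  apply: (cvg_filter_unique (V := R^o) (F := \oo)
      (u := fun k => (b' - a') * ip (bump_class k a b y) u)).
    apply: cvg_seqMl; apply: cvg_ipl; apply: bump_class_cvg; exact: ltW.
  under eq_fun do rewrite l1.
  apply: cvg_seqM; last exact: cvg_cst.
  by apply: bump_integral_cvg; rewrite // ltW.
(* A fixed interval with closure inside []0, T[] measures the slope [c]; the support of a bump
   reaching 0 or [T] would leave the open interval. *)
pose a0 := T / 3; pose b0 := T / 3 * 2.
have a00 : 0 < a0 by rewrite divr_gt0.
have ab0 : a0 < b0 by rewrite /b0 ltr_pMr// ltr1n.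
have b0T : b0 < T by rewrite /b0 mulrAC ltr_pdivrMr// ltr_pM2l// ltr_nat.
pose P (t : R) : V := @primitive _ T V hV u t.
pose c := (b0 - a0)^-1 *: (P b0 - P a0).
have lin a b : 0 < a -> a <= b -> b < T -> P b - P a = (b - a) *: c.
  move=> ap ab bT; apply: ip_ext => y; rewrite ![ip _ y]ipC.
  rewrite /c !ipZr !primitiveB ?(ltW ap) ?(ltW bT) ?(ltW a00) ?(ltW ab0) ?(ltW b0T)//.
  have := key2 a b a0 b0 y ap ab bT a00 (ltW ab0) b0T => h.
  by rewrite mulrCA -h mulKf// subr_eq0 gt_eqF.
have PE t : 0 <= t <= T -> P t = P a0 + (t - a0) *: c.
  move: t; apply: (cont_on_unique T0).
  - by move=> t t0T e e0; have := primitive_cont T0 0 u t0T e0 => -[r r0 hr]; exists r => // s s0T st; have := hr s s0T st; rewrite !add0r.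
  - have h : cont_on T (fun t => (t - a0) *: c).
      apply: (@cont_on_scale R V T (fun t => t - a0)); apply: cont_on_continuous => t.
      by apply: cvgB; [exact: cvg_id|exact: cvg_cst].
    move=> t t0T e e0; have [r r0 hr] := h t t0T e e0; exists r => // s s0T st.
    by rewrite opprD addrACA subrr add0r; exact: hr.
  apply: ae_time => // t /andP[t0 tT].
  have [ta|/ltW ta] := leP a0 t.
    by rewrite -lin// addrC subrK.
  by rewrite -[t - a0]opprB scaleNr -lin ?(lt_trans ab0 b0T)// opprB addrC subrK.
exists c; apply/subr0_eq; apply: (primitive_inj T0) => t t0T.
have tid : t *: c = primitive (time_cut T T (fun=> c)) t.
  have d1 : derive1 (id : R -> R) = cst 1.
    by apply/funext => s; rewrite derive1E derive_id.
  have c1 : continuous (derive1 (id : R -> R)) by rewrite d1 => s; exact: cvg_cst.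
  have di s : derivable (id : R -> R) s 1 by exact: derivable_id.
  rewrite [LHS](primitive_derive T0 c di c1 t0T) scale0r add0r.
  by congr (primitive _ _); apply: time_cut_eq => s _; rewrite d1 scale1r.
(* The affine formula evaluated at 0, where the primitive vanishes, fixes its constant. *)
have Pa0 : P a0 = a0 *: c.
  have := PE 0; rewrite lexx ltW// => /(_ isT); rewrite {1}/P (primitive0 T0) sub0r scaleNr.
  by move=> /esym/eqP; rewrite subr_eq0 => /eqP.
rewrite -scaleN1r addrC primitive_linear// -tid scaleN1r -/(P t) PE// Pa0.
by rewrite -scalerDl addrCA subrr addr0 addNr.
Qed.

(** Subtracting the primitive [J] of [v] leaves a function with vanishing weak derivative, hence a
    constant. *)
Lemma weak_dt_exists u v : weak_dt u v ->
  exists x, u = time_cut T T (fun t => x + primitive v t).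
Proof.
move=> uv; pose J := time_cut T T (fun t => 0 + @primitive _ T V hV v t).
have Jv : weak_dt J v by exact: weak_dt_primitive.
have [|x ux] := du_bois_reymond (u := u - J).
  move=> phi y tphi; rewrite ipBr.
  by rewrite (iffLR (weak_dt_ipP T0 u v) uv)// (iffLR (weak_dt_ipP T0 J v) Jv)// subrr.
exists x; rewrite -[u](subrK J) ux.
have c1 : cont_on T (fun=> x) by exact: cont_on_continuous (fun _ => cvg_cst _).
pose proof (time_classE T0 (primitive_cont T0 x v)) as h1.
have h2 : {ae mu, forall t, L2_repr (time_cut T T (fun=> x) + J) t = x + primitive v t}.
  apply: filterS3 (L2_reprD (time_cut T T (fun=> x)) J) (time_classE T0 c1)
    (time_classE T0 (primitive_cont T0 0 v)) => t -> -> ->.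
  by rewrite add0r.
exact: (L2_ae_eq h2 h1).
Qed.

End du_bois_reymond.

(** * The space H^1(0, T; V) *)

Section H1_time_map.
Context {R : realType} (T : R) {V W : normedModType R} (B : V -> W) (M : R).
Hypothesis bB : bounded_linear B M.
Notation mu := (time_measure T).

Lemma weak_dt_map (u v : L2 mu V) : weak_dt u v -> weak_dt (L2_map B u) (L2_map B v).
Proof.
move=> uv phi tphi; have [I [I1 I2]] := uv phi tphi.
have h (psi : R -> R) (w : L2 mu V) K : bochner_integral mu (fun t => psi t *: w t) K ->
    bochner_integral mu (fun t => psi t *: L2_map B w t) (B K).
  move=> /(bochner_integral_map bB); apply: bochner_integral_ae.
  by apply: filterS (L2_mapE bB w) => t -> /=; rewrite (bounded_linearZ bB).
exists (B I); split; first exact: h.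
have -> : - B I = B (- I) by rewrite -scaleN1r -(bounded_linearZ bB) scaleN1r.
exact: h.
Qed.

Lemma H1_map_subproof (U : H1_time T V) :
  (L2_map B (graph_val U).1, L2_map B (graph_val U).2) \in @weak_dt_pred R T W.
Proof.
apply: mem_set; apply: weak_dt_map; have := graph_valP U.
by rewrite inE.
Qed.

Definition H1_map (U : H1_time T V) : H1_time T W := GraphSpace (H1_map_subproof U).

Lemma H1_map_fun U : H1_time_fun (H1_map U) = L2_map B (H1_time_fun U).
Proof. by []. Qed.

Lemma H1_map_dot U : H1_time_dot (H1_map U) = L2_map B (H1_time_dot U).
Proof. by []. Qed.

Lemma H1_normE {X : normedModType R} (U : H1_time T X) :
  `|U| ^+ 2 = `|H1_time_fun U| ^+ 2 + `|H1_time_dot U| ^+ 2.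
Proof.
have -> : `|U| = Num.sqrt (`|H1_time_fun U| ^+ 2 + `|H1_time_dot U| ^+ 2) by [].
by rewrite sqr_sqrtr// addr_ge0// sqr_ge0.
Qed.

Lemma H1_map_bounded_linear : bounded_linear H1_map M.
Proof.
have [M0 _ _] := bB; have [_ lB bnd] := L2_map_bounded_linear mu bB.
split=> // [a U U'|U].
  by apply: val_inj; rewrite /= /H1_map /= !lB.
rewrite -(@ler_pXn2r _ 2)// ?nnegrE ?mulr_ge0// exprMn !H1_normE H1_map_fun H1_map_dot mulrDr.
by rewrite -!exprMn lerD// lerXn2r ?nnegrE ?mulr_ge0.
Qed.

End H1_time_map.

(** * Traces and the Hilbert structure of H^1(0, T; V) *)

Section H1_trace.
Context {R : realType} (T : R) (T0 : 0 < T) {V : normedModType R} {hV : hilbert V}.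
Notation mu := (time_measure T).
Notation H1 := (H1_time T V).
Let mfin := time_fin T0.
Let T1 : 0 <= T <= T. Proof. by rewrite lexx ltW. Qed.
Let z1 : 0 <= (0 : R) <= T. Proof. by rewrite lexx ltW. Qed.
Implicit Types (U W : H1) (x y z : V).

(** The value at 0 of the continuous representative. The default 0 is never taken, by
    [weak_dt_exists]. *)
Definition H1_start U : V := xget 0 [set x | H1_time_fun U =
  time_cut T T (fun t => x + @primitive _ T V hV (H1_time_dot U) t)].

Definition H1_trace U t : V := H1_start U + primitive (H1_time_dot U) t.

Lemma H1_trace_cont U : cont_on T (H1_trace U).
Proof. exact: primitive_cont. Qed.

Lemma H1_fun_trace U : H1_time_fun U = time_cut T T (H1_trace U).
Proof.
rewrite /H1_trace /H1_start; case: xgetP => [y -> //|nex].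
have [x hx] : exists x, H1_time_fun U =
    time_cut T T (fun t => x + @primitive _ T V hV (H1_time_dot U) t).
  by apply: (weak_dt_exists T0); have := graph_valP U; rewrite inE.
by have := nex x.
Qed.

Lemma H1_trace_ae U : {ae mu, forall t, H1_time_fun U t = H1_trace U t}.
Proof.
have ae_congr (u u' : L2 mu V) (f : R -> V) : u = u' ->
  {ae mu, forall t, u' t = f t} -> {ae mu, forall t, u t = f t} by move=> ->.
by apply: ae_congr (H1_fun_trace U) _; apply: (time_classE T0); exact: H1_trace_cont.
Qed.

Lemma H1_trace_uniq U (g : R -> V) : cont_on T g ->
  {ae mu, forall t, H1_time_fun U t = g t} -> forall t, 0 <= t <= T -> H1_trace U t = g t.
Proof.
move=> cg gU; apply: (cont_on_unique T0) => //; first exact: H1_trace_cont.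
by apply: filterS2 (H1_trace_ae U) gU => t -> ->.
Qed.

Lemma H1_time_atP U (t : R) z : 0 <= t <= T -> H1_time_at U t z <-> H1_trace U t = z.
Proof.
move=> t0T; split=> [[g [/within_continuousP cg gU <-]]|<-].
  exact: H1_trace_uniq.
exists (H1_trace U); split => //; first by apply/within_continuousP; exact: H1_trace_cont.
exact: H1_trace_ae.
Qed.

Lemma H1_traceB U s t : H1_trace U t - H1_trace U s =
  primitive (H1_time_dot U) t - primitive (H1_time_dot U) s.
Proof. by rewrite /H1_trace opprD addrACA subrr add0r. Qed.

Lemma H1_trace_lipschitz U s t : 0 <= s -> s <= t -> t <= T ->
  `|H1_trace U t - H1_trace U s| <= Num.sqrt (t - s) * `|H1_time_dot U|.
Proof. by move=> s0 st tT; rewrite H1_traceB primitive_lipschitz. Qed.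

(** The function determines its traces, these determine the primitive of the derivative, and this
    the derivative by [primitive_inj]. *)
Lemma H1_ext U W : H1_time_fun U = H1_time_fun W -> U = W.
Proof.
move=> e; have eT t : 0 <= t <= T -> H1_trace U t = H1_trace W t.
  apply: H1_trace_uniq; first exact: H1_trace_cont.
  by rewrite e; exact: H1_trace_ae.
apply: val_inj; rewrite /= [graph_val U]surjective_pairing [graph_val W]surjective_pairing.
congr pair => //; apply/subr0_eq/(primitive_inj T0) => t t0T.
rewrite -scaleN1r addrC primitive_linear// scaleN1r.
have p0 := primitive0 T0.
rewrite addrC -[primitive _ t]subr0 -(p0 _ _ (H1_time_dot U)) -H1_traceB.
rewrite -[X in _ - X]subr0 -(p0 _ _ (H1_time_dot W)) -H1_traceB.
by rewrite !eT ?subrr.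
Qed.

Lemma H1_trace_linear t a U W : 0 <= t <= T ->
  H1_trace (a *: U + W) t = a *: H1_trace U t + H1_trace W t.
Proof.
move: t; apply: H1_trace_uniq.
  move=> t t0T e e0; have a1 : 0 < `|a| + 1 by rewrite ltr_wpDl.
  have ea : 0 < e / 2 / (`|a| + 1) by rewrite !divr_gt0.
  have e2 : 0 < e / 2 by rewrite divr_gt0.
  have [r1 r10 h1] := H1_trace_cont U t0T ea.
  have [r2 r20 h2] := H1_trace_cont W t0T e2.
  exists (Num.min r1 r2) => [|s s0T]; first by rewrite lt_min r10.
  rewrite lt_min => /andP[/(h1 _ s0T) k1 /(h2 _ s0T) k2].
  rewrite opprD addrACA -scalerBr; apply: le_lt_trans (ler_normD _ _) _.
  rewrite [ltRHS]splitr; apply: ler_ltD => //; rewrite normrZ.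
  move: k1; rewrite ltr_pdivlMr// => /ltW; apply: le_trans.
  by rewrite mulrC ler_wpM2l// lerDl.
have h : H1_time_fun (a *: U + W) = a *: H1_time_fun U + H1_time_fun W by [].
rewrite h; apply: filterS3 (L2_repr_lin a (H1_time_fun U) (H1_time_fun W))
  (H1_trace_ae U) (H1_trace_ae W) => t -> -> ->.
by [].
Qed.

Lemma H1_fun_le U : `|H1_time_fun U| <= `|U|.
Proof. by rewrite -(@ler_pXn2r _ 2)// ?nnegrE// H1_normE lerDl sqr_ge0. Qed.

Lemma H1_dot_le U : `|H1_time_dot U| <= `|U|.
Proof. by rewrite -(@ler_pXn2r _ 2)// ?nnegrE// H1_normE lerDr sqr_ge0. Qed.

(** Comparing [U] in L^2 with the constant [U t] gives [sqrt T * |U t| <= |U| + sqrt T * osc], where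
    the oscillation is at most [sqrt T * |U'|]. *)
Definition trace_bound : R := (Num.sqrt T)^-1 + Num.sqrt T.

Lemma H1_trace_le U t : 0 <= t <= T -> `|H1_trace U t| <= trace_bound * `|U|.
Proof.
move=> t0T; set z := H1_trace U t.
have sT : 0 < Num.sqrt T by rewrite sqrtr_gt0.
set M := Num.sqrt T * `|H1_time_dot U|.
have M0 : 0 <= M by rewrite mulr_ge0// sqrtr_ge0.
have key s : 0 <= s <= T -> `|z - H1_trace U s| <= M.
  have h a b : 0 <= a -> a <= b -> b <= T -> `|H1_trace U b - H1_trace U a| <= M.
    move=> a0 ab bT; apply: le_trans (H1_trace_lipschitz U a0 ab bT) _.
    by rewrite ler_wpM2r// ler_wsqrtr// lerBlDr (le_trans bT)// lerDl.
  have /andP[t0 tT] := t0T => /andP[s0 sT'].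
  by have [st|/ltW ts] := leP s t; [exact: h|rewrite distrC; exact: h].
have h1 : `|time_ind T 0 T z - H1_time_fun U| ^+ 2 <= M ^+ 2 * T.
  rewrite -[X in _ <= _ * X]/(fine T%:E) -(time_measureT T0).
  apply: (L2_norm_bound mfin) => //.
  have ht : {ae mu, forall t, 0 < t < T} by exact: ae_time.
  have h2 : {ae mu, forall t, time_ind T 0 T z t = z}.
    apply: filterS2 (time_indE T0 0 T z) ht => s -> /andP[s0 sT'].
    by rewrite indicE mem_setE in_itv/= s0 ltW// scale1r.
  have h3 : {ae mu, forall t, `|time_ind T 0 T z t - H1_time_fun U t| <= M}.
    apply: filterS3 (H1_trace_ae U) h2 ht => s -> -> /andP[s0 sT'].
    by apply: key; rewrite !ltW.
  by apply: filterS2 h3 (L2_reprB (time_ind T 0 T z) (H1_time_fun U)) => s + ->.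
have h2 : `|time_ind T 0 T z - H1_time_fun U| <= M * Num.sqrt T.
  by rewrite -(@ler_pXn2r _ 2)// ?nnegrE ?mulr_ge0 ?sqrtr_ge0// exprMn sqr_sqrtr// ltW.
have h3 : Num.sqrt T * `|z| <= `|U| + M * Num.sqrt T.
  have := time_ind_norm T0 z (lexx 0) (ltW T0) (lexx T); rewrite subr0 => <-.
  rewrite -[time_ind _ _ _ _](subrK (H1_time_fun U)) addrC.
  by apply: le_trans (ler_normD _ _) _; rewrite lerD// H1_fun_le.
rewrite -(ler_pM2l sT) (le_trans h3)// /trace_bound mulrA mulrDr mulfV ?gt_eqF// mulrDl mul1r.
rewrite lerD2l /M mulrAC -expr2 ler_wpM2l ?sqr_ge0//.
exact: H1_dot_le.
Qed.

Lemma trace_bound_ge0 : 0 <= trace_bound.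
Proof. by rewrite addr_ge0 ?invr_ge0 ?sqrtr_ge0. Qed.

Lemma H1_trace_bounded_linear t : 0 <= t <= T ->
  bounded_linear (H1_trace^~ t) trace_bound.
Proof.
move=> t0T; split; first exact: trace_bound_ge0.
- by move=> a U W; exact: H1_trace_linear.
- by move=> U; exact: H1_trace_le.
Qed.

Lemma H1_mk_subproof x (v : L2 mu V) :
  (time_cut T T (fun t => x + primitive v t), v) \in @weak_dt_pred R T V.
Proof. by apply: mem_set; exact: weak_dt_primitive. Qed.

Definition H1_mk x (v : L2 mu V) : H1 := GraphSpace (H1_mk_subproof x v).

Lemma H1_mk_trace x v t : 0 <= t <= T -> H1_trace (H1_mk x v) t = x + primitive v t.
Proof.
move: t; apply: H1_trace_uniq; first exact: primitive_cont.
by apply: (time_classE T0); exact: primitive_cont.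
Qed.

(** With the trace at 0 known, only rates remain to be bounded. In [T + 1] the [T] is
    [sqrt T * sqrt T], once from the Hoelder bound and once from integration in time, and the 1
    comes from the derivative itself. *)
Lemma H1_norm_le U : `|U| <= Num.sqrt T * `|H1_trace U 0| + (T + 1) * `|H1_time_dot U|.
Proof.
have h : `|H1_time_fun U| <= Num.sqrt T * (`|H1_trace U 0| + Num.sqrt T * `|H1_time_dot U|).
  set M := `|H1_trace U 0| + _.
  have M0 : 0 <= M by rewrite addr_ge0 ?mulr_ge0 ?sqrtr_ge0.
  rewrite -(@ler_pXn2r _ 2)// ?nnegrE ?mulr_ge0 ?sqrtr_ge0// exprMn sqr_sqrtr ?(ltW T0)// mulrC.
  rewrite -[X in _ <= _ * X]/(fine T%:E) -(time_measureT T0).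
  apply: (L2_norm_bound mfin) => //.
  have ht : {ae mu, forall t, 0 < t < T} by exact: ae_time.
  apply: filterS2 (H1_trace_ae U) ht => t -> /andP[t0 tT].
  rewrite -[H1_trace U t](subrK (H1_trace U 0)) addrC.
  apply: le_trans (ler_normD _ _) _; rewrite lerD2l.
  apply: le_trans (H1_trace_lipschitz U (lexx 0) (ltW t0) (ltW tT)) _.
  by rewrite ler_wpM2r// ler_wsqrtr// subr0 ltW.
have hU : `|U| <= `|H1_time_fun U| + `|H1_time_dot U|.
  rewrite -(@ler_pXn2r _ 2)// ?nnegrE ?addr_ge0// H1_normE.
  have := normr_ge0 (H1_time_fun U); have := normr_ge0 (H1_time_dot U); nra.
apply: (le_trans hU); apply: le_trans (lerD h (lexx _)) _.
have -> : Num.sqrt T * (`|H1_trace U 0| + Num.sqrt T * `|H1_time_dot U|) =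
  Num.sqrt T * `|H1_trace U 0| + (Num.sqrt T) ^+ 2 * `|H1_time_dot U| by ring.
by rewrite sqr_sqrtr ?(ltW T0)// mulrDl mul1r addrA.
Qed.

Definition H1_ip U W : R := ip (H1_time_fun U) (H1_time_fun W) +
  ip (H1_time_dot U) (H1_time_dot W).

Lemma H1_ip_sym_bilinear : sym_bilinear H1_ip.
Proof.
split=> [U W|W a U U']; first by rewrite /H1_ip ipC [X in _ + X]ipC.
have e1 : H1_time_fun (a *: U + U') = a *: H1_time_fun U + H1_time_fun U' by [].
have e2 : H1_time_dot (a *: U + U') = a *: H1_time_dot U + H1_time_dot U' by [].
by rewrite /H1_ip e1 e2 !ip_linear; ring.
Qed.

Lemma H1_ip_norm U : H1_ip U U = `|U| ^+ 2.
Proof. by rewrite /H1_ip !ip_norm H1_normE. Qed.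

Lemma bounded_linear_cauchy {X Y : normedModType R} (B : X -> Y) (M : R) (u : nat -> X) :
  bounded_linear B M ->
  (forall e : R, 0 < e -> exists N, forall m n, (N <= m)%N -> (N <= n)%N ->
    `|u m - u n| < e) ->
  forall e : R, 0 < e -> exists N, forall m n, (N <= m)%N -> (N <= n)%N ->
    `|B (u m) - B (u n)| < e.
Proof.
move=> bB uc e e0; have [M0 _ _] := bB; have M1 : 0 < M + 1 by rewrite ltr_wpDl.
have [N hN] := uc _ (divr_gt0 e0 M1); exists N => m n Nm Nn.
rewrite -(bounded_linearB bB); apply: le_lt_trans (bounded_linear_le bB _) _.
apply: (@le_lt_trans _ _ ((M + 1) * `|u m - u n|)); first by rewrite ler_wpM2r// lerDl.
by rewrite mulrC -ltr_pdivlMr//; exact: hN.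
Qed.

Lemma H1_dot_bounded_linear : bounded_linear (@H1_time_dot R T V) 1.
Proof. by split=> // U; rewrite mul1r; exact: H1_dot_le. Qed.

(** The limit is rebuilt by [H1_mk] from the limits of the traces at 0 and of the derivatives, so it
    has a weak derivative by construction. *)
Lemma H1_complete : cauchy_complete H1.
Proof.
move=> U Uc.
have [v hv] := hilbert_complete (bounded_linear_cauchy H1_dot_bounded_linear Uc).
have tb := H1_trace_bounded_linear z1.
have [x hx] := hilbert_complete (bounded_linear_cauchy tb Uc).
exists (H1_mk x v).
have e n : H1_time_dot (U n - H1_mk x v) = H1_time_dot (U n) - v by [].
have e' n : H1_trace (U n - H1_mk x v) 0 = H1_trace (U n) 0 - x.
  by rewrite (bounded_linearB tb) H1_mk_trace// (primitive0 T0) addr0.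
apply: (cvg_seq_norm_le (d := fun n => Num.sqrt T * `|H1_trace (U n) 0 - x| +
    (T + 1) * `|H1_time_dot (U n) - v|)) => [n|].
  by rewrite -e -e'; exact: H1_norm_le.
have e0 : Num.sqrt T * 0 + (T + 1) * 0 = 0 :> R by rewrite !mulr0 addr0.
rewrite -[X in _ --> X]e0.
by apply: cvg_seqD; apply: cvg_seqMl; exact: cvg_dist0.
Qed.

Lemma H1_hilbert_sealed : {h : hilbert H1 | @ip _ _ h = H1_ip}.
Proof. by exists (Hilbert H1_ip_sym_bilinear H1_ip_norm H1_complete). Qed.

(** It depends on a proof of [0 < T], so it is passed explicitly or declared as a local instance. *)
Definition H1_hilbert : hilbert H1 := proj1_sig H1_hilbert_sealed.

End H1_trace.

Section H1_map_trace.
Context {R : realType} (T : R) (T0 : 0 < T) {V W : normedModType R}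
  {hV : hilbert V} {hW : hilbert W} (B : V -> W) (M : R) (bB : bounded_linear B M).

Lemma H1_map_trace (U : H1_time T V) t : 0 <= t <= T ->
  H1_trace (H1_map bB U) t = B (H1_trace U t).
Proof.
move: t; apply: (H1_trace_uniq T0).
  have [M0 _ _] := bB; have M1 : 0 < M + 1 by rewrite ltr_wpDl.
  move=> t t0T e e0.
  have [r r0 h] := H1_trace_cont T0 U t0T (divr_gt0 e0 M1); exists r => // s s0T st.
  rewrite -(bounded_linearB bB); apply: le_lt_trans (bounded_linear_le bB _) _.
  have := h s s0T st; rewrite ltr_pdivlMr// => /(le_lt_trans _); apply.
  by rewrite mulrC ler_wpM2l// lerDl.
by apply: filterS2 (L2_mapE bB (H1_time_fun U)) (H1_trace_ae T0 U) => t -> ->.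
Qed.

End H1_map_trace.

Lemma L2_ip_ge0 {dT} {X : measurableType dT} {R : realType} (mu : {measure set X -> \bar R})
  {V : normedModType R} {hV : hilbert V} (u v : L2 mu V) :
  {ae mu, forall t, 0 <= ip (u t) (v t)} -> 0 <= ip u v.
Proof.
move=> h; rewrite (L2_ipE (L2_strongly_measurable u) (L2_strongly_measurable v)
  (aeW mu (fun t => erefl (u t))) (aeW mu (fun t => erefl (v t)))).
by apply: ae_Rintegral_ge0 h; apply: measurable_ip; exact: L2_strongly_measurable.
Qed.

(** * Energy identity and interpolants on uniform partitions *)

Section H1_calculus.
Context {R : realType} (T : R) (T0 : 0 < T) {V : normedModType R} {hV : hilbert V}.
Notation mu := (time_measure T).
Notation L2t := (L2 mu V).
Notation H1 := (H1_time T V).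
Let T1 : 0 <= T <= T. Proof. by rewrite lexx ltW. Qed.
Let z1 : 0 <= (0 : R) <= T. Proof. by rewrite lexx ltW. Qed.
Implicit Types (U W : H1).

Lemma H1_by_parts_cut U W b : 0 <= b <= T ->
  ip (H1_trace U b) (H1_trace W b) - ip (H1_trace U 0) (H1_trace W 0) =
  ip (time_cut T b (H1_trace W)) (H1_time_dot U) +
  ip (time_cut T b (H1_trace U)) (H1_time_dot W).
Proof.
move=> b0T; have s0 U' : H1_trace U' 0 = H1_start U'.
  by rewrite /H1_trace (primitive0 T0) addr0.
by rewrite !s0; exact: time_by_parts.
Qed.

Lemma H1_by_parts U W :
  ip (H1_trace U T) (H1_trace W T) - ip (H1_trace U 0) (H1_trace W 0) =
  ip (H1_time_fun W) (H1_time_dot U) + ip (H1_time_fun U) (H1_time_dot W).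
Proof. by rewrite (H1_by_parts_cut U W T1) -!(H1_fun_trace T0). Qed.

(** Integration by parts of [U] against its image under [A]: by symmetry of [A] the two products
    coincide, whence the factor 2. *)
Lemma H1_energy (A : V -> V) (M : R) U b : bounded_linear A M ->
  (forall x y, ip (A x) y = ip x (A y)) -> 0 <= b <= T ->
  ip (A (H1_trace U b)) (H1_trace U b) - ip (A (H1_trace U 0)) (H1_trace U 0) =
  2 * ip (L2_map A (H1_time_dot U)) (time_cut T b (H1_trace U)).
Proof.
move=> bA sA b0T.
have trA t : 0 <= t <= T -> H1_trace (H1_map bA U) t = A (H1_trace U t).
  exact: (H1_map_trace T0).
rewrite -!trA// H1_by_parts_cut// H1_map_dot ipC.
have -> : time_cut T b (H1_trace (H1_map bA U)) = L2_map A (time_cut T b (H1_trace U)).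
  apply: L2_ae_eq (time_cutE T0 b0T (H1_trace_cont T0 _)) _.
  have ht : {ae mu, forall t : measurableTypeR R, 0 < t < T} by exact: ae_time.
  apply: filterS3 (L2_mapE bA (time_cut T b (H1_trace U)))
    (time_cutE T0 b0T (H1_trace_cont T0 U)) ht => t -> -> /andP[t0 tT].
  by rewrite (bounded_linearZ bA) trA// !ltW.
rewrite (L2_map_ip _ _ bA bA sA) [X in _ + X]ipC; ring.
Qed.

Lemma pcL_ae n (x : nat -> V) : {ae mu, forall t : measurableTypeR R, exists i,
  [/\ (i < n.+1)%N, piece T n i t & pcL T T n x t = x i]}.
Proof.
have ht : {ae mu, forall t : measurableTypeR R, 0 < t < T} by exact: ae_time.
apply: filterS2 (pcLE T0 T n x) ht => t -> /andP[t0 tT].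
have t0T : 0 < t <= T by rewrite t0 ltW.
by have [i ni it] := piece_exists n t0T; exists i; split=> //; rewrite (pc_eq _ (ltW T0) ni it).
Qed.

Lemma pcL_ae2 n (x y : nat -> V) : {ae mu, forall t : measurableTypeR R, exists i,
  [/\ (i < n.+1)%N, piece T n i t, pcL T T n x t = x i & pcL T T n y t = y i]}.
Proof.
apply: filterS2 (pcL_ae n x) (pcL_ae n y) => t [i [ni it xi]] [j [nj jt yj]].
have ij := piece_uniq (ltW T0) it jt.
by exists i; split=> //; rewrite yj ij.
Qed.

Lemma pcL_primitive n (x : nat -> V) i : (i < n.+1)%N ->
  primitive (pcL T T n x) (pt T n i.+1) - primitive (pcL T T n x) (pt T n i) =
  (T / n.+1%:R) *: x i.
Proof.
move=> ni; have T0' := ltW T0; apply: ip_ext => y; rewrite ipC.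
have p0 := pt_ge0 n i T0'; have pS := pt_le n T0' (leqnSn i); have pT := pt_leb T0' ni.
rewrite primitiveB// (L2_ipE (strongly_measurable_time_ind (pt T n i) (pt T n i.+1) y)
  (strongly_measurable_pc T n x) (time_indE T0 _ _ y) (pcLE T0 T n x)).
rewrite (_ : (fun t => _) = (fun=> ip (x i) y) \_ (piece T n i : set (measurableTypeR R))).
  rewrite -Rintegral_mkcond Rintegral_cst; last exact: measurable_piece.
  rewrite time_measure_itv//= ipZl ptS addrAC subrr add0r mulrC; ring.
apply/funext => t; rewrite patchE indicE; case: (boolP (t \in piece T n i)) => [|_].
  by rewrite inE => it; rewrite scale1r (pc_eq _ T0' ni it) ipC.
by rewrite scale0r ip0l.
Qed.

(** The primitive of the difference quotients is the piecewise affine interpolant of [x], shifted so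
    as to start at [x0]. *)
Lemma H1_mk_pcL_trace n x0 (x : nat -> V) i : (i <= n.+1)%N ->
  H1_trace (H1_mk T0 x0 (pcL T T n (fun j => (T / n.+1%:R)^-1 *: (x j.+1 - x j)))) (pt T n i) =
  x0 + (x i - x 0%N).
Proof.
have T0' := ltW T0; have h0 : T / n.+1%:R != 0 by rewrite mulf_neq0 ?invr_neq0// gt_eqF.
elim: i => [_|i IH ni].
  by rewrite pt0 (H1_mk_trace T0)// (primitive0 T0) subrr.
have e j : (j <= n.+1)%N -> 0 <= pt T n j <= T by move=> nj; rewrite pt_ge0//= pt_leb.
have := IH (ltnW ni); rewrite !(H1_mk_trace T0) ?e// 1?ltnW// => hi.
rewrite -[primitive _ (pt T n i.+1)](subrK (primitive (pcL T T n
  (fun j => (T / n.+1%:R)^-1 *: (x j.+1 - x j))) (pt T n i))) pcL_primitive//.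
rewrite scalerA mulfV// scale1r addrCA hi addrCA; congr (_ + _).
by rewrite addrA subrK.
Qed.

(** The difference quotients are the means of the derivative over the pieces, that is, its
    orthogonal projection [f] onto piecewise constants: [ip f f = ip f U']. *)
Lemma pcL_diff_le n (U : H1) :
  `|pcL T T n (fun i => (T / n.+1%:R)^-1 *: (H1_trace U (pt T n i.+1) - H1_trace U (pt T n i)))|
   <= `|H1_time_dot U|.
Proof.
set f := pcL _ _ _ _.
have h0 : T / n.+1%:R != 0 by rewrite mulf_neq0 ?invr_neq0// gt_eqF.
have e : ip f f = ip f (H1_time_dot U).
  rewrite !(pcL_ip T0 _ _ _ T1); apply: eq_bigr => i _.
  by rewrite (pcL_primitive _ (ltn_ord i)) scalerA mulfV// scale1r H1_traceB.
have h : `|f| ^+ 2 <= `|f| * `|H1_time_dot U| by rewrite -ip_norm e ip_le.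
have [->|f0] := eqVneq `|f| 0; first by [].
have fp : 0 < `|f| by rewrite lt0r f0 normr_ge0.
by rewrite -(ler_pM2l fp) -expr2.
Qed.

Lemma L2_ae_cvg0 (w : nat -> L2t) (d : nat -> R) : (forall n, 0 <= d n) ->
  (forall n, {ae mu, forall t, `|w n t| <= d n}) -> d n @[n --> \oo] --> 0 ->
  w n @[n --> \oo] --> (0 : L2t).
Proof.
move=> d0 wd dc; apply: (cvg_seq_norm_le (d := fun n => d n * Num.sqrt T)) => [n|]; last first.
  by rewrite -[X in _ --> X](mul0r (Num.sqrt T)); apply: cvg_seqM => //; exact: cvg_cst.
rewrite subr0 -(@ler_pXn2r _ 2)// ?nnegrE ?mulr_ge0 ?sqrtr_ge0// exprMn sqr_sqrtr ?(ltW T0)//.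
rewrite -[X in _ <= _ * X]/(fine T%:E) -(time_measureT T0).
exact: (L2_norm_bound (time_fin T0)).
Qed.

End H1_calculus.

(** * The evolution variational inequality *)

Section evolution.
Context {R : realType} (T : R) (T0 : 0 < T) {V : normedModType R} {hV : hilbert V}.
Notation mu := (time_measure T).
Notation L2t := (L2 mu V).
Notation H1 := (H1_time T V).
#[local] Instance H1_time_hilbert : hilbert H1 := H1_hilbert T0.
Context (A : V -> V) (M c : R) (bA : bounded_linear A M).
Context (sA : forall x y, ip (A x) y = ip x (A y)).
Context (c0 : 0 < c) (coA : forall x, c * `|x| ^+ 2 <= ip (A x) x).
Context (C : set V) (clC : seq_closed C) (cvC : seg_convex C) (s0 : V) (Cs0 : C s0).
Let T1 : 0 <= T <= T. Proof. by rewrite lexx ltW. Qed.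
Let z1 : 0 <= (0 : R) <= T. Proof. by rewrite lexx ltW. Qed.

(** The reduced state equation in abstract form: [V] stands for the stresses, [C] for the admissible
    ones in equilibrium, [U] for the strain of the Dirichlet datum. *)
Definition evolution_solution (U u : H1) := H1_trace u 0 = s0 /\
  {ae mu, forall t : measurableTypeR R, C (H1_time_fun u t) /\
    forall tau, C tau ->
      0 <= ip (A (H1_time_dot u t) - H1_time_dot U t) (tau - H1_time_fun u t)}.

Definition in_C (w : L2t) := {ae mu, forall t, C (w t)}.

Lemma H1_fun_bounded_linear : bounded_linear (@H1_time_fun R T V) 1.
Proof. by split=> // u; rewrite mul1r; exact: H1_fun_le. Qed.

(* The inequality integrated in time is tested with the projection of u - g on C:
   this forces the projection to be u itself, which is the pointwise inequality. *)
Lemma evolution_localize (u : H1) (g : L2t) : in_C (H1_time_fun u) ->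
  (forall tau, in_C tau -> 0 <= ip g (tau - H1_time_fun u)) ->
  {ae mu, forall t : measurableTypeR R, forall tau, C tau ->
     0 <= ip (g t) (tau - H1_time_fun u t)}.
Proof.
move=> Cu hg; set w := H1_time_fun u in Cu hg *.
have [p hp] : exists p, is_projection C p by apply: projection => //; exists s0.
have mp : is_L2 mu (p \o (w - g : L2t)).
  by apply: (is_L2_lipschitz (time_fin T0)) (L2_reprP _) => x y; exact: projection_lipschitz hp.
pose q : L2t := L2_class mu (p \o (w - g : L2t)).
have qE : {ae mu, forall t : measurableTypeR R, q t = p (w t - g t)}.
  by apply: filterS2 (L2_classE mp) (L2_reprB w g) => t -> <-.
have Cq : in_C q by apply: filterS qE => t ->; have [] := hp (w t - g t).
(* The angle inequality at the projection of [w - g], tested with [w] and integrated; added to the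
   hypothesis tested with [q] it gives [|q - w|^2 <= 0]. *)
have h1 : 0 <= ip (q - w) (-1 *: g - (q - w)).
  apply: L2_ip_ge0.
  have h : {ae mu, forall t : measurableTypeR R, q t = p (w t - g t) /\ C (w t)}.
    by apply: filterS2 qE Cu => t.
  have h' : {ae mu, forall t : measurableTypeR R, L2_repr (-1 *: g - (q - w)) t = -1 *: g t - (q t - w t)}.
    apply: filterS3 (L2_reprB (-1 *: g) (q - w)) (L2_reprB q w) (L2_reprZ (-1) g) => t e1 e2 e3.
    by rewrite e1 e2 e3.
  apply: filterS3 (L2_reprB q w) h' h => t e2 e3 [e1 Cw].
  rewrite e3 e2 e1; have [_ /(_ _ Cw)] := hp (w t - g t).
  set y := p _; rewrite !ipBr !ipBl !ipZr (ipC y (w t)) (ipC y (g t)) (ipC (w t) (g t)); lra.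
have qw : q = w.
  have h2 := hg _ Cq.
  apply/subr0_eq/normr0_eq0/eqP; rewrite -sqrf_eq0 eq_le sqr_ge0 andbT -ip_norm.
  by move: h1; rewrite ipBr ipZr (ipC _ g); lra.
rewrite -/w qw in qE; apply: filterS qE => t e tau Ctau.
have [_ /(_ _ Ctau)] := hp (w t - g t); rewrite -e.
have -> : w t - g t - w t = - g t by rewrite addrAC subrr add0r.
by rewrite ipNl oppr_le0.
Qed.

Let q (x : V) := ip (A x) x.

(** Convexity of [q]: its tangent at [y] is affine in [x], so it passes to weak limits. In
    [evolution_stability] the point [y] is the weak limit, where tangent and form agree. *)
Lemma quad_tangent x y : 2 * ip (A y) x - q y <= q x.
Proof.
have := coA (x - y); rewrite (bounded_linearB bA) !ipBr !ipBl (sA x y) (ipC x) /q => h.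
have : 0 <= c * `|x - y| ^+ 2 by rewrite mulr_ge0 ?sqr_ge0// ltW.
by lra.
Qed.

Lemma H1_energy_end (u : H1) :
  ip (L2_map A (H1_time_dot u)) (H1_time_fun u) =
  2^-1 * (q (H1_trace u T) - q (H1_trace u 0)).
Proof. by rewrite (H1_energy T0 u bA sA T1) -(H1_fun_trace T0) mulrA mulVf ?mul1r. Qed.

(* The only product of two weakly convergent factors, A u' against u, is half the
   increment of the quadratic form of A, hence lower semicontinuous; U' against u
   is integrated by parts, since only U converges strongly. The piecewise constant
   ub serves the time discretization. *)
Lemma evolution_stability (un Un : nat -> H1) (ub : nat -> L2t) (u U : H1) (N : R) :
  wcvg un u -> wcvg Un U -> (forall n, `|un n| <= N) -> (forall n, `|Un n| <= N) ->
  H1_time_fun (Un n) @[n --> \oo] --> H1_time_fun U ->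
  H1_trace (Un n) 0 @[n --> \oo] --> H1_trace U 0 ->
  H1_trace (Un n) T @[n --> \oo] --> H1_trace U T ->
  (forall n, H1_trace (un n) 0 = s0) ->
  ub n - H1_time_fun (un n) @[n --> \oo] --> (0 : L2t) ->
  (forall n, in_C (ub n)) ->
  (forall n tau, in_C tau ->
     0 <= ip (L2_map A (H1_time_dot (un n)) - H1_time_dot (Un n)) (tau - ub n)) ->
  evolution_solution U u.
Proof.
move=> wu wU bu bU cf c0' cT un0 cub Cub vi.
pose proof (bounded_linear_wcvg (H1_trace_bounded_linear T0 z1) wu) as wu0.
pose proof (bounded_linear_wcvg (H1_trace_bounded_linear T0 T1) wu) as wuT.
pose proof (bounded_linear_wcvg (@H1_dot_bounded_linear R T V) wu) as wud.
pose proof (bounded_linear_wcvg (@H1_dot_bounded_linear R T V) wU) as wUd.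
pose proof (bounded_linear_wcvg H1_fun_bounded_linear wu) as wuf.
pose proof (bounded_linear_wcvg (L2_map_bounded_linear mu bA) wud) as wAd.
have u0 : H1_trace u 0 = s0.
  apply: wcvg_unique wu0 _ => z; rewrite (_ : (fun n => _) = fun=> ip s0 z); first exact: cvg_cst.
  by apply/funext => n /=; rewrite un0.
have wub : wcvg ub (H1_time_fun u).
  move=> z; pose proof (cvg_ipl (w := z) cub) as h; rewrite ip0l in h.
  have := cvg_seqD h (wuf z); rewrite add0r.
  by rewrite (_ : (fun n => _ + _) = fun n => ip (ub n) z)//; apply/funext => n /=; rewrite -ipDl subrK.
have Cu : in_C (H1_time_fun u).
  by apply: (wcvg_closed (ae_constraint_closed clC) (ae_constraint_convex cvC) Cub wub).
have nd n : `|H1_time_dot (un n)| <= N.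
  by have [_ _ /(_ (un n))] := @H1_dot_bounded_linear R T V; rewrite mul1r => /le_trans ->.
have nD n : `|H1_time_dot (Un n)| <= N.
  by have [_ _ /(_ (Un n))] := @H1_dot_bounded_linear R T V; rewrite mul1r => /le_trans ->.
have nA n : `|L2_map A (H1_time_dot (un n))| <= M * N.
  have [M0 _ h] := L2_map_bounded_linear mu bA.
  by apply: (le_trans (h _)); rewrite ler_wpM2l.
have nT n : `|H1_trace (un n) T| <= trace_bound T * N.
  have [M0 _ h] := H1_trace_bounded_linear T0 (V := V) T1.
  by apply: (le_trans (h _)); rewrite ler_wpM2l.
split=> //.
have gE : {ae mu, forall t : measurableTypeR R,
    (L2_map A (H1_time_dot u) - H1_time_dot U : L2t) t = A (H1_time_dot u t) - H1_time_dot U t}.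
  by apply: filterS2 (L2_reprB (L2_map A (H1_time_dot u)) (H1_time_dot U))
    (L2_mapE bA (H1_time_dot u)) => t -> ->.
apply: filterS3 Cu gE (@evolution_localize u (L2_map A (H1_time_dot u) - H1_time_dot U) Cu _)
  => [t Ct <- //|tau Ctau].
pose proof (wcvg_ip wAd nA cub) as e1; pose proof (wcvg_ip wUd nD cub) as e2.
pose proof (wcvg_ip wuT nT cT) as e3; pose proof (wcvg_ip wud nd cf) as e4.
pose proof (cvg_ipl (w := s0) c0') as e5; pose proof (wuT (A (H1_trace u T))) as e6.
rewrite ip0r in e1; rewrite ip0r in e2.
pose proof (H1_by_parts T0 u U) as ibp; pose proof (H1_energy_end u) as en.
set L := ip _ _.
(* The energy identity and integration by parts leave only terms that converge along the sequence.
   The form at time [T] is written as its tangent at the limit, and the two zeros are the limits of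
   the products with [ub n - H1_time_fun (un n)]. *)
have LE : L = ip (L2_map A (H1_time_dot u)) tau - ip (H1_time_dot U) tau
   - 2^-1 * (2 * ip (H1_trace u T) (A (H1_trace u T)) - q (H1_trace u T) - q s0) - 0
   + (ip (H1_trace u T) (H1_trace U T) - ip (H1_trace U 0) s0 - ip (H1_time_dot u) (H1_time_fun U)) + 0.
  rewrite /L !ipBl !ipBr en u0; rewrite u0 in ibp.
  by move: ibp; rewrite (ipC _ (H1_time_dot U)) (ipC (H1_time_fun U)) (ipC s0) /q (ipC _ (A (H1_trace u T))); lra.
rewrite LE; apply: (cvg_seq_lim_le (u := fun=> 0) (v := fun n =>
   ip (L2_map A (H1_time_dot (un n))) tau - ip (H1_time_dot (Un n)) tau
   - 2^-1 * (2 * ip (H1_trace (un n) T) (A (H1_trace u T)) - q (H1_trace u T) - q s0)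
   - ip (L2_map A (H1_time_dot (un n))) (ub n - H1_time_fun (un n))
   + (ip (H1_trace (un n) T) (H1_trace (Un n) T) - ip (H1_trace (Un n) 0) s0
      - ip (H1_time_dot (un n)) (H1_time_fun (Un n)))
   + ip (H1_time_dot (Un n)) (ub n - H1_time_fun (un n)))); first exact: cvg_cst.
  apply: cvg_seqD; last exact: e2.
  apply: cvg_seqD; last first.
    by apply: cvg_seqB; [apply: cvg_seqB; [exact: e3|exact: e5]|exact: e4].
  apply: cvg_seqB; last exact: e1.
  apply: cvg_seqB; first by apply: cvg_seqB; [exact: wAd|exact: wUd].
  apply: cvg_seqM; first exact: cvg_cst.
  apply: cvg_seqB; last exact: cvg_cst.
  apply: cvg_seqB; last exact: cvg_cst.
  by apply: cvg_seqM; [exact: cvg_cst|exact: e6].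
move=> n; have h := vi n _ Ctau.
pose proof (H1_by_parts T0 (un n) (Un n)) as ib; pose proof (H1_energy_end (un n)) as ee.
pose proof (quad_tangent (H1_trace (un n) T) (H1_trace u T)) as qt.
rewrite un0 in ib ee; move: h ib ee qt.
rewrite !ipBl !ipBr (ipC (H1_time_fun (un n))) (ipC (H1_time_fun (Un n))) (ipC s0) (ipC (A (H1_trace u T))); lra.
Qed.


Lemma evolution_solution_integrated U u tau : evolution_solution U u -> in_C tau ->
  0 <= ip (L2_map A (H1_time_dot u) - H1_time_dot U) (tau - H1_time_fun u).
Proof.
move=> [_ hu] Ctau; apply: L2_ip_ge0.
have e1 : {ae mu, forall t : measurableTypeR R,
    L2_repr (L2_map A (H1_time_dot u) - H1_time_dot U) t = A (H1_time_dot u t) - H1_time_dot U t}.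
  by apply: filterS2 (L2_reprB (L2_map A (H1_time_dot u)) (H1_time_dot U))
    (L2_mapE bA (H1_time_dot u)) => t -> ->.
have e2 : {ae mu, forall t : measurableTypeR R,
    L2_repr (tau - H1_time_fun u) t = tau t - H1_time_fun u t /\ C (tau t)}.
  by apply: filterS2 (L2_reprB tau (H1_time_fun u)) Ctau => t.
by apply: filterS3 e1 e2 hu => t -> [-> Ct] [_]; exact.
Qed.

Lemma evolution_closed (un Un : nat -> H1) (u U : H1) (N : R) :
  (forall n, evolution_solution (Un n) (un n)) ->
  wcvg un u -> wcvg Un U -> (forall n, `|un n| <= N) -> (forall n, `|Un n| <= N) ->
  H1_time_fun (Un n) @[n --> \oo] --> H1_time_fun U ->
  H1_trace (Un n) 0 @[n --> \oo] --> H1_trace U 0 ->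
  H1_trace (Un n) T @[n --> \oo] --> H1_trace U T -> evolution_solution U u.
Proof.
move=> sol wu wU bu bU cf cz cT.
apply: (evolution_stability (ub := fun n => H1_time_fun (un n)) wu wU bu bU cf cz cT).
- by move=> n; have [] := sol n.
- by under eq_fun do rewrite subrr; exact: cvg_cst.
- by move=> n; have [_] := sol n; apply: filterS => t [].
- by move=> n tau; exact: evolution_solution_integrated.
Qed.

Lemma coercive_eq0 x : ip (A x) x <= 0 -> x = 0.
Proof.
move=> h; apply/normr0_eq0/eqP; rewrite -sqrf_eq0 eq_le sqr_ge0 andbT.
by rewrite -(ler_pM2l c0) mulr0 (le_trans (coA x)).
Qed.

(** Each inequality tested with the other solution makes [ip (A (u' - v')) (u - v)] nonpositive
    almost everywhere; its integral up to any [b] is half the energy of [u - v] at [b]. *)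
Lemma evolution_unique U u v : evolution_solution U u -> evolution_solution U v -> u = v.
Proof.
move=> [u0 hu] [v0 hv].
have wt t : 0 <= t <= T -> H1_trace (u - v) t = H1_trace u t - H1_trace v t.
  by move=> t0T; exact: (bounded_linearB (H1_trace_bounded_linear T0 t0T)).
have wd : H1_time_dot (u - v) = H1_time_dot u - H1_time_dot v.
  exact: (bounded_linearB (@H1_dot_bounded_linear R T V)).
have w0 b : 0 <= b <= T -> H1_trace (u - v) b = 0.
  move=> b0T; apply: coercive_eq0.
  pose proof (H1_energy T0 (u - v) bA sA b0T) as en.
  rewrite (wt 0 z1) u0 v0 subrr ip0r subr0 in en.
  set cu := time_cut _ _ _ in en.
  have h : 0 <= ip (L2_map A (H1_time_dot (u - v))) (-1 *: cu); last first.
    by move: h; rewrite ipZr; move: en; lra.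
  have wE : {ae mu, forall t : measurableTypeR R, cu t =
      \1_(`]0, b]%classic) t *: (H1_time_fun u t - H1_time_fun v t)}.
    have ht : {ae mu, forall t : measurableTypeR R, 0 < t < T} by exact: ae_time.
    have ht2 : {ae mu, forall t : measurableTypeR R,
        H1_trace (u - v) t = H1_time_fun u t - H1_time_fun v t}.
      apply: filterS3 (H1_trace_ae T0 u) (H1_trace_ae T0 v) ht => t -> -> /andP[t0 tT].
      by rewrite wt// !ltW.
    by apply: filterS2 (time_cutE T0 b0T (H1_trace_cont T0 (u - v))) ht2 => t -> ->.
  apply: L2_ip_ge0.
  have h1 : {ae mu, forall t : measurableTypeR R, (L2_map A (H1_time_dot (u - v))) t =
      A (H1_time_dot u t) - A (H1_time_dot v t)}.
    have e := L2_reprB (H1_time_dot u) (H1_time_dot v); rewrite -wd in e.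
    apply: filterS2 (L2_mapE bA (H1_time_dot (u - v))) e => t -> ->.
    by rewrite (bounded_linearB bA).
  have h2 : {ae mu, forall t : measurableTypeR R, 
      ip (A (H1_time_dot u t) - A (H1_time_dot v t)) (H1_time_fun u t - H1_time_fun v t) <= 0}.
    apply: filterS2 hu hv => t [Cu /(_ (H1_time_fun v t)) h1'] [Cv /(_ (H1_time_fun u t)) h2'].
        have {}h1' := h1' Cv; have {}h2' := h2' Cu; move: h1' h2'.
    by rewrite !ipBl !ipBr; lra.
  have h3 : {ae mu, forall t : measurableTypeR R, L2_repr (-1 *: cu) t =
     - (\1_(`]0, b]%classic) t) *: (H1_time_fun u t - H1_time_fun v t)}.
    by apply: filterS2 (L2_reprZ (-1) cu) wE => t -> ->; rewrite /= scalerA mulN1r.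
  apply: filterS3 h1 h2 h3 => t -> h ->.
  by rewrite ipZr mulNr oppr_ge0 mulr_ge0_le0// indicE ler0n.
apply: (H1_ext T0); apply: L2_ae_eq (H1_trace_ae T0 u) _.
have ht : {ae mu, forall t : measurableTypeR R, 0 < t < T} by exact: ae_time.
apply: filterS2 (H1_trace_ae T0 v) ht => t -> /andP[t0 tT].
by apply/esym/subr0_eq; rewrite -wt ?w0// !ltW.
Qed.

(** [s'] minimizes [ip (A x) x / 2 - ip (A s + F) x] over [C]. As [F] is an increment of the strain
    and not a rate, the time step does not enter. The bound follows from the test with [s] and
    coercivity. *)
Lemma euler_step (s F : V) : C s -> exists s', [/\ C s',
  forall tau, C tau -> 0 <= ip (A (s' - s) - F) (tau - s') & `|s' - s| <= c^-1 * `|F|].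
Proof.
move=> Cs; have [M0 lA MA] := bA.
have bil : sym_bilinear (fun x y => ip (A x) y).
  split=> [x y|a x y z]; first by rewrite sA ipC.
  by rewrite lA ipDl ipZl.
have bnd x y : `|ip (A x) y| <= M * `|x| * `|y|.
  by apply: (le_trans (ip_CS _ _)); rewrite ler_wpM2r.
have [s' Cs' hs'] := quadratic_argmin hilbert_complete bil c0 coA bnd
  (ip_linearr (A s + F)) (ip_CS (A s + F)) (ex_intro _ s Cs) clC cvC.
have vi tau : C tau -> 0 <= ip (A (s' - s) - F) (tau - s').
  by move=> /hs'; rewrite (bounded_linearB bA) !ipBl ipDl; lra.
exists s'; split=> //; rewrite ler_pdivlMl//.
have [->|d0] := eqVneq (s' - s) 0; first by rewrite normr0 mulr0.
have dp : 0 < `|s' - s| by rewrite normr_gt0.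
rewrite -(ler_pM2r dp) -mulrA -expr2 (le_trans (coA _))// (le_trans _ (ip_le _ _))//.
by have := vi _ Cs; rewrite -[s - s']opprB ipNr ipBl; lra.
Qed.

(** The Hoelder modulus of a trace over one piece, up to the norm of the derivative. *)
Let mesh n := Num.sqrt (T / n.+1%:R).

Lemma mesh_cvg0 (k : R) : mesh n * k @[n --> \oo] --> 0.
Proof.
rewrite -[X in _ --> X](mul0r k); apply: cvg_seqM; last exact: cvg_cst.
have e : T / n.+1%:R @[n --> \oo] --> (0 : R).
  by rewrite -[X in _ --> X](mulr0 T); apply: cvg_seqMl; exact: cvg_inv_succ.
by rewrite -[X in _ --> X]sqrtr0; exact: (cvg_comp _ _ e (@sqrt_continuous R 0)).
Qed.

Lemma piece_trace_le (W : H1) n i t (l : bool) : (i < n.+1)%N -> piece T n i t ->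
  `|H1_trace W t - H1_trace W (pt T n (i + l))| <= mesh n * `|H1_time_dot W|.
Proof.
move=> ni; rewrite /piece /= in_itv/= => /andP[t0 t1]; have T0' := ltW T0.
have p0 := pt_ge0 n i T0'; have pT := pt_leb T0' ni; have pS := ptS T n i.
have hm r : r <= T / n.+1%:R -> Num.sqrt r * `|H1_time_dot W| <= mesh n * `|H1_time_dot W|.
  by move=> hr; rewrite ler_wpM2r// ler_wsqrtr.
have ht : t - pt T n i <= T / n.+1%:R by rewrite lerBlDl -pS.
case: l; rewrite ?addn1 ?addn0.
  rewrite distrC; apply: le_trans (H1_trace_lipschitz T0 W _ t1 pT) (hm _ _).
    by rewrite (le_trans p0)// ltW.
  by rewrite pS lerBlDr addrC lerD2l ltW.
by apply: le_trans (H1_trace_lipschitz T0 W p0 (ltW t0) (le_trans t1 pT)) (hm _ ht).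
Qed.

Lemma pcL_time_ae n (x : nat -> V) (W : H1) (l : bool) (k : R) :
  (forall i, (i < n.+1)%N -> `|x i - H1_trace W (pt T n (i + l))| <= k) ->
  {ae mu, forall t : measurableTypeR R,
    `|L2_repr (pcL T T n x - H1_time_fun W) t| <= mesh n * `|H1_time_dot W| + k}.
Proof.
move=> hk; have h := L2_reprB (pcL T T n x) (H1_time_fun W).
apply: filterS3 h (H1_trace_ae T0 W) (pcL_ae T0 n x) => t -> -> [i [ni it ->]].
rewrite -(subrKA (H1_trace W (pt T n (i + l)))) addrC.
apply: (le_trans (ler_normD _ _)); apply: lerD; last exact: hk.
by rewrite distrC; exact: piece_trace_le.
Qed.

(* Implicit Euler scheme on uniform partitions. *)
Lemma evolution_exists U : exists2 u, evolution_solution U u &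
  `|H1_time_dot u| <= c^-1 * `|H1_time_dot U|.
Proof.
have [st hst] : exists st : V * V -> V, forall p, C p.1 -> [/\ C (st p),
    forall tau, C tau -> 0 <= ip (A (st p - p.1) - p.2) (tau - st p)
    & `|st p - p.1| <= c^-1 * `|p.2|].
  have h p : exists s', C p.1 -> [/\ C s',
    forall tau, C tau -> 0 <= ip (A (s' - p.1) - p.2) (tau - s') & `|s' - p.1| <= c^-1 * `|p.2|].
    (* [choice] asks for a value at every pair; outside [C] the step is the default 0. *)
    have [Cp|] := pselect (C p.1); last by exists 0.
    by have [s' hs'] := euler_step p.2 Cp; exists s'.
  by have [f hf] := choice h; exists f.
pose F n i := @H1_trace _ _ _ hV U (pt T n i.+1) - @H1_trace _ _ _ hV U (pt T n i).
pose fix s n i := if i is j.+1 then st (s n j, F n j) else s0.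
have Cs n i : C (s n i) by elim: i => //= i IH; have [] := hst (s n i, F n i) IH.
have hs n i := hst (s n i, F n i) (Cs n i).
pose h n : R := T / n.+1%:R.
have h_gt0 n : 0 < h n by rewrite divr_gt0.
pose vn n := pcL T T n (fun i => (h n)^-1 *: (s n i.+1 - s n i)).
pose Fn n := pcL T T n (fun i => (h n)^-1 *: F n i).
pose un n : H1 := @H1_mk _ _ T0 _ hV s0 (vn n).
pose Un n : H1 := @H1_mk _ _ T0 _ hV (@H1_trace _ _ _ hV U 0) (Fn n).
(* Right end values: the inequality of the implicit step holds at the new state. *)
pose ub n := pcL T T n (fun i => s n i.+1).
have Fle n : `|Fn n| <= `|H1_time_dot U| by exact: (pcL_diff_le T0).
have vle n : `|vn n| <= c^-1 * `|H1_time_dot U|.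
  apply: (@le_trans _ _ (c^-1 * `|Fn n|)); last by rewrite ler_wpM2l ?invr_ge0 ?(ltW c0).
  apply: L2_norm_le; first by rewrite invr_ge0 ltW.
  apply: filterS (pcL_ae2 T0 n (fun i => (h n)^-1 *: (s n i.+1 - s n i)) (fun i => (h n)^-1 *: F n i)).
  move=> t [i [_ _ -> ->]]; rewrite !normrZ mulrCA ler_wpM2l//.
  by have [] := hs n i.
have utr n i : (i <= n.+1)%N -> H1_trace (un n) (pt T n i) = s n i.
  by move=> ni; rewrite (H1_mk_pcL_trace T0 s0 (s n) ni)/= addrC subrK.
have Utr n i : (i <= n.+1)%N -> H1_trace (Un n) (pt T n i) = H1_trace U (pt T n i).
  move=> ni; rewrite (H1_mk_pcL_trace T0 _ (fun i => H1_trace U (pt T n i)) ni)/=.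
  by rewrite pt0 addrC subrK.
have ub0 : ub n - H1_time_fun (un n) @[n --> \oo] --> (0 : L2t).
  apply: (L2_ae_cvg0 T0 (d := fun n => mesh n * (c^-1 * `|H1_time_dot U|))).
  - by move=> n; rewrite !mulr_ge0 ?sqrtr_ge0// invr_ge0 ltW.
  - move=> n; have hk i : (i < n.+1)%N -> `|s n i.+1 - H1_trace (un n) (pt T n (i + true))| <= 0.
      by move=> ni; rewrite addn1 utr// subrr normr0.
    apply: filterS (pcL_time_ae hk) => t /le_trans; apply.
    by rewrite addr0 ler_wpM2l ?sqrtr_ge0//; exact: vle.
  - exact: mesh_cvg0.
have UL2 : H1_time_fun (Un n) @[n --> \oo] --> H1_time_fun U.
  have hd (W : H1) n : {ae mu, forall t : measurableTypeR R,
      `|L2_repr (pcL T T n (fun i => H1_trace W (pt T n i)) - H1_time_fun W) t|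
       <= mesh n * `|H1_time_dot W|}.
    have hk i : (i < n.+1)%N -> `|H1_trace W (pt T n i) - H1_trace W (pt T n (i + false))| <= 0.
      by move=> ni; rewrite addn0 subrr normr0.
    by apply: filterS (pcL_time_ae hk) => t; rewrite addr0.
  (* [Un n] and [U] agree at the nodes, so they share one piecewise constant interpolant, to which
     both are close. *)
  have pE n : pcL T T n (fun i => H1_trace (Un n) (pt T n i)) =
              pcL T T n (fun i => H1_trace U (pt T n i)).
    have e : {ae mu, forall t : measurableTypeR R, pcL T T n (fun i => H1_trace (Un n) (pt T n i)) t =
        pcL T T n (fun i => H1_trace U (pt T n i)) t}.
      apply: filterS (pcL_ae2 T0 n (fun i => H1_trace (Un n) (pt T n i))
        (fun i => H1_trace U (pt T n i))) => t [i [ni it -> ->]].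
      by rewrite Utr// ltnW.
    exact: L2_ae_eq e (aeW mu (fun t => erefl)).
  have hm n : 0 <= mesh n by exact: sqrtr_ge0.
  have a0 : pcL T T n (fun i => H1_trace U (pt T n i)) - H1_time_fun U @[n --> \oo] --> (0 : L2t).
    apply: (L2_ae_cvg0 T0 _ (hd U)) => [n|]; first by rewrite mulr_ge0.
    exact: mesh_cvg0.
  have a1 : pcL T T n (fun i => H1_trace U (pt T n i)) - H1_time_fun (Un n) @[n --> \oo] --> (0 : L2t).
    apply: (L2_ae_cvg0 T0 (d := fun n => mesh n * `|H1_time_dot U|)) => [n|n|].
    - by rewrite mulr_ge0.
    - rewrite -pE; apply: filterS (hd (Un n) n) => t /le_trans; apply.
      by rewrite ler_wpM2l//; exact: Fle.
    - exact: mesh_cvg0.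
  have hc : (fun=> H1_time_fun U) n @[n --> \oo] --> H1_time_fun U by exact: cvg_cst.
  have := cvg_seqD (cvg_seqB a0 a1) hc; rewrite subr0 add0r.
  have e n : pcL T T n (fun i => H1_trace U (pt T n i)) - H1_time_fun U -
    (pcL T T n (fun i => H1_trace U (pt T n i)) - H1_time_fun (Un n)) + H1_time_fun U =
    H1_time_fun (Un n) by rewrite opprB addrC addrA [H1_time_fun U + _]addrC subrK addrC subrK.
  by under eq_fun do rewrite e.
(* The bound of [H1_norm_le] for both interpolants at once, with rates estimated by [vle] and
   [Fle]. *)
pose N := Num.sqrt T * (`|s0| + `|@H1_trace _ _ _ hV U 0|) + (T + 1) * (c^-1 * `|H1_time_dot U| + `|H1_time_dot U|).
have T1p : 0 <= T + 1 by rewrite addr_ge0// ltW.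
have ci : 0 <= c^-1 by rewrite invr_ge0 ltW.
have un0 n : H1_trace (un n) 0 = s0 by rewrite (H1_mk_trace T0)// (primitive0 T0) addr0.
have Un0 n : H1_trace (Un n) 0 = H1_trace U 0 by rewrite (H1_mk_trace T0)// (primitive0 T0) addr0.
have bu n : `|un n| <= N.
  apply: (le_trans (H1_norm_le T0 (un n))); rewrite un0; apply: lerD.
    by rewrite ler_wpM2l ?sqrtr_ge0// lerDl.
  by rewrite ler_wpM2l// (le_trans (vle n))// lerDl.
have bU n : `|Un n| <= N.
  apply: (le_trans (H1_norm_le T0 (Un n))); rewrite Un0; apply: lerD.
    by rewrite ler_wpM2l ?sqrtr_ge0// lerDr.
  by rewrite ler_wpM2l// (le_trans (Fle n))// lerDr mulr_ge0.
have [k1 [u [k1n wu]]] := bounded_wcvg_subseq bu.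
have [k2 [U' [k2n wU]]] := bounded_wcvg_subseq (fun n => bU (k1 n)).
have kn n : (n <= k1 (k2 n))%N by rewrite (leq_trans (k2n n)).
pose proof (wcvg_subseq k2n wu) as wu2.
have cf := cvg_seq_subseq kn UL2.
(* The weak limit of the strains is identified through the function part, which converges
   strongly. *)
have UU : U' = U.
  apply: (H1_ext T0); pose proof (bounded_linear_wcvg H1_fun_bounded_linear wU) as wf.
  by pose proof (cvg_wcvg cf) as wf'; apply: wcvg_unique wf wf'.
rewrite UU in wU; exists u; last first.
  pose proof (bounded_linear_wcvg (@H1_dot_bounded_linear R T V) wu) as wd.
  by apply: wcvg_norm_le wd _ => n; exact: vle.
apply: (evolution_stability wu2 wU (fun n => bu _) (fun n => bU _) cf _ _ _
  (cvg_seq_subseq kn ub0)) => [||n|n|n tau Ctau] //=.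
- rewrite (_ : (fun n => _) = fun=> H1_trace U 0); first exact: cvg_cst.
  by apply/funext => n.
- rewrite (_ : (fun n => _) = fun=> H1_trace U T); first exact: cvg_cst.
  by apply/funext => n; have := Utr (k1 (k2 n)) _ (leqnn _); rewrite ptn.
- by apply: filterS (pcL_ae T0 (k1 (k2 n)) (fun i => s (k1 (k2 n)) i.+1)) => t [i [_ _ ->]].
- set m := k1 (k2 n); apply: L2_ip_ge0.
  have e1 : {ae mu, forall t : measurableTypeR R, L2_repr (L2_map A (vn m) - Fn m) t = A (vn m t) - Fn m t}.
    by apply: filterS2 (L2_reprB (L2_map A (vn m)) (Fn m)) (L2_mapE bA (vn m)) => t -> ->.
  have e2 : {ae mu, forall t : measurableTypeR R, exists i, [/\ vn m t = (h m)^-1 *: (s m i.+1 - s m i),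
      Fn m t = (h m)^-1 *: F m i & ub m t = s m i.+1]}.
    apply: filterS2 (pcL_ae2 T0 m (fun i => (h m)^-1 *: (s m i.+1 - s m i)) (fun i => (h m)^-1 *: F m i))
      (pcL_ae T0 m (fun i => s m i.+1)) => t [i [ni it a1 a2]] [j [nj jt a3]].
    by exists i; split=> //; rewrite /ub a3 (piece_uniq (ltW T0) it jt).
  have e3 : {ae mu, forall t : measurableTypeR R, C (tau t) /\ L2_repr (tau - ub m) t = tau t - ub m t}.
    by apply: filterS2 Ctau (L2_reprB tau (ub m)) => t.
  apply: filterS3 e1 e2 e3 => t -> [i [-> -> e]] [Ct ->]; rewrite e.
  (* Both rates carry the positive factor [(h m)^-1], so this is the inequality of one Euler
     step. *)
  rewrite (bounded_linearZ bA) -scalerBr ipZl mulr_ge0 ?invr_ge0 ?(ltW (h_gt0 m))//.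
  by have [_ hv _] := hs m i; exact: hv.
Qed.

Lemma evolution_bound U u : evolution_solution U u ->
  `|H1_time_dot u| <= c^-1 * `|H1_time_dot U|.
Proof.
by move=> hu; have [v hv] := evolution_exists U; rewrite (evolution_unique hu hv).
Qed.

End evolution.

Lemma continuous_linear_bounded_linear {R : realType} (V W : normedModType R)
  (f : {linear V -> W}) : continuous f -> exists M, bounded_linear f M.
Proof.
move=> /(_ 0) /continuous_linear_bounded /linear_boundedP [y [yr hy]].
exists (`|y| + 1); split=> [|a u v|u]; [by rewrite addr_ge0|exact: linearP|].
by apply: hy; rewrite (le_lt_trans (ler_norm y))// ltrDl.
Qed.

Lemma bounded_linear_comp {R : realType} (V W Z : normedModType R)
  (f : V -> W) (g : W -> Z) (M N : R) :
  bounded_linear f M -> bounded_linear g N -> bounded_linear (g \o f) (N * M).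
Proof.
move=> [M0 lf bf] [N0 lg bg]; split=> [|a u v|u] /=; first exact: mulr_ge0.
  by rewrite lf lg.
by rewrite -mulrA (le_trans (bg _))// ler_wpM2l.
Qed.

Lemma cvg_seq_sum {R : realType} (V : normedModType R) (I : Type) (r : seq I)
  (u : I -> nat -> V) (l : I -> V) : (forall i, u i n @[n --> \oo] --> l i) ->
  (\sum_(i <- r) u i n) @[n --> \oo] --> \sum_(i <- r) l i.
Proof.
move=> ul; elim: r => [|i r IH].
  by rewrite big_nil; under eq_fun do rewrite big_nil; exact: cvg_cst.
by rewrite big_cons; under eq_fun do rewrite big_cons; apply: cvg_seqD.
Qed.

(** * Stresses *)

Section symmetric_matrix_space.
Context {R : realType} {d : nat}.
Notation S := (sym R d).

Lemma frob_norm m n (G : eucl R m n) : frob G G = `|G| ^+ 2.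
Proof. by rewrite [`|G|]/(enorm G) sqr_sqrtr ?frob_ge0. Qed.

Lemma entry_le m n (G : eucl R m n) i j : `|G i j| <= `|G|.
Proof.
rewrite -(@ler_pXn2r _ 2)// ?nnegrE// -frob_norm /frob.
rewrite (bigD1 i)//= (bigD1 j)//= real_normK ?num_real// -expr2 -addrA lerDl.
rewrite addr_ge0// sumr_ge0// => k _; first by rewrite -expr2 sqr_ge0.
by rewrite sumr_ge0// => l _; rewrite -expr2 sqr_ge0.
Qed.

Lemma sym_complete : cauchy_complete S.
Proof.
move=> u uc.
have h i j : exists l : R, u n i j @[n --> \oo] --> l.
  apply: (@completeNormedMod_cauchy_complete R R) => e /uc[N hN]; exists N => m n Nm Nn.
  have -> : u m i j - u n i j = (u m - u n : S) i j by rewrite !mxE.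
  exact: le_lt_trans (entry_le (u m - u n : S) i j) (hN _ _ Nm Nn).
have [f hf] := choice (fun p : 'I_d * 'I_d => h p.1 p.2).
pose L : 'M[R]_d := \matrix_(i, j) f (i, j).
have symL : L \in sym_pred.
  rewrite inE; apply/eqP/matrixP => i j; rewrite !mxE.
  apply: cvg_filter_unique (hf (j, i)) _ => /=.
  rewrite (_ : (fun n => _) = fun n => u n i j); first exact: hf (i, j).
  by apply/funext => n; have := sym_valP (u n); rewrite inE => /eqP {2}<-; rewrite mxE.
exists (Sym symL); apply: (cvg_seq_norm_le (d := fun n => `|u n - Sym symL|)) => //.
apply: cvg_sqr0 => //.
have -> : (fun n => `|u n - Sym symL| ^+ 2) =
    fun n => \sum_i \sum_j (u n i j - f (i, j)) * (u n i j - f (i, j)).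
  apply/funext => n; rewrite -[LHS](frob_norm (u n - Sym symL : S)) /frob.
  by apply: eq_bigr => i _; apply: eq_bigr => j _; rewrite !mxE.
rewrite [X in _ --> X](_ : 0 = \sum_(i < d) \sum_(j < d) 0 * 0 :> R); last first.
  by rewrite big1 // => i _; rewrite big1 // => j _; rewrite mulr0.
apply: (@cvg_seq_sum R R _ _ (fun i n => \sum_j (u n i j - f (i, j)) * (u n i j - f (i, j)))
  (fun=> \sum_j 0 * 0)) => i.
apply: (@cvg_seq_sum R R _ _ (fun j n => (u n i j - f (i, j)) * (u n i j - f (i, j)))
  (fun=> 0 * 0)) => j.
have e : u n i j - f (i, j) @[n --> \oo] --> 0.
  by rewrite -(subrr (f (i, j))); apply: cvg_seqB; [exact: hf (i, j)|exact: cvg_cst].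
exact: cvg_seqM.
Qed.

Lemma frob_sym_bilinear : sym_bilinear (fun P Q : S => frob P Q).
Proof. by split=> [P Q|a P Q Z]; [exact: frobC|rewrite frobDl frobZl]. Qed.

#[export] Instance sym_hilbert : hilbert S :=
  Hilbert frob_sym_bilinear (fun P => @frob_norm d d P) sym_complete.

Lemma enormT (G : 'M[R]_d) : enorm G^T = enorm G.
Proof.
rewrite /enorm /frob exchange_big; congr (Num.sqrt _).
by apply: eq_bigr => i _; apply: eq_bigr => j _; rewrite !mxE.
Qed.

Lemma sym_part_bounded_linear :
  bounded_linear (fun G : eucl R d d => sym_part G) 1.
Proof.
split=> // [a G H|G]; last first.
  have -> : `|sym_part G| = enorm (2^-1 *: ((G : 'M[R]_d) + G^T)) by [].
  rewrite mul1r (enormZ _ ((G : 'M[R]_d) + G^T)) ger0_norm ?invr_ge0//.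
  rewrite ler_pdivrMl// (le_trans (enormD _ _))// enormT.
  by rewrite [`|G|]/(enorm G) mulrDl mul1r.
apply/val_inj/matrixP => i j /=; rewrite !mxE; ring.
Qed.

Lemma sym_partK (P : S) : sym_part P = P.
Proof.
apply: val_inj => /=; have := sym_valP P; rewrite inE => /eqP ->.
by rewrite scalerDr -scalerDl (_ : 2^-1 + 2^-1 = 1) ?scale1r//; lra.
Qed.

(** A symmetric matrix is its own symmetric part, hence the combination of the symmetrized matrix
    units [e i j] with its entries as coefficients, and entries are bounded by the norm. *)
Lemma linear_sym_bounded (C : {linear S -> S}) : exists M, bounded_linear C M.
Proof.
have [_ ls _] := sym_part_bounded_linear.
pose e i j : S := sym_part (delta_mx i j).
have expand (P : S) : P = \sum_i \sum_j P i j *: e i j.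
  have s0 : sym_part (0 : eucl R d d) = 0.
    by have := ls (-1) 0 0; rewrite scaler0 addr0 scaleN1r addNr.
  rewrite -[LHS]sym_partK {1}(matrix_sum_delta P).
  have sumE (I : finType) (F : I -> eucl R d d) : sym_part (\sum_i F i) = \sum_i sym_part (F i).
    elim/big_rec2: _ => [//|i x y _ <-].
    by have := ls 1 (F i) y; rewrite !scale1r.
  rewrite sumE; apply: eq_bigr => i _; rewrite sumE; apply: eq_bigr => j _.
  by have := ls (P i j) (delta_mx i j) 0; rewrite s0 !addr0.
exists (\sum_i \sum_j `|C (e i j)|); split=> [|a u v|P]; last first.
- rewrite {1}(expand P) linear_sum mulr_suml (le_trans (ler_norm_sum _ _ _))//.
  apply: ler_sum => i _; rewrite linear_sum mulr_suml (le_trans (ler_norm_sum _ _ _))//.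
  by apply: ler_sum => j _; rewrite linearZ/= normrZ mulrC ler_wpM2l// entry_le.
- exact: linearP.
by rewrite sumr_ge0// => i _; rewrite sumr_ge0.
Qed.

(** As [P = C (A P)], coercivity of [C] gives [ip (A P) P >= c * |A P|^2], and
    [|P| <= (M + 1) * |A P|]; the added 1 keeps the divisor positive. *)
Lemma sym_coercive_inverse (C A : {linear S -> S}) : sym_coercive C -> cancel A C ->
  (forall P Q : S, ip (A P) Q = ip P (A Q)) /\
  exists2 c, 0 < c & forall P : S, c * `|P| ^+ 2 <= ip (A P) P.
Proof.
move=> [sC [c c0 coC]] AK; split=> [P Q|].
  by rewrite -{1}(AK Q) -{2}(AK P) [LHS]frobC [LHS]sC frobC [RHS]/= frobC.
have [M [M0 _ MC]] := linear_sym_bounded C.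
have M1 : 0 < M + 1 by rewrite ltr_wpDl.
exists (c / (M + 1) ^+ 2); first by rewrite divr_gt0// exprn_gt0.
move=> P; apply: le_trans (_ : c * `|A P| ^+ 2 <= _).
  rewrite -mulrA ler_pM2l// ler_pdivrMl ?exprn_gt0// -exprMn ler_pXn2r ?nnegrE ?mulr_ge0 ?(ltW M1)//.
  by rewrite -{1}(AK P) (le_trans (MC _))// ler_wpM2r// lerDl.
by rewrite (le_trans (coC (A P)))// AK [leRHS]frobC.
Qed.

End symmetric_matrix_space.

Section stress_space.
Context {R : realType} {d : nat} {Omega : set 'rV[R]_d} (oO : open Omega).
Notation mu := (domain_measure oO).
Notation S := (sym R d).
Notation stress := (L2 mu S).

(** The symmetric gradient as a bounded operator into the stresses, so that strains live in a
    Hilbert space and [H1_map] applies. *)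
Definition sym_grad_map (u : H1_domain oO) : stress :=
  L2_map (fun G : eucl R d d => sym_part G) (H1_domain_grad u).

Lemma sym_grad_map_bounded_linear : bounded_linear sym_grad_map 1.
Proof.
have [_ lB bB] := L2_map_bounded_linear mu (@sym_part_bounded_linear R d).
split=> // [a u v|u]; first exact: (lB a (H1_domain_grad u) (H1_domain_grad v)).
rewrite mul1r; apply: (le_trans (bB (H1_domain_grad u))); rewrite mul1r.
rewrite -(@ler_pXn2r _ 2)// ?nnegrE//.
have -> : `|u| = Num.sqrt (`|H1_domain_fun u| ^+ 2 + `|H1_domain_grad u| ^+ 2) by [].
by rewrite sqr_sqrtr ?addr_ge0 ?sqr_ge0// lerDr sqr_ge0.
Qed.

Lemma sym_grad_mapE u :
  {ae mu, forall x, sym_grad_map u x = sym_grad u x}.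
Proof. exact: L2_mapE (@sym_part_bounded_linear R d) (H1_domain_grad u). Qed.

Lemma strongly_measurable_sym_grad (u : H1_domain oO) :
  strongly_measurable (sym_grad u : borel_rV R d -> S).
Proof.
have [] // := is_L2_bounded_linear (@sym_part_bounded_linear R d)
  (L2_reprP (H1_domain_grad u)).
Qed.

Variables (A : {linear S -> S}) (GammaD : set 'rV[R]_d) (K : set S).
Variables (clK : closed K) (cvK : @convex_set R S K).

Definition EK : set stress := in_equilibrium GammaD `&` plastically_admissible K.

(** Equilibrium as orthogonality to symmetric gradients, from which closedness and convexity are
    immediate. *)
Lemma equilibriumE (tau : stress) : in_equilibrium GammaD tau <->
  forall phi, H1_D GammaD phi -> ip tau (sym_grad_map phi) = 0.
Proof.
have e phi : ip tau (sym_grad_map phi) = \int[mu]_x frob (tau x) (sym_grad phi x).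
  exact: (L2_ipE (L2_strongly_measurable tau) (strongly_measurable_sym_grad phi)
    (aeW mu (fun x => erefl)) (sym_grad_mapE phi)).
by split=> h phi /h; rewrite e.
Qed.

Lemma EK_closed : seq_closed EK.
Proof.
move=> u l hu ul; split.
  apply/equilibriumE => phi hphi; apply: cvg_filter_unique (cvg_ipl (w := sym_grad_map phi) ul) _.
  rewrite (_ : (fun n => _) = fun=> 0); first exact: cvg_cst.
  by apply/funext => n; have [/equilibriumE /(_ _ hphi)] := hu n.
have cK : seq_closed K.
  by move=> v m Kv vm; apply: (closed_cvg K clK _ _ vm); exact: nearW.
by apply: (ae_constraint_closed cK) ul => n; have [] := hu n.
Qed.

Lemma EK_convex : seg_convex EK.
Proof.
move=> u v t [eu Ku] [ev Kv] t01; split.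
  apply/equilibriumE => phi hphi; move/equilibriumE: eu => /(_ _ hphi) eu.
  move/equilibriumE: ev => /(_ _ hphi) ev.
  by rewrite ipDl ipZl ipBl eu ev subrr mulr0 addr0.
have cK : seg_convex K.
  move=> x y s Kx Ky /andP[s0 s1].
  have := cvK (Itv01 s0 s1) (mem_set Ky) (mem_set Kx); rewrite inE.
  rewrite [X in K X](_ : _ = x + s *: (y - x))//=.
  by rewrite /conv/= scalerBl scale1r scalerBr addrCA.
exact: (ae_constraint_convex cK) Ku Kv t01.
Qed.

Context (T : R) (T0 : 0 < T).
Variables (sigma0 : stress) (sigma : H1_time T stress) (uD : H1_time T (H1_domain oO)).

Lemma stress_productE (dsigma tau s : stress) (u : H1_domain oO) :
  \int[mu]_x frob (A (dsigma x) - sym_grad u x) (tau x - s x) =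
  ip (L2_map A dsigma - sym_grad_map u) (tau - s).
Proof.
have [N bA] := linear_sym_bounded A.
have [mA _] := is_L2_bounded_linear bA (L2_reprP dsigma).
have mf := strongly_measurableB mA (strongly_measurable_sym_grad u).
have mg := strongly_measurableB (L2_strongly_measurable tau) (L2_strongly_measurable s).
have fE : {ae mu, forall x, L2_repr (L2_map A dsigma - sym_grad_map u) x =
    A (dsigma x) - sym_grad u x}.
  apply: filterS3 (L2_reprB (L2_map A dsigma) (sym_grad_map u)) (L2_mapE bA dsigma)
    (sym_grad_mapE u) => x -> -> -> //.
by rewrite (L2_ipE mf mg fE (L2_reprB tau s)).
Qed.

(** The integral over the domain is an inner product of stresses, and the strain rate is the image
    of the displacement rate at almost every time. *)
Lemma reduced_solutionP : reduced_solution A GammaD K sigma0 sigma uD <->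
  evolution_solution (L2_map A) EK sigma0 (H1_map sym_grad_map_bounded_linear uD) sigma.
Proof.
have z1 : 0 <= (0 : R) <= T by rewrite lexx ltW.
have dE : {ae time_measure T, forall t : measurableTypeR R,
    H1_time_dot (H1_map sym_grad_map_bounded_linear uD) t = sym_grad_map (H1_time_dot uD t)}.
  exact: (L2_mapE sym_grad_map_bounded_linear).
split=> -[h0 h]; split.
- by apply/(H1_time_atP T0 _ _ z1).
- apply: filterS2 dE h => t -> [Ct ht]; split=> // tau /ht.
  by rewrite stress_productE.
- by apply/(H1_time_atP T0 _ _ z1).
- apply: filterS2 dE h => t -> [Ct ht]; split=> // tau /ht.
  by rewrite stress_productE.
Qed.

End stress_space.

(** * Existence of an optimal control *)

Section compactness.
Context {R : realType}.

(** Otherwise some subsequence would stay at a distance [e] from [l]. It upgrades compactness, when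
    a weak limit is already known, to convergence of the whole sequence. *)
Lemma cvg_subsubseq (V : normedModType R) (u : nat -> V) (l : V) :
  (forall k : nat -> nat, (forall n, (n <= k n)%N) ->
    exists m : nat -> nat, (forall n, (n <= m n)%N) /\ u (k (m n)) @[n --> \oo] --> l) ->
  u n @[n --> \oo] --> l.
Proof.
move=> h; apply/cvg_seqP => e e0; apply: contrapT => hN.
have far n : exists m, (n <= m)%N /\ e <= `|u m - l|.
  apply: contrapT => hn; apply: hN; exists n => m nm; rewrite ltNge; apply/negP => em.
  by apply: hn; exists m.
have [k hk] := choice far; have [m [_ /cvg_seqP /(_ e e0) [N /(_ N (leqnn N))]]] :=
  h k (fun n => proj1 (hk n)).
by rewrite ltNge; have [_ ->] := hk (m N).
Qed.

Lemma compact_cvg_subseq (V : normedModType R) (C : set V) (u : nat -> V) :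
  compact C -> (forall n, C (u n)) -> exists (z : V) (k : nat -> nat), (forall n, (n <= k n)%N) /\
    u (k n) @[n --> \oo] --> z.
Proof.
move=> cC Cu; have [z [_ hz]] : (C `&` cluster (fmap u \oo)) !=set0.
  by apply: cC; exists 0%N => // n _; exact: Cu.
have near_z n : exists m, (n <= m)%N /\ `|u m - z| <= n.+1%:R^-1.
  have hA : fmap u \oo [set u m | m in [set m | (n <= m)%N]].
    by exists n => // m nm; exists m.
  have n0 : (0 : R) < n.+1%:R^-1 by rewrite invr_gt0.
  have [_ [[m nm <-] hm]] := hz _ _ hA (nbhsx_ballx z _ n0).
  by exists m; split=> //; rewrite distrC; move: hm; rewrite -ball_normE => /ltW.
have [k hk] := choice near_z; exists z, k; split=> [n|]; first by have [] := hk n.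
apply: (cvg_seq_norm_le (d := fun n => n.+1%:R^-1)) => [n|]; first by have [] := hk n.
exact: cvg_inv_succ.
Qed.

(* Weak limits are only used in the two Hilbert spaces; the intermediate space
   may be any normed space. *)
Lemma compact_embedding_cvg {V X H : normedModType R} {hV : hilbert V} {hH : hilbert H}
  (iota : {linear V -> X}) (B : X -> H) (M N : R) (x_ : nat -> V) (x : V) :
  compact (closure (iota @` [set v | `|v| <= 1])) -> bounded_linear B M ->
  continuous iota -> wcvg x_ x -> (forall n, `|x_ n| <= N) ->
  B (iota (x_ n)) @[n --> \oo] --> B (iota x).
Proof.
move=> ciota bB coniota wx xN; apply: cvg_subsubseq => k kn.
have [L bi] := continuous_linear_bounded_linear coniota.
have N0 : 0 < N + 1 by rewrite ltr_wpDl// (le_trans _ (xN 0%N)).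
have inC n : closure (iota @` [set v | `|v| <= 1]) (iota ((N + 1)^-1 *: x_ (k n))).
  apply: subset_closure; exists ((N + 1)^-1 *: x_ (k n)) => //=.
  rewrite normrZ ger0_norm ?invr_ge0 ?(ltW N0)// ler_pdivrMl// mulr1.
  by rewrite (le_trans (xN _))// lerDl.
have [z [m [mn hz]]] := compact_cvg_subseq ciota inC; exists m; split=> //.
have hz' := bounded_linear_cvg bB hz.
have bBi := bounded_linear_comp bi bB.
have e n : B (iota (x_ (k (m n)))) = (N + 1) *: B (iota ((N + 1)^-1 *: x_ (k (m n)))).
  have /= := bounded_linearZ bBi (N + 1)^-1 (x_ (k (m n))).
  by move=> ->; rewrite scalerA mulfV ?gt_eqF// scale1r.
have hs : B (iota (x_ (k (m n)))) @[n --> \oo] --> (N + 1) *: B z.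
  by under eq_fun do rewrite e; apply: cvgZl_tmp.
suff -> : B (iota x) = (N + 1) *: B z by [].
have kmn n : (n <= k (m n))%N by rewrite (leq_trans (mn n)).
pose proof (bounded_linear_wcvg bBi (wcvg_subseq kmn wx)) as w1.
pose proof (cvg_wcvg hs) as w2.
exact: wcvg_unique w1 w2.
Qed.

Lemma H1_map_compact_cvg (T : R) (T0 : 0 < T) {V H : normedModType R} {hV : hilbert V} {hH : hilbert H}
  (B : V -> H) (M N : R) (bB : bounded_linear B M) (l_ : nat -> H1_time T V) (l : H1_time T V) :
  (forall (x_ : nat -> V) x K, wcvg x_ x -> (forall n, `|x_ n| <= K) ->
     B (x_ n) @[n --> \oo] --> B x) ->
  @wcvg _ _ (@H1_hilbert R T T0 V hV) l_ l -> (forall n, `|l_ n| <= N) ->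
  H1_time_fun (H1_map bB (l_ n)) @[n --> \oo] --> H1_time_fun (H1_map bB l).
Proof.
move=> compB wl lN; have z1 : 0 <= (0 : R) <= T by rewrite lexx ltW.
have tb t n : 0 <= t <= T -> `|H1_trace (l_ n) t| <= trace_bound T * N.
  move=> t0T; apply: (le_trans (H1_trace_le T0 _ t0T)); rewrite ler_wpM2l//.
  by have [] := H1_trace_bounded_linear T0 (V := V) t0T.
have ct t : 0 <= t <= T -> B (H1_trace (l_ n) t) @[n --> \oo] --> B (H1_trace l t).
  move=> t0T; apply: (compB _ _ (trace_bound T * N)) => [|n]; last exact: tb.
  exact: (@bounded_linear_wcvg _ _ _ _ _ (H1_trace_bounded_linear T0 t0T)
    (@H1_hilbert R T T0 V hV) hV _ _ wl).
have fE (W : H1_time T V) : {ae time_measure T, forall t : measurableTypeR R,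
    H1_time_fun (H1_map bB W) t = B (H1_trace W t) /\ 0 < t < T}.
  have ht : {ae time_measure T, forall t : measurableTypeR R, 0 < t < T} by exact: ae_time.
  pose proof (H1_trace_ae T0 W) as h1.
  have h2 : {ae time_measure T, forall t : measurableTypeR R,
    H1_time_fun (H1_map bB W) t = B (H1_time_fun W t)} by exact: L2_mapE bB (H1_time_fun W).
  by apply: filterS3 h1 h2 ht => t <- <-.
(* The norm bound passes to the weak limit, so the same [K] also dominates the limit function. *)
have lN' : `|l| <= N := @wcvg_norm_le _ _ (@H1_hilbert R T T0 V hV) _ _ _ wl lN.
have [M0 _ hM] := bB; have [b0 _ _] := H1_trace_bounded_linear T0 (V := V) z1.
pose K := M * (trace_bound T * N).
have bnd (W : H1_time T V) t : 0 <= t <= T -> `|W| <= N -> `|B (H1_trace W t)| <= K.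
  move=> t0T WN; apply: (le_trans (hM _)); rewrite ler_wpM2l//.
  by apply: (le_trans (H1_trace_le T0 _ t0T)); rewrite ler_wpM2l.
have K0 : 0 <= K by apply: le_trans (bnd l 0 z1 lN').
clearbody K.
apply: (L2_dominated (integrable_cst (time_fin T0) ((2 * K) ^+ 2))).
  have hn := ae_foralln (fun n => fE (l_ n)).
  apply: filterS2 (fE l) hn => t [-> /andP[t0 tT]] hn'.
  have t0T : 0 <= t <= T by rewrite !ltW.
  by under eq_fun do rewrite (proj1 (hn' _)); exact: ct.
move=> n; apply: filterS2 (fE (l_ n)) (fE l) => t [-> /andP[t0 tT]] [-> _].
have t0T : 0 <= t <= T by rewrite !ltW.
rewrite ler_pXn2r ?nnegrE ?mulr_ge0//.
by apply: (le_trans (ler_normB _ _)); rewrite mulr_natl mulr2n lerD ?bnd.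
Qed.

End compactness.

(** * The direct method for pairs of state and control *)

Section direct_method.
Context {R : realType} {V W Y : normedModType R} {hV : hilbert V} {hW : hilbert W} {hY : hilbert Y}.

(** The product carries the maximum norm, which does not come from an inner product, so a functional
    is split into its restrictions to the factors and each is represented there. *)
Lemma wcvg_pair (u_ : nat -> V) (w_ : nat -> W) u w : wcvg u_ u -> wcvg w_ w ->
  weak_cvg (fun n => (u_ n, w_ n)) (u, w).
Proof.
move=> hu hw f cf; have [M [M0 lf bf]] := continuous_linear_bounded_linear cf.
have fE x y : f (x, y) = f (x, 0) + f (0, y).
  by rewrite -linearD/=; congr (f (_, _)); rewrite ?addr0 ?add0r.
have l1 : linear_form (fun x => f (x, 0)).
  move=> k x y; have -> : (k *: x + y, 0) = k *: (x, 0) + (y, 0) :> V * W.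
    by congr pair; rewrite /= scaler0 addr0.
  exact: lf.
have l2 : linear_form (fun y => f (0, y)).
  move=> k x y; have -> : (0, k *: x + y) = k *: (0, x) + (0, y) :> V * W.
    by congr pair; rewrite /= scaler0 addr0.
  exact: lf.
have b1 x : `|f (x, 0)| <= M * `|x|.
  by rewrite (le_trans (bf _))// ler_wpM2l// prod_normE/= normr0 ge_max lexx normr_ge0.
have b2 y : `|f (0, y)| <= M * `|y|.
  by rewrite (le_trans (bf _))// ler_wpM2l// prod_normE/= normr0 ge_max lexx normr_ge0.
rewrite fE; under eq_fun do rewrite fE.
by apply: (@cvg_seqD R R); [exact: wcvg_linear_form l1 b1 hu|exact: wcvg_linear_form l2 b2 hw].
Qed.

(** Admissible pairs are to be bounded in terms of [D l] only, because [Psi] is merely bounded below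
    and [D l] is all that the cost controls. *)
Lemma direct_method (Adm : V -> W -> Prop) (D : W -> Y) (M alpha m : R) (Psi : V * W -> R) :
  bounded_linear D M -> 0 < alpha -> weakly_lsc Psi -> (forall z, m <= Psi z) ->
  (exists s l, Adm s l) ->
  (forall K, exists N, forall s l, Adm s l -> `|D l| <= K -> `|s| <= N /\ `|l| <= N) ->
  (forall s_ l_ s l N, (forall n, Adm (s_ n) (l_ n)) -> wcvg s_ s -> wcvg l_ l ->
     (forall n, `|s_ n| <= N) -> (forall n, `|l_ n| <= N) -> Adm s l) ->
  exists s l, Adm s l /\ forall s' l', Adm s' l' ->
    Psi (s, l) + alpha / 2 * `|D l| ^+ 2 <= Psi (s', l') + alpha / 2 * `|D l'| ^+ 2.
Proof.
move=> bD a0 lsc hm [s0 [l0 adm0]] bnd clo.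
pose J z := Psi z + alpha / 2 * `|D z.2| ^+ 2.
have a2 : 0 < alpha / 2 by rewrite divr_gt0.
have Jm z : m <= J z by rewrite (le_trans (hm z))// lerDl mulr_ge0 ?sqr_ge0// ltW.
pose E := [set J z | z in [set z | Adm z.1 z.2]].
have lbE : lbound E m by move=> _ [z _ <-]; exact: Jm.
have E0 : E (J (s0, l0)) by exists (s0, l0).
have infE : has_inf E by split; [exists (J (s0, l0))|exists m].
have ex n : exists z, Adm z.1 z.2 /\ J z < inf E + n.+1%:R^-1.
  have n0 : (0 : R) < n.+1%:R^-1 by rewrite invr_gt0.
  by have [_ [z hz <-] hJ] := inf_adherent n0 infE; exists z.
have [z hz] := choice ex.
(* The minimizing pairs cost at most [inf E + 1], of which [Psi] takes at least [m]. *)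
pose K := Num.sqrt ((alpha / 2)^-1 * (inf E + 1 - m)).
have DK n : `|D (z n).2| <= K.
  have h : `|D (z n).2| ^+ 2 <= (alpha / 2)^-1 * (inf E + 1 - m).
    rewrite ler_pdivlMl// lerBrDr; have [_ /ltW h] := hz n.
    apply: (@le_trans _ _ (J (z n))); first by rewrite addrC lerD2r.
    by apply: (le_trans h); rewrite lerD2l invf_le1// ler1n.
  by rewrite -[leLHS]normr_id -sqrtr_sqr ler_wsqrtr.
have [N hN] := bnd K.
have bN n : `|(z n).1| <= N /\ `|(z n).2| <= N by apply: hN => //; have [] := hz n.
have [k1 [l [k1n wl]]] := bounded_wcvg_subseq (fun n => proj2 (bN n)).
have [k2 [s [k2n ws]]] := bounded_wcvg_subseq (fun n => proj1 (bN (k1 n))).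
pose proof (wcvg_subseq k2n wl) as wl2.
have kn n : (n <= k1 (k2 n))%N by rewrite (leq_trans (k2n n)).
have adm : Adm s l.
  apply: (clo (fun n => (z (k1 (k2 n))).1) (fun n => (z (k1 (k2 n))).2) s l N) => // n.
  - by have [] := hz (k1 (k2 n)).
  - by have [] := bN (k1 (k2 n)).
  - by have [] := bN (k1 (k2 n)).
exists s, l; split=> // s' l' adm'.
apply: (@le_trans _ _ (inf E)); last by apply: ge_inf; [exists m|exists (s', l')].
have wp := wcvg_pair ws wl2.
pose proof (bounded_linear_wcvg bD wl2) as wD.
(* The square is replaced by its tangent at [D l], affine in the weakly convergent argument; moved
   to the side of the costs it leaves [Psi] alone under the lower limit. *)
have hc : inf E + (k1 (k2 n)).+1%:R^-1 - alpha / 2 * (2 * ip (D (z (k1 (k2 n))).2) (D l) - `|D l| ^+ 2)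
    @[n --> \oo] --> inf E + 0 - alpha / 2 * (2 * `|D l| ^+ 2 - `|D l| ^+ 2).
  apply: (@cvg_seqB R R); first apply: (@cvg_seqD R R); [exact: cvg_cst| |].
    exact: (@cvg_seq_subseq R R (fun n => n.+1%:R^-1) 0 (fun n => k1 (k2 n)) kn (@cvg_inv_succ R)).
  apply: cvg_seqMl; apply: (@cvg_seqB R R); last exact: cvg_cst.
  by apply: cvg_seqMl; rewrite -ip_norm; exact: wD.
apply/ler_addgt0Pr => e e0.
have [N1 hN1] := (proj1 (@cvg_seqP R R _ _) hc) e e0.
have le_liminf : ((Psi (s, l))%:E <= (inf E + e - alpha / 2 * `|D l| ^+ 2)%:E)%E.
  apply: (le_trans (lsc _ _ wp)); apply: limn_einf_le; exists N1 => n /hN1.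
  rewrite ltr_norml lee_fin => /andP[_ h1].
  have [_ h2] := hz (k1 (k2 n)).
  have h3 : 2 * ip (D (z (k1 (k2 n))).2) (D l) - `|D l| ^+ 2 <= `|D (z (k1 (k2 n))).2| ^+ 2.
    have := sqr_ge0 `|D (z (k1 (k2 n))).2 - D l|; rewrite norm_sqrB; lra.
  have h4 : alpha / 2 * (2 * ip (D (z (k1 (k2 n))).2) (D l) - `|D l| ^+ 2) <=
            alpha / 2 * `|D (z (k1 (k2 n))).2| ^+ 2 by rewrite ler_pM2l.
  rewrite /= -surjective_pairing; move: h1 h2 h4; rewrite /J.
  by move: (_.+1%:R^-1) => q; lra.
by move: le_liminf; rewrite lee_fin; lra.
Qed.

End direct_method.

Lemma L2_map_coercive {dT} {X : measurableType dT} {R : realType}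
  (mu : {measure set X -> \bar R}) {V : normedModType R} {hV : hilbert V}
  (B : V -> V) (M c : R) : bounded_linear B M ->
  (forall x, c * `|x| ^+ 2 <= ip (B x) x) ->
  forall u : L2 mu V, c * `|u| ^+ 2 <= ip (L2_map B u) u.
Proof.
move=> bB coB u; rewrite -subr_ge0 -ip_norm -ipZl -ipBl; apply: L2_ip_ge0.
apply: filterS3 (L2_reprB (L2_map B u) (c *: u)) (L2_mapE bB u) (L2_reprZ c u) => x -> -> ->.
by rewrite ipBl ipZl ip_norm subr_ge0.
Qed.

(** * The control problem in terms of the strain *)

Section control_problem.
Context {R : realType} {d : nat} {Omega : set 'rV[R]_d} (oO : open Omega).
Context (T : R) (T0 : 0 < T) {X Xc : normedModType R} {hXc : hilbert Xc}.
Notation stress := (L2 (domain_measure oO) (sym R d)).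
Notation E := (@sym_grad_map R d Omega oO).
Notation bE := (@sym_grad_map_bounded_linear R d Omega oO).
Variables (G : {linear X -> H1_domain oO}) (iota : {linear Xc -> X}) (MG Mi : R).
Hypotheses (bG : bounded_linear G MG) (bi : bounded_linear iota Mi).
Variable a : H1_time T (H1_domain oO).
Notation bGi := (bounded_linear_comp bi bG).
Notation bS := (bounded_linear_comp bGi bE).
Notation mu := (time_measure T).
Implicit Types (l : H1_time T Xc) (uD : H1_time T (H1_domain oO)).

Definition strain l : H1_time T stress := H1_map bS l + H1_map bE a.

(** The Dirichlet data prescribe only the function; by [H1_ext] this fixes the strain together with
    its rate, whatever [uD] is chosen. *)
Lemma dirichlet_strain l uD : dirichlet_data G iota a l uD -> H1_map bE uD = strain l.
Proof.
move=> hd; apply: (H1_ext T0).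
have e : {ae mu, forall t : measurableTypeR R, H1_time_fun (strain l) t =
    E (G (iota (H1_time_fun l t))) + E (H1_time_fun a t)}.
  apply: filterS3 (L2_reprD (L2_map (E \o (G \o iota)) (H1_time_fun l)) (L2_map E (H1_time_fun a)))
    (L2_mapE bS (H1_time_fun l)) (L2_mapE bE (H1_time_fun a)) => t h1 h2 h3.
  by rewrite -[E (G _)]h2 -h3 -h1.
apply: L2_ae_eq (L2_mapE bE (H1_time_fun uD)) _.
apply: filterS2 e hd => t -> ->.
by rewrite (bounded_linearD bE).
Qed.

Lemma dirichlet_exists l : exists uD, dirichlet_data G iota a l uD.
Proof.
exists (H1_map bGi l + a).
by apply: filterS2 (L2_reprD (L2_map (G \o iota) (H1_time_fun l)) (H1_time_fun a))
  (L2_mapE bGi (H1_time_fun l)) => t h1 h2; rewrite [LHS]h1 h2.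
Qed.

(** Eliminates the displacement: the state sees the control only through [strain l], an affine and
    weakly continuous function of [l]. *)
Lemma admissibleP (A : {linear sym R d -> sym R d}) GammaD K (sigma0 : stress) sigma l :
  admissible G iota a A GammaD K sigma0 sigma l <->
  [/\ H1_trace l 0 = 0, H1_trace l T = 0 &
      evolution_solution (L2_map A) (EK GammaD K) sigma0 (strain l) sigma].
Proof.
have z1 : 0 <= (0 : R) <= T by rewrite lexx ltW.
have T1 : 0 <= T <= T by rewrite lexx ltW.
have h10 : H10_time l <-> H1_trace l 0 = 0 /\ H1_trace l T = 0.
  by split=> -[/(H1_time_atP T0 _ _ z1) ? /(H1_time_atP T0 _ _ T1) ?].
split=> [[/h10 [l0 lT] [uD [/dirichlet_strain <- /(reduced_solutionP A GammaD K T0)]]]//|[l0 lT hs]].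
split; first exact/h10.
have [uD hd] := dirichlet_exists l; exists uD; split=> //.
by apply/(reduced_solutionP A GammaD K T0); rewrite (dirichlet_strain hd).
Qed.

Lemma strain_trace l t : 0 <= t <= T ->
  H1_trace (strain l) t = E (G (iota (H1_trace l t))) + H1_trace (H1_map bE a) t.
Proof.
move=> t0T; rewrite (bounded_linearD (H1_trace_bounded_linear T0 t0T)).
by rewrite (H1_map_trace T0 bS).
Qed.

Lemma strain_le l : `|strain l| <= (1 * (MG * Mi)) * `|l| + `|H1_map bE a|.
Proof.
apply: (le_trans (ler_normD _ _)); rewrite lerD2r.
by have [_ _] := H1_map_bounded_linear T bS; exact.
Qed.

Lemma strain_wcvg (l_ : nat -> H1_time T Xc) l : @wcvg _ _ (H1_hilbert T0) l_ l ->
  @wcvg _ _ (H1_hilbert T0) (fun n => strain (l_ n)) (strain l).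
Proof.
move=> wl; pose proof (@bounded_linear_wcvg _ _ _ _ _ (H1_map_bounded_linear T bS)
  (H1_hilbert T0) (H1_hilbert T0) _ _ wl) as h.
by apply: wcvgD => //; apply: cvg_wcvg; exact: cvg_cst.
Qed.

Lemma strain_cvg (l_ : nat -> H1_time T Xc) l (N : R) : compact (closure (iota @` [set v | `|v| <= 1])) ->
  continuous iota -> @wcvg _ _ (H1_hilbert T0) l_ l -> (forall n, `|l_ n| <= N) ->
  H1_time_fun (strain (l_ n)) @[n --> \oo] --> H1_time_fun (strain l).
Proof.
move=> ci coni wl lN.
have hc := H1_map_compact_cvg (bB := bS) _ wl lN.
have e l' : H1_time_fun (strain l') = H1_time_fun (H1_map bS l') + H1_time_fun (H1_map bE a).
  exact: (bounded_linearD (@H1_fun_bounded_linear R T stress)).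
rewrite e; under eq_fun do rewrite e.
apply: cvg_seqD; last exact: cvg_cst.
apply: hc => x_ x M wx xM.
have bEG := bounded_linear_comp bG bE.
pose proof (compact_embedding_cvg ci bEG coni wx xM) as h; exact: h.
Qed.

Lemma strain_bounded (l_ : nat -> H1_time T Xc) (N : R) : (forall n, `|l_ n| <= N) ->
  exists B, forall n, `|strain (l_ n)| <= B.
Proof.
move=> lN; exists ((1 * (MG * Mi)) * N + `|H1_map bE a|) => n.
have [M0 _ _] := bS; apply: le_trans (strain_le (l_ n)) _.
by rewrite lerD2r; apply: ler_wpM2l M0 _ _ (lN n).
Qed.

End control_problem.

Theorem theorem4p4 (R : realType) (T : R) (d : nat)
    (Omega GammaD GammaN : set 'rV[R]_d) (Omega_open : open Omega)
    (K : set (sym R d)) (C A : {linear sym R d -> sym R d})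
    (sigma0 : L2 (domain_measure Omega_open) (sym R d)) (pbar : R)
    (X Xc : completeNormedModType R) (iota : {linear Xc -> X})
    (G : {linear X -> H1_domain Omega_open}) (a : H1_time T (H1_domain Omega_open))
    (alpha : R)
    (Psi : (H1_time T (L2 (domain_measure Omega_open) (sym R d)) *
            H1_time T Xc)%type -> R) :
  0 < T -> (2 <= d)%N ->
  Omega !=set0 -> connected Omega -> bounded_set Omega ->
  lipschitz_boundary Omega ->
  GammaD `&` GammaN = set0 -> GammaD `|` GammaN = boundary Omega ->
  (exists2 O, open O & GammaN = boundary Omega `&` O) ->
  (exists2 F, closed F & GammaD = boundary Omega `&` F) ->
  (0 < hausdorff_measure d.-1 GammaD)%E ->
  groger_regular Omega GammaN ->
  sym_coercive C -> cancel C A -> cancel A C ->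
  closed K -> @convex_set R (sym R d) K ->
  in_equilibrium GammaD sigma0 -> plastically_admissible K sigma0 ->
  2 < pbar -> ('N[domain_measure Omega_open]_pbar%:E[normE sigma0] < +oo)%E ->
  is_hilbert Xc -> compact_embedding iota ->
  continuous G ->
  0 < alpha ->
  weakly_lsc Psi -> continuous Psi -> (exists m, forall z, m <= Psi z) ->
  exists sigma l,
    admissible G iota a A GammaD K sigma0 sigma l /\
    forall sigma' l', admissible G iota a A GammaD K sigma0 sigma' l' ->
      cost alpha Psi sigma l <= cost alpha Psi sigma' l'.
Proof.
move=> T0 _ _ _ _ _ _ _ _ _ _ _ coC _ AK clK cvK eq0 adm0 _ _ [ipX [ipXC ipXl ipXn]].
move=> [_ conti comi] conG a0 lsc _ [m hm].
have bil : sym_bilinear ipX by split=> // w k u v; exact: ipXl.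
pose hX : hilbert Xc := Hilbert bil ipXn (@completeNormedMod_cauchy_complete R Xc).
have [sA [c c0 coA]] := sym_coercive_inverse coC AK.
have [MA bA] := linear_sym_bounded A.
have [MG bG] := continuous_linear_bounded_linear conG.
have [Mi bi] := continuous_linear_bounded_linear conti.
pose mu := domain_measure Omega_open.
pose stress := L2 mu (sym R d).
pose proof (L2_map_bounded_linear mu bA) as bAA.
have sAA (u v : stress) : ip (L2_map A u) v = ip u (L2_map A v) by exact: (L2_map_ip u v bA bA sA).
pose proof (L2_map_coercive (mu := mu) bA coA) as coAA.
pose proof (EK_closed (oO := Omega_open) (GammaD := GammaD) clK) as clE.
pose proof (EK_convex (oO := Omega_open) (GammaD := GammaD) cvK) as cvE.
have s0E : EK GammaD K sigma0 by [].
have z1 : 0 <= (0 : R) <= T by rewrite lexx ltW.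
have T1 : 0 <= T <= T by rewrite lexx ltW.
have adm := admissibleP T0 bG bi a A GammaD K sigma0.
pose Adm s l := admissible G iota a A GammaD K sigma0 s l.
have [|K1|s_ l_ s l N|s [l [hs hmin]]] := @direct_method R _ _ _
  (H1_hilbert T0) (@H1_hilbert _ _ T0 _ hX) (@L2_hilbert _ _ _ _ _ hX)
  Adm (@H1_time_dot R T Xc) 1 alpha m Psi
  (@H1_dot_bounded_linear R T Xc) a0 lsc hm; last by exists s, l.
(* Feasible pair: the zero control with the solution driven by the strain of [a] alone. *)
- have [s hs _] := evolution_exists T0 bAA sAA c0 coAA clE cvE s0E (strain bG bi a 0).
  exists s, 0; apply/adm; split=> //.
    exact: (bounded_linear0 (H1_trace_bounded_linear T0 z1)).
  exact: (bounded_linear0 (H1_trace_bounded_linear T0 T1)).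
(* [L] bounds the controls, whose rates are bounded by [K1] and which start from 0; [S] bounds the
   strains, and the stress bound combines the fixed initial value with the rate bound [c^-1 * S]. *)
- pose L := (T + 1) * K1; pose S := (1 * (MG * Mi)) * L + `|H1_map (@sym_grad_map_bounded_linear R d Omega Omega_open) a|.
  exists (Num.max L (Num.sqrt T * `|sigma0| + (T + 1) * (c^-1 * S))) => s l /adm [l0 lT hs] hl.
  have T1p : 0 <= T + 1 by rewrite addr_ge0// ltW.
  have lL : `|l| <= L.
    by apply: (le_trans (H1_norm_le T0 l)); rewrite l0 normr0 mulr0 add0r ler_wpM2l.
  have ci : 0 <= c^-1 by rewrite invr_ge0 ltW.
  have [M0 _ _] := bounded_linear_comp (bounded_linear_comp bi bG) (@sym_grad_map_bounded_linear R d Omega Omega_open).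
  have sS : `|s| <= Num.sqrt T * `|sigma0| + (T + 1) * (c^-1 * S).
    apply: (le_trans (H1_norm_le T0 s)); have [-> _] := hs; rewrite lerD2l ler_wpM2l//.
    apply: (le_trans (evolution_bound T0 bAA sAA c0 coAA clE cvE s0E hs)); rewrite ler_wpM2l//.
    have [_ _ bD] := @H1_dot_bounded_linear R T stress.
    apply: (le_trans (bD _)); rewrite mul1r (le_trans (strain_le bG bi a l))// lerD2r.
    by rewrite ler_wpM2l.
  by rewrite !le_max lL sS orbT.
- move=> hadm ws wl bs bl.
  have tr t : 0 <= t <= T -> (forall n, H1_trace (l_ n) t = 0) -> H1_trace l t = 0.
    move=> t0T h.
    pose proof (@bounded_linear_wcvg _ _ _ _ _ (H1_trace_bounded_linear T0 t0T)
      (H1_hilbert T0) hX _ _ wl) as w.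
    apply: wcvg_unique w _; apply: cvg_wcvg; rewrite /comp.
    by under eq_fun do rewrite h; exact: cvg_cst.
  have l0 : H1_trace l 0 = 0 by apply: tr => // n; have /adm [] := hadm n.
  have lT : H1_trace l T = 0 by apply: tr => // n; have /adm [] := hadm n.
  (* At such a time the strain is that of [a], the same along the sequence and in the limit. *)
  have trS t : 0 <= t <= T -> (forall n, H1_trace (l_ n) t = 0) ->
      H1_trace (strain bG bi a (l_ n)) t @[n --> \oo] --> H1_trace (strain bG bi a l) t.
    move=> t0T h; have e n : H1_trace (strain bG bi a (l_ n)) t = H1_trace (strain bG bi a l) t.
      by rewrite !(strain_trace T0)// h tr.
    under eq_fun do rewrite e.
    exact: cvg_cst.
  have [B hB] := strain_bounded bG bi a bl.
  apply/adm; split; [exact: l0|exact: lT|].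
  apply: (evolution_closed (T0 := T0) bAA sAA c0 coAA clE cvE s0E (un := s_)
    (Un := fun n => strain bG bi a (l_ n)) (N := Num.max N B)).
  + by move=> n; have /adm [] := hadm n.
  + exact: ws.
  + exact: strain_wcvg.
  + by move=> n; apply: le_trans (bs n) _; rewrite le_max lexx.
  + by move=> n; apply: le_trans (hB n) _; rewrite le_max lexx orbT.
  + exact: strain_cvg comi conti wl bl.
  + apply: trS; first exact: z1.
    by move=> n; have /adm [] := hadm n.
  + apply: trS; first exact: T1.
    by move=> n; have /adm [] := hadm n.
Qed.
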